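(* Let $\mathcal{S}=\langle S,+,\cdot,\mathbb{0},\mathbb{1}\rangle$ be a semiring and let $\tau=\{R_1,\dots,R_j\}$ be a finite relational vocabulary. (i) The weighted logic $\mathrm{wESO}[\mathcal{S}]$ captures the class $\mathsf{NP}[\mathcal{S}]$ over finite ordered $\tau$-structures; that is: (1) for every $\mathrm{wESO}[\mathcal{S}]$-formula $\varphi$ there is a series $P\in\mathsf{NP}[\mathcal{S}]$ such that $P(\mathrm{enc}(\mathfrak{A}))=\|\varphi\|(\mathfrak{A})$ for every finite ordered $\tau$-structure $\mathfrak{A}$; and (2) for every $P\in\mathsf{NP}[\mathcal{S}]$ there is a $\mathrm{wESO}[\mathcal{S}]$-formula $\varphi$ such that $P(\mathrm{enc}(\mathfrak{A}))=\|\varphi\|(\mathfrak{A})$ for every finite ordered $\tau$-structure $\mathfrak{A}$. (ii) If moreover $\mathcal{S}$ is idempotent and commutative, then $\mathrm{wESO}[\mathcal{S}]$ captures $\mathsf{NP}[\mathcal{S}]$ in the same sense over all finite $\tau$-structures (not necessarily equipped with an order).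
   Context: A semiring $\mathcal{S}=\langle S,+,\cdot,\mathbb{0},\mathbb{1}\rangle$: $\langle S,+,\mathbb{0}\rangle$ is a commutative monoid, $\langle S,\cdot,\mathbb{1}\rangle$ a monoid, multiplication distributes over addition, and $s\cdot\mathbb{0}=\mathbb{0}\cdot s=\mathbb{0}$. It is commutative if $\cdot$ is commutative, idempotent if $s+s=s$ for all $s$. Weighted Turing machines. A weighted Turing machine over $\mathcal{S}$ and input alphabet $\Sigma$ is $\mathcal{M}=\langle Q,\Gamma,\Delta,\nu,q_0,F,\Box\rangle$ with finite state set $Q$, working alphabet $\Gamma\supseteq\Sigma$, transitions $\Delta\subseteq (Q\setminus F)\times\Gamma\times Q\times\Gamma\times\{-1,0,1\}$, weight function $\nu:\Delta\to S$, initial state $q_0$, accepting states $F\subseteq Q$, blank $\Box\in\Gamma\setminus\Sigma$. Configurations and one-step moves $C\to_e C'$ via a transition $e$ are as usual for (nondeterministic) Turing machines. A computation on $w\in\Sigma^*$ is a sequence $C_1e_1C_2\dots C_ne_nC_{n+1}$ with $C_k\to_{e_k}C_{k+1}$, where $C_1$ has state $q_0$, tape content $w$ and the head on the leftmost non-blank cell; its weight is $\nu(e_1)\cdots\nu(e_n)$; it is accepting if $C_{n+1}$ has a state in $F$. Machines are assumed finitely terminating (finitely many computations on each input). The behavior is $\|\mathcal{M}\|(w)=\sum$ of the weights of all accepting computations on $w$. $\mathsf{TIME}(\mathcal{M},n)$ is the maximal length of a computation of $\mathcal{M}$ on an input of length at most $n$. $\mathsf{NP}[\mathcal{S}]$ is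 the set of all series $\sigma:\Sigma^*\to S$ ($\Sigma$ any finite alphabet) with $\sigma=\|\mathcal{M}\|$ for some weighted Turing machine $\mathcal{M}$ over $\mathcal{S}$ and $\Sigma$ with $\mathsf{TIME}(\mathcal{M},n)=O(n^k)$ for some $k\in\mathbb{N}$. Structures and encodings. Structures are finite; an ordered $\tau$-structure is a $\tau\cup\{<\}$-structure with $<$ a linear order. For a structure $\mathfrak{A}$ with universe $A=\{0,\dots,n-1\}$ (identified via its order), $\mathrm{enc}(\mathfrak{A})=\mathrm{enc}(R_1^{\mathfrak{A}})\cdots\mathrm{enc}(R_j^{\mathfrak{A}})$, where for an $l$-ary $R_i$, $\mathrm{enc}(R_i^{\mathfrak{A}})$ is the $0/1$-string of length $n^l$ whose $m$-th symbol is $1$ iff the $m$-th tuple of $A^l$ (in lexicographic order) lies in $R_i^{\mathfrak{A}}$. Weighted second-order logic $\mathrm{wSO}[\mathcal{S}]$. Boolean formulas: $\beta::=\mathtt{false}\mid R(x_1,\dots,x_n)\mid X(x_1,\dots,x_n)\mid\neg\beta\mid\beta\lor\beta\mid\exists x.\beta\mid\exists X.\beta$ (with usual abbreviations, including the order symbol $<$ in the ordered case). Weighted formulas: $\varphi::=\beta\mid s\ (s\in S)\mid\varphi\oplus\varphi\mid\varphi\otimes\varphi\mid\bigoplus x.\varphi\mid\bigotimes x.\varphi\mid\bigoplus X.\varphi\mid\bigotimes X.\varphi$. Semantics for an assignment $\rho$: $\|\beta\|(\mathfrak{A},\rho)=\mathbb{1}$ if $(\mathfrak{A},\rho)\models\beta$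 and $\mathbb{0}$ otherwise; $\|s\|=s$; $\oplus,\otimes$ are interpreted by $+,\cdot$; $\|\bigoplus x.\varphi\|(\mathfrak{A},\rho)=\sum_{a\in A}\|\varphi\|(\mathfrak{A},\rho[x\to a])$; $\|\bigotimes x.\varphi\|(\mathfrak{A},\rho)=\prod_{i=1}^{k}\|\varphi\|(\mathfrak{A},\rho[x\to a_i])$ where $a_1,\dots,a_k$ enumerates $A$ in the order $<$ (when $\mathcal{S}$ is commutative the order of factors is irrelevant); $\|\bigoplus X.\varphi\|(\mathfrak{A},\rho)=\sum_{I\subseteq A^{\mathrm{ar}(X)}}\|\varphi\|(\mathfrak{A},\rho[X\to I])$; $\bigotimes X$ is the product over all $I\subseteq A^{\mathrm{ar}(X)}$ in the enumeration induced lexicographically by $<$. $\|\varphi\|(\mathfrak{A})$ denotes evaluation under the empty assignment. $\mathrm{wESO}[\mathcal{S}]$ is the fragment of $\mathrm{wSO}[\mathcal{S}]$ whose formulas have the form $\bigoplus X_1\cdots\bigoplus X_m.\psi$ where $\psi$ contains no second-order quantifiers.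
   Formalization: In (ii)(2), P ranges over series for which P(enc(A)) does not depend on the order used to list the universe; τ is assumed to contain a relation symbol of positive arity; and equality x = y is allowed as an atomic Boolean formula. *)

(* Defs.v *)
From HB Require Import structures.
From mathcomp Require Import all_boot all_order all_algebra.

Set Implicit Arguments.
Unset Strict Implicit.
Unset Printing Implicit Defensive.

Import GRing.Theory.
Local Open Scope ring_scope.

(** * Weighted Turing machines *)

(* A transition [(p, a, q, b, m)] rewrites [a] to [b], passes from state [p]
   to state [q] and moves the head by [m - 1], so that [m = 0, 1, 2] stands for
   the displacement -1, 0, 1. *)
Definition transition (Q G : Type) : Type := (Q * G * Q * G * 'I_3)%type.

Definition src (Q G : Type) (e : transition Q G) : Q :=
  let: (p, _, _, _, _) := e in p.

(* The working alphabet contains the input alphabet through the injection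
   [emb].  Only the values of [weight] on [delta] matter. *)
Record wtm (S : pzSemiRingType) (Sigma : finType) := WTM {
  state : finType;
  work : finType;
  emb : Sigma -> work;
  delta : {set transition state work};
  weight : transition state work -> S;
  start : state;
  final : {set state};
  blank : work;
  emb_inj : injective emb;
  blank_notin : forall a, emb a != blank;
  delta_src : forall e, e \in delta -> src e \notin final
}.

Section Machines.
Variables (S : pzSemiRingType) (Sigma : finType) (M : wtm S Sigma).

(* The tape is infinite in both directions. *)
Record config := Config {
  cstate : state M;
  ctape : int -> work M;
  chead : int
}.

(* On the empty word no cell is non-blank and the head starts on cell 0. *)
Definition init (w : seq Sigma) : config :=
  Config (start M)
    (fun i => if i is Posz k then nth (blank M) (map (@emb _ _ M) w) k
              else blank M)
    0.

(* [fire e C] is the configuration [C'] such that [C ->_e C'], if any. *)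
Definition fire (e : transition (state M) (work M)) (C : config) :
    option config :=
  let: (p, a, q, b, m) := e in
  if [&& e \in delta M, cstate C == p & ctape C (chead C) == a] then
    Some (Config q [eta ctape C with chead C |-> b]
                 (chead C + (m : nat)%:Z - 1))
  else None.

Fixpoint run (es : seq (transition (state M) (work M))) (C : config) :
    option config :=
  if es is e :: es' then obind (run es') (fire e C) else Some C.

(* The initial configuration and the transitions determine all the
   configurations of a computation [C1 e1 C2 .. en C(n+1)], which is therefore
   represented by the sequence [e1 .. en]; its length is [n]. *)
Definition computation (w : seq Sigma)
    (es : seq (transition (state M) (work M))) : bool :=
  isSome (run es (init w)).

Definition accepting (w : seq Sigma)
    (es : seq (transition (state M) (work M))) : bool :=
  if run es (init w) is Some C then cstate C \in final M else false.

Definition comp_weight (es : seq (transition (state M) (work M))) : S :=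
  \prod_(e <- es) weight e.

Definition finitely_terminating : Prop :=
  forall w, exists s : seq (seq (transition (state M) (work M))),
    forall es, computation w es -> es \in s.

(* [is_behavior w x]: the (finite) sum of the weights of all the accepting
   computations on [w] is [x]. *)
Definition is_behavior (w : seq Sigma) (x : S) : Prop :=
  exists s : seq (seq (transition (state M) (work M))),
    [/\ uniq s, s =i accepting w & x = \sum_(es <- s) comp_weight es].

(* [is_time n t]: the maximal length of a computation on an input of length
   at most [n] is [t]. *)
Definition is_time (n t : nat) : Prop :=
  (exists w es, [/\ (size w <= n)%N, computation w es & size es = t]) /\
  (forall w es, (size w <= n)%N -> computation w es -> (size es <= t)%N).

End Machines.

Definition bigO (f g : nat -> nat) : Prop :=
  exists c N, forall n, (N <= n)%N -> (f n <= c * g n)%N.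

Definition NP (S : pzSemiRingType) (Sigma : finType) (P : seq Sigma -> S) :
    Prop :=
  exists M : wtm S Sigma,
    [/\ finitely_terminating M,
        exists k T, (forall n, is_time M n (T n)) /\ bigO T (fun n => n ^ k)%N
      & forall w, is_behavior M w (P w)].

(** * Structures and encodings *)

(* The listing R_1, .., R_j of the symbols is [enum sym]. *)
Record vocabulary := Vocabulary {
  sym : finType;
  arity : sym -> nat
}.

(* The vocabulary tau extended with the order symbol [None]. *)
Definition with_lt (tau : vocabulary) : vocabulary :=
  Vocabulary (fun R : option (sym tau) => if R is Some R' then arity R' else 2).

Record structure (tau : vocabulary) := Structure {
  univ :> finType;
  interp : forall R : sym tau, {set (arity R).-tuple univ}
}.

Definition linear_order (A : finType) (lt : rel A) : Prop :=
  [/\ irreflexive lt, transitive lt & forall x y, x != y -> lt x y || lt y x].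

Definition ltA (tau : vocabulary) (A : structure (with_lt tau)) : rel A :=
  fun x y => [tuple x; y] \in (@interp _ A None : {set 2.-tuple A}).
Arguments ltA {tau} A.

Record ordered_structure (tau : vocabulary) := OrderedStructure {
  ostruct :> structure (with_lt tau);
  ltA_linear : linear_order (ltA ostruct)
}.

Definition reduct (tau : vocabulary) (A : structure (with_lt tau)) :
    structure tau :=
  @Structure tau A (fun R => @interp _ A (Some R)).

Definition order_enum (A : finType) (lt : rel A) : seq A :=
  sort (fun x y => (x == y) || lt x y) (enum A).

(* All the tuples of length [n] over [r], lexicographically. *)
Fixpoint lex_tuples (T : Type) (r : seq T) (n : nat) : seq (n.-tuple T) :=
  if n is n'.+1 then
    [seq cons_tuple a t | a <- r, t <- lex_tuples r n']
  else [:: nil_tuple T].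

(* The encoding of [A], its universe being identified with [{0, .., n - 1}]
   along the linear order [lt]; the order itself is not encoded. *)
Definition enc (tau : vocabulary) (A : structure tau) (lt : rel A) :
    seq bool :=
  flatten [seq [seq t \in interp A R | t <- lex_tuples (order_enum lt) (arity R)]
          | R <- enum (sym tau)].

(** * Weighted second-order logic *)

(* First-order variables are natural numbers; the second-order variable
   [X = (i, k)] has arity [k]. *)
Definition sovar : Type := (nat * nat)%type.

Definition ar (X : sovar) : nat := X.2.

(* Equality is a logical symbol of the language, as usual in first-order
   logic.  Without it, over structures with no order, a formula could not tell
   apart two elements satisfying the same atoms. *)
Inductive bformula (tau : vocabulary) : Type :=
| BFalse
| BRel (R : sym tau) (xs : (arity R).-tuple nat)
| BVar (X : sovar) (xs : (ar X).-tuple nat)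
| BEq (x y : nat)
| BNot (b : bformula tau)
| BOr (b1 b2 : bformula tau)
| BEx (x : nat) (b : bformula tau)
| BExSO (X : sovar) (b : bformula tau).

Inductive wformula (S : pzSemiRingType) (tau : vocabulary) : Type :=
| WBool (b : bformula tau)
| WConst (s : S)
| WAdd (f1 f2 : wformula S tau)
| WMul (f1 f2 : wformula S tau)
| WSum (x : nat) (f : wformula S tau)
| WProd (x : nat) (f : wformula S tau)
| WSumSO (X : sovar) (f : wformula S tau)
| WProdSO (X : sovar) (f : wformula S tau).

(* [bclosed V W b]: the free variables of [b] belong to [V] and [W]. *)
Fixpoint bclosed (tau : vocabulary) (V : seq nat) (W : seq sovar)
    (b : bformula tau) : bool :=
  match b with
  | BFalse => true
  | BRel R xs => all (mem V) xs
  | BVar X xs => (X \in W) && all (mem V) xs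
  | BEq x y => (x \in V) && (y \in V)
  | BNot b => bclosed V W b
  | BOr b1 b2 => bclosed V W b1 && bclosed V W b2
  | BEx x b => bclosed (x :: V) W b
  | BExSO X b => bclosed V (X :: W) b
  end.

Fixpoint wclosed (S : pzSemiRingType) (tau : vocabulary) (V : seq nat)
    (W : seq sovar) (f : wformula S tau) : bool :=
  match f with
  | WBool b => bclosed V W b
  | WConst _ => true
  | WAdd f1 f2 | WMul f1 f2 => wclosed V W f1 && wclosed V W f2
  | WSum x f | WProd x f => wclosed (x :: V) W f
  | WSumSO X f | WProdSO X f => wclosed V (X :: W) f
  end.

Definition sentence (S : pzSemiRingType) (tau : vocabulary)
    (f : wformula S tau) : bool := wclosed [::] [::] f.

Fixpoint bfirst_order (tau : vocabulary) (b : bformula tau) : bool :=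
  match b with
  | BFalse | BRel _ _ | BVar _ _ | BEq _ _ => true
  | BNot b | BEx _ b => bfirst_order b
  | BOr b1 b2 => bfirst_order b1 && bfirst_order b2
  | BExSO _ _ => false
  end.

Fixpoint wfirst_order (S : pzSemiRingType) (tau : vocabulary)
    (f : wformula S tau) : bool :=
  match f with
  | WBool b => bfirst_order b
  | WConst _ => true
  | WAdd f1 f2 | WMul f1 f2 => wfirst_order f1 && wfirst_order f2
  | WSum _ f | WProd _ f => wfirst_order f
  | WSumSO _ _ | WProdSO _ _ => false
  end.

Definition wESO (S : pzSemiRingType) (tau : vocabulary) (f : wformula S tau) :
    Prop :=
  exists (Xs : seq sovar) (psi : wformula S tau),
    wfirst_order psi /\ f = foldr (@WSumSO S tau) psi Xs.

Section Semantics.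
Variables (S : pzSemiRingType) (tau : vocabulary) (A : structure tau).

Definition so_assignment : Type := forall X : sovar, {set (ar X).-tuple A}.

(* First-order assignments are partial, the universe being possibly empty; an
   atom with an undefined variable is false. *)
Fixpoint bsem (rho : nat -> option A) (eta : so_assignment)
    (b : bformula tau) : bool :=
  match b with
  | BFalse => false
  | BRel R xs =>
      [exists t in interp A R, map rho xs == map Some (tval t)]
  | BVar X xs => [exists t in eta X, map rho xs == map Some (tval t)]
  | BEq x y => [exists a, (rho x == Some a) && (rho y == Some a)]
  | BNot b => ~~ bsem rho eta b
  | BOr b1 b2 => bsem rho eta b1 || bsem rho eta b2
  | BEx x b => [exists a, bsem [eta rho with x |-> Some a] eta b]
  | BExSO X b =>
      [exists I : {set (ar X).-tuple A}, bsem rho (dfwith eta I) b]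
  end.

(* The sets of [k]-tuples, ordered lexicographically through their
   characteristic sequences. *)
Definition lex_sets (r : seq A) (k : nat) : seq {set k.-tuple A} :=
  [seq [set t in mask m (lex_tuples r k)]
  | m : bitseq <- map val (lex_tuples [:: false; true] (size r ^ k)%N)].

(* [r] enumerates the universe and fixes the order of the factors in
   products. *)
Fixpoint wsem (r : seq A) (rho : nat -> option A) (eta : so_assignment)
    (f : wformula S tau) : S :=
  match f with
  | WBool b => if bsem rho eta b then 1 else 0
  | WConst s => s
  | WAdd f1 f2 => wsem r rho eta f1 + wsem r rho eta f2
  | WMul f1 f2 => wsem r rho eta f1 * wsem r rho eta f2
  | WSum x f => \sum_(a : A) wsem r [eta rho with x |-> Some a] eta f
  | WProd x f => \prod_(a <- r) wsem r [eta rho with x |-> Some a] eta f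
  | WSumSO X f =>
      \sum_(I : {set (ar X).-tuple A}) wsem r rho (dfwith eta I) f
  | WProdSO X f =>
      \prod_(I <- lex_sets r (ar X)) wsem r rho (dfwith eta I) f
  end.

Definition value_along (r : seq A) (f : wformula S tau) : S :=
  wsem r (fun=> None) (fun=> set0) f.

End Semantics.

Definition ovalue (S : pzSemiRingType) (tau : vocabulary)
    (A : ordered_structure tau) (f : wformula S (with_lt tau)) : S :=
  @value_along S (with_lt tau) A (order_enum (ltA A)) f.

(* For commutative [S], where the order of the factors is irrelevant. *)
Definition value (S : pzSemiRingType) (tau : vocabulary) (A : structure tau)
    (f : wformula S tau) : S :=
  @value_along S tau A (enum A) f.

(* [P(enc(A))] does not depend on the order along which the universe of a
   structure is listed, i.e. [A |-> P(enc(A))] is well defined on structures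
   without order.  [d] embeds the digits 0, 1 in the alphabet of [P]. *)
Definition order_invariant (S : pzSemiRingType) (tau : vocabulary)
    (Sigma : finType) (d : bool -> Sigma) (P : seq Sigma -> S) : Prop :=
  forall (A : structure tau) (lt1 lt2 : rel A),
    linear_order lt1 -> linear_order lt2 ->
    P (map d (enc lt1)) = P (map d (enc lt2)).

(* Main.v *)
(** From formulas to machines: the machine guesses the size [n] of the structure
    and the relations [X_1, .., X_m], then evaluates the first-order part with
    the variables kept as marked cells of the tape.  A sum is a nondeterministic
    choice, a product is a loop along the order, so the factors come out in the
    right order and exactly one family of runs yields each summand.

    From machines to formulas: a computation of length at most [n ^ K] is coded
    by a single relation, the set of its events (time, head cell, transition).
    The symbol under the head is the last one written in the same cell, or the
    input symbol of that cell, so a first-order formula recognizes the codes of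
    the accepting computations; as each has exactly one code, no summand is
    counted twice, and the product over all possible events in lexicographic
    order is the weight.  The bound [n ^ K] and the coding require [n] to be
    large; the finitely many smaller structures are handled by a decision tree
    with constants at its leaves.

    Without order, the order is one more relation to be summed over.  All linear
    orders give the same value, and their sum collapses by idempotency. *)

Require Import Defs.
From HB Require Import structures.
From mathcomp Require Import all_boot all_order all_algebra zify.
From mathcomp Require Import boolp.

Set Implicit Arguments.
Unset Strict Implicit.
Unset Printing Implicit Defensive.

Import GRing.Theory.
Local Open Scope ring_scope.

(** * From structured programs to weighted Turing machines *)

Section RunValue.
Variables (S : pzSemiRingType) (Sigma : finType) (M : wtm S Sigma).
Implicit Types (C : config M) (es : seq (transition (state M) (work M))).

(* [v] is the sum of the weights of the accepting computations from [C] and [t]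
   bounds the length of all computations from [C]. *)
Inductive run_value : config M -> S -> nat -> Prop :=
| RunFinal C t : cstate C \in final M -> run_value C 1 t
| RunStep C t (f : transition (state M) (work M) -> S) :
    cstate C \notin final M ->
    (forall e C', fire e C = Some C' -> run_value C' (f e) t) ->
    run_value C (\sum_(e | isSome (fire e C)) weight e * f e) t.+1.

Definition accepts_from C es : bool :=
  if run es C is Some C' then cstate C' \in final M else false.

Lemma fire_final e C : cstate C \in final M -> fire e C = None.
Proof.
case: e => [[[[p a] q] b] m] Cf /=; case: ifP => // /and3P[eD /eqP pE _].
by move: (delta_src eD); rewrite /= -pE Cf.
Qed.

Lemma run_value_size C v t : run_value C v t ->
  forall es, isSome (run es C) -> (size es <= t)%N.
Proof.
elim=> {C v t} [C t Cf [|e es] //= | C t f _ _ IH [|e es] //=].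
  by rewrite fire_final.
by case Ce: (fire e C) => [C'|] //= /(IH _ _ Ce).
Qed.

Lemma run_value_sum C v t : run_value C v t ->
  exists s, [/\ uniq s, s =i accepts_from C & v = \sum_(es <- s) comp_weight es].
Proof.
elim=> {C v t} [C t Cf | C t f Cf _ IH].
  exists [:: [::]]; split=> //.
    move=> [|e es]; rewrite !inE ?eqxx /in_mem /= /accepts_from /= ?Cf //.
    by rewrite fire_final.
  by rewrite big_seq1 /comp_weight big_nil.
have /choice[g gP] : forall e, exists s, forall C', fire e C = Some C' ->
    [/\ uniq s, s =i accepts_from C' & f e = \sum_(es <- s) comp_weight es].
  move=> e; case Ce: (fire e C) => [C'|]; last by exists [::].
  by have [s sP] := IH _ _ Ce; exists s => _ [<-].
exists (flatten [seq [seq e :: es | es <- g e] | e <- enum (fun e => isSome (fire e C))]).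
split.
- apply/allpairs_uniq_dep => [|e|]; first exact: enum_uniq.
    by rewrite mem_enum unfold_in; case Ce: (fire e C) => [C'|] // _; case: (gP _ _ Ce).
  by move=> [e1 s1] [e2 s2] _ _ /= [-> ->].
- move=> es; apply/allpairsPdep/idP => [[e [es' []]]|].
    rewrite mem_enum unfold_in; case Ce: (fire e C) => [C'|] // _.
    have [_ -> _] := gP _ _ Ce; rewrite !unfold_in => acc ->.
    by rewrite /accepts_from /= Ce.
  case: es => [|e es]; rewrite unfold_in /accepts_from /=; first by rewrite (negPf Cf).
  case Ce: (fire e C) => [C'|] //= acc; exists e, es; split=> //.
    by rewrite mem_enum unfold_in Ce.
  by have [_ -> _] := gP _ _ Ce.
- rewrite big_allpairs_dep /= big_enum /=; apply: eq_bigr => e.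
  rewrite /in_mem /=; case Ce: (fire e C) => [C'|] // _.
  have [_ _ ->] := gP _ _ Ce; rewrite mulr_sumr; apply: eq_bigr => es _.
  by rewrite /comp_weight big_cons.
Qed.

Lemma run_value_behavior w v t : run_value (init M w) v t -> is_behavior M w v.
Proof. by move=> /run_value_sum[s [us sP vE]]; exists s; split. Qed.

Lemma is_behavior_inj w x y : is_behavior M w x -> is_behavior M w y -> x = y.
Proof.
move=> [s [us sP ->]] [s' [us' s'P ->]]; apply/perm_big/uniq_perm => // es.
by rewrite sP s'P.
Qed.

End RunValue.

Lemma leq_wexp2r (a b k : nat) : (a <= b)%N -> (a ^ k <= b ^ k)%N.
Proof. by case: k => [|k] ab; rewrite ?expn0 ?leq_exp2r. Qed.

Lemma bounded_max (p : nat -> Prop) (m : nat) :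
  (exists i, p i) -> (forall i, p i -> (i <= m)%N) ->
  exists2 i, p i & forall j, p j -> (j <= i)%N.
Proof.
move=> [i0 pi0] pm.
have ex : exists i, `[< p i >] by exists i0; apply/asboolP.
have bd : forall i, `[< p i >] -> (i <= m)%N by move=> i /asboolP; exact: pm.
case: (ex_maxnP ex bd) => i /asboolP pi maxi; exists i => // j pj.
by apply: maxi; apply/asboolP.
Qed.

Lemma NP_of_run_value (S : pzSemiRingType) (Sigma : finType) (M : wtm S Sigma)
    (P : seq Sigma -> S) (c k : nat) :
  (forall w, run_value (init M w) (P w) (c * (size w).+1 ^ k)%N) -> NP P.
Proof.
move=> H; have sz w es : @computation _ _ M w es -> (size es <= c * (size w).+1 ^ k)%N.
  exact: (run_value_size (H w)).
exists M; split; last by move=> w; apply: run_value_behavior (H w).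
  move=> w; set B := (c * (size w).+1 ^ k)%N.
  exists (flatten [seq [seq val s | s <- enum {: n.-tuple (transition (state M) (work M))}] | n <- iota 0 B.+1]).
  move=> es /sz les; apply/allpairsPdep; exists (size es), (in_tuple es).
  by rewrite mem_iota mem_enum.
have /choice[T TP] : forall n, exists t, is_time M n t.
  move=> n; pose p t := exists w es, [/\ (size w <= n)%N, @computation _ _ M w es & size es = t].
  have [||t pt tmax] := @bounded_max p (c * n.+1 ^ k)%N.
  - by exists 0%N, [::], [::].
  - move=> _ [w [es [wn ces <-]]]; apply: leq_trans (sz _ _ ces) _.
    by rewrite leq_mul2l leq_wexp2r ?orbT.
  - exists t; split=> // w es wn ces; apply: tmax; by exists w, es.
exists k, T; split=> //; exists (c * 2 ^ k)%N, 1%N => n n1.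
have [[w [es [wn ces <-]]] _] := TP n.
apply: leq_trans (sz _ _ ces) _; rewrite -mulnA leq_mul2l -expnMn.
by apply/orP; right; rewrite leq_wexp2r // mul2n -addnn -addn1 leq_add.
Qed.

Section Programs.
Variables (S : pzSemiRingType) (Rg Tk : finType).

(* A register is the mark of the cell whose number is its value, a track marks a
   set of cells, and [None] is the mark of cell 0. *)
Definition mark : finType := option (Rg + Tk).
Definition cell : finType := (option bool * {set mark})%type.

Definition rmark (v : Rg) : mark := Some (inl v).
Definition tmark (X : Tk) : mark := Some (inr X).

Lemma rmarkE r v : (Some (inl r) == rmark v :> mark) = (r == v).
Proof. by apply/eqP/eqP => [[]|->]. Qed.

Lemma tmarkE X Y : (Some (inr X) == tmark Y :> mark) = (X == Y).
Proof. by apply/eqP/eqP => [[]|->]. Qed.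

Inductive prog : Type :=
| Skip
| Fail
| Wt (x : S)
| Seq (p q : prog)
| Alt (p q : prog)
| Inc (v : Rg)
| Rst (v : Rg)
| Wr (X : Tk) (v : Rg) (b : bool)
| If (v : Rg) (phi : cell -> bool) (p q : prog)
| Until (v : Rg) (phi : cell -> bool) (p : prog).

Record store := Store { rg : Rg -> nat; tk : Tk -> nat -> bool }.

Definition setr (v : Rg) (k : nat) (s : store) : store :=
  Store [eta rg s with v |-> k] (tk s).

Definition sett (X : Tk) (i : nat) (b : bool) (s : store) : store :=
  Store (rg s) (fun Y j => if (Y == X) && (j == i) then b else tk s Y j).

Definition has_mark (s : store) (i : nat) (k : mark) : bool :=
  match k with
  | None => i == 0%N
  | Some (inl v) => rg s v == i
  | Some (inr X) => tk s X i
  end.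

Section Semantics.
Variable w : seq bool.

Definition content (s : store) (i : nat) : cell :=
  (onth w i, [set k | has_mark s i k]).

(* As in [run_value]; the sequence is the stack of the programs still to be
   executed. *)
Inductive eval : seq prog -> store -> S -> nat -> Prop :=
| EvalNil s t : eval [::] s 1 t
| EvalSkip K s v t : eval K s v t -> eval (Skip :: K) s v t.+1
| EvalFail K s t : eval (Fail :: K) s 0 t.+1
| EvalWt x K s v t : eval K s v t -> eval (Wt x :: K) s (x * v) t.+1
| EvalSeq p q K s v t : eval (p :: q :: K) s v t -> eval (Seq p q :: K) s v t.+1
| EvalAlt p q K s v v' t : eval (p :: K) s v t -> eval (q :: K) s v' t ->
    eval (Alt p q :: K) s (v + v') t.+1
| EvalInc r K s v t : eval K (setr r (rg s r).+1 s) v t ->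
    eval (Inc r :: K) s v t.+1
| EvalRst r K s v t : eval K (setr r 0 s) v t -> eval (Rst r :: K) s v t.+1
| EvalWr X r b K s v t : eval K (sett X (rg s r) b s) v t ->
    eval (Wr X r b :: K) s v t.+1
| EvalIf r phi p q K s v t :
    eval ((if phi (content s (rg s r)) then p else q) :: K) s v t ->
    eval (If r phi p q :: K) s v t.+1
| EvalUntil r phi p K s v t :
    eval (if phi (content s (rg s r)) then K else p :: Until r phi p :: K) s v t ->
    eval (Until r phi p :: K) s v t.+1.

Lemma eval_le K s v t t' : eval K s v t -> (t <= t')%N -> eval K s v t'.
Proof.
move=> H; elim: H t' => {K s v t};
  try (by move=> > /=; constructor);
  try (by move=> ? ? ? [|?] //=; constructor);
  try (by move=> > _ IH [|t'] //= ?; constructor; apply: IH).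
by move=> p q K s v v' t _ IH1 _ IH2 [|t'] //= ?; constructor; [apply: IH1|apply: IH2].
Qed.

End Semantics.

Local Notation cont := {classic (seq prog)}.

Fixpoint reach (p : prog) (K : seq prog) : seq cont :=
  (p :: K : cont) :: match p with
  | Seq p q => reach p (q :: K) ++ reach q K
  | Alt p q => reach p K ++ reach q K
  | If _ _ p q => reach p K ++ reach q K
  | Until v phi p => reach p (Until v phi p :: K)
  | _ => [::]
  end.

Definition succs (K : seq prog) : seq cont :=
  match K with
  | [::] => [::]
  | Fail :: K => [::]
  | Seq p q :: K => [:: (p :: q :: K : cont)]
  | Alt p q :: K => [:: (p :: K : cont); (q :: K : cont)]
  | If _ _ p q :: K => [:: (p :: K : cont); (q :: K : cont)]
  | Until v phi p :: K => [:: (K : cont); (p :: Until v phi p :: K : cont)]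
  | _ :: K => [:: (K : cont)]
  end.

Lemma reach_self p K : (p :: K : cont) \in reach p K.
Proof. by case: p => *; rewrite /= inE eqxx. Qed.

Lemma reach_succs p K (K1 K2 : cont) : K1 \in reach p K -> K2 \in succs K1 ->
  K2 \in (K : cont) :: reach p K.
Proof.
elim: p K => [||x|p IHp q IHq|p IHp q IHq|v|v|X v b|v phi p IHp q IHq|v phi p IHp] K;
  rewrite [reach _ _]/= in_cons => /orP[/eqP->|//];
  try (by rewrite [succs _]/= ?in_cons in_nil ?orbF // => /eqP->; rewrite ?eqxx).
- by rewrite [succs _]/= inE => /eqP->; rewrite !in_cons mem_cat reach_self !orbT.
- rewrite mem_cat => /orP[/IHp|/IHq] H /H; rewrite !(in_cons, mem_cat) => /orP[/eqP->|->];
  by rewrite ?reach_self ?eqxx ?orbT.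
- by rewrite [succs _]/= !in_cons in_nil => /or3P[/eqP->|/eqP->|//]; rewrite mem_cat reach_self ?orbT.
- by rewrite mem_cat => /orP[/IHp|/IHq] H /H; rewrite !(in_cons, mem_cat) => /orP[/eqP->|->];
  rewrite ?reach_self ?eqxx ?orbT.
- by rewrite [succs _]/= !in_cons in_nil => /or3P[/eqP->|/eqP->|//]; rewrite mem_cat reach_self ?orbT.
- by rewrite mem_cat => /orP[/IHp|/IHq] H /H; rewrite !(in_cons, mem_cat) => /orP[/eqP->|->];
  rewrite ?reach_self ?eqxx ?orbT.
- by rewrite [succs _]/= !in_cons in_nil => /or3P[/eqP->|/eqP->|//]; rewrite ?reach_self ?eqxx ?orbT.
- by move=> /IHp H /H; rewrite !in_cons => /orP[/eqP->|->]; rewrite ?eqxx ?orbT.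
Qed.

Variable p0 : prog.

Definition conts : seq cont := ([::] : cont) :: reach p0 [::].

Lemma conts_nil : ([::] : cont) \in conts. Proof. exact: mem_head. Qed.

Lemma conts_succs (K1 K2 : cont) : K1 \in conts -> K2 \in succs K1 -> K2 \in conts.
Proof.
rewrite /conts in_cons => /orP[/eqP->//|K1r K2s]; exact: reach_succs K1r K2s.
Qed.

(* The first component of a phase only keeps apart the two transitions of a
   choice; the second one says what the head is doing: walking right in search
   of a register (or executing an instruction at cell 0), storing a register
   that has been incremented, walking back to cell 0, walking back to cell 0 in
   order to store there a register that has been reset. *)
Definition phase : finType := (bool * (bool * bool))%type.
Definition Go b : phase := (b, (false, false)).
Definition Put : phase := (false, (false, true)).
Definition Back : phase := (false, (true, false)).
Definition BackR : phase := (false, (true, true)).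

Definition tmstate : finType := option (seq_sub conts * phase).

Definition at_ (K : seq prog) (ph : phase) : tmstate :=
  Some (insubd (SeqSub conts_nil) (K : cont), ph).

Definition mleft : 'I_3 := Ordinal (isT : (0 < 3)%N).
Definition mstay : 'I_3 := Ordinal (isT : (1 < 3)%N).
Definition mright : 'I_3 := Ordinal (isT : (2 < 3)%N).

Definition action := (tmstate * cell * 'I_3)%type.

Definition seeker (p : prog) : option Rg :=
  match p with
  | Inc v | Rst v | Wr _ v _ | If v _ _ _ | Until v _ _ => Some v
  | _ => None
  end.

Definition at_home (p : prog) (K : seq prog) (a : cell) : seq action :=
  match p with
  | Skip | Wt _ => [:: (at_ K (Go false), a, mstay)]
  | Seq p q => [:: (at_ (p :: q :: K) (Go false), a, mstay)]
  | Alt p q => [:: (at_ (p :: K) (Go false), a, mstay);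
                      (at_ (q :: K) (Go true), a, mstay)]
  | _ => [::]
  end.

Definition at_found (p : prog) (K : seq prog) (a : cell) : seq action :=
  match p with
  | Inc v => [:: (at_ (p :: K) Put, (a.1, a.2 :\ rmark v), mright)]
  | Rst v => [:: (at_ (p :: K) BackR, (a.1, a.2 :\ rmark v), mstay)]
  | Wr X v b =>
      [:: (at_ K Back, (a.1, if b then tmark X |: a.2 else a.2 :\ tmark X), mstay)]
  | If v phi p q => [:: (at_ ((if phi a then p else q) :: K) Back, a, mstay)]
  | Until v phi p =>
      [:: (at_ (if phi a then K else p :: Until v phi p :: K) Back, a, mstay)]
  | _ => [::]
  end.

Definition tm_next (q : tmstate) (a : cell) : seq action :=
  if q is Some (c, ph) then
    if ssval c is p :: K then
      match ph.2 with
      | (false, false) =>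
          if seeker p is Some v then
            if rmark v \in a.2 then at_found p K a
            else [:: (at_ (p :: K) (Go false), a, mright)]
          else at_home p K a
      | (false, true) =>
          if p is Inc v then [:: (at_ K Back, (a.1, rmark v |: a.2), mstay)] else [::]
      | (true, false) =>
          if None \in a.2 then [:: (at_ (p :: K) (Go false), a, mstay)]
          else [:: (at_ (p :: K) Back, a, mleft)]
      | (true, true) =>
          if None \in a.2 then
            if p is Rst v then [:: (at_ K (Go false), (a.1, rmark v |: a.2), mstay)]
            else [::]
          else [:: (at_ (p :: K) BackR, a, mleft)]
      end
    else [::]
  else [:: (at_ [:: p0] (Go false),
            (a.1, a.2 :|: [set k | if k is Some (inr _) then false else true]), mstay)].

Definition tmfinal : {set tmstate} :=
  [set q | if q is Some (c, _) then ssval c == ([::] : cont) else false].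

Definition tmdelta : {set transition tmstate cell} :=
  [set e | let: (p, a, q, b, m) := e in
           (p \notin tmfinal) && ((q, b, m) \in tm_next p a)].

Definition stweight (q : tmstate) : S :=
  if q is Some (c, (_, (false, false))) then
    if ssval c is Wt x :: _ then x else 1
  else 1.

Definition tmweight (e : transition tmstate cell) : S := stweight (src e).

Arguments at_ : simpl never.
Arguments tm_next : simpl never.
Arguments stweight : simpl never.

Lemma tm_emb_inj : injective (fun b : bool => (Some b, set0) : cell).
Proof. by move=> b b' [->]. Qed.

Lemma tm_blank b : (Some b, set0) != (None, set0) :> cell.
Proof. by apply/eqP. Qed.

Lemma tm_delta_src e : e \in tmdelta -> src e \notin tmfinal.
Proof. by case: e => [[[[p a] q] b] m]; rewrite inE => /andP[]. Qed.

Definition tm : wtm S bool :=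
  @WTM S bool tmstate cell (fun b => (Some b, set0)) tmdelta tmweight None tmfinal
    (None, set0) tm_emb_inj tm_blank tm_delta_src.

Implicit Types (C : config tm).

Lemma run_value_step C (f : action -> S) t :
  let a := ctape C (chead C) in let q := cstate C in
  q \notin tmfinal -> uniq (tm_next q a) ->
  (forall q' b m, (q', b, m) \in tm_next q a ->
     run_value (@Config _ _ tm q' [eta ctape C with chead C |-> b]
                  (chead C + (m : nat)%:Z - 1)) (f (q', b, m)) t) ->
  run_value C (\sum_(x <- tm_next q a) stweight q * f x) t.+1.
Proof.
move=> a q qf un H; rewrite /q /a in un H qf *.
pose g (e : transition tmstate cell) := f (e.1.1.2, e.1.2, e.2).
suff -> : \sum_(x <- tm_next q a) stweight q * f x =
    \sum_(e : transition tmstate cell | isSome (fire (M := tm) e C)) weight (e : transition (state tm) (work tm)) * g e.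
  apply: RunStep => // -[[[[p a1] q'] b] m] C' /=; case: ifP => // /and3P[].
  rewrite inE => /andP[_ i1] /eqP i2 /eqP i3 [<-]; apply: H.
  by rewrite i2 i3.
pose h (x : action) : transition tmstate cell := (q, a, x.1.1, x.1.2, x.2).
rewrite -[RHS]big_filter (perm_big [seq h x | x <- tm_next q a]) /=.
  rewrite big_map; apply: eq_bigr => -[[q' b] m] _ //.
apply: uniq_perm; first by rewrite filter_uniq // index_enum_uniq.
  by rewrite map_inj_uniq // => -[[? ?] ?] [[? ?] ?] [-> -> ->].
move=> [[[[p a1] q'] b] m]; rewrite mem_filter mem_index_enum andbT.
apply/idP/mapP => [|[[[q1 b1] m1] xn [-> -> -> -> ->]]] /=.
  case: ifP => // /and3P[+ /eqP i2 /eqP i3] _.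
  rewrite inE => /andP[_ i1]; exists (q', b, m); last by rewrite /h /q /a i2 i3.
  by rewrite /q /a i2 i3.
by rewrite !eqxx !andbT inE qf xn.
Qed.

Lemma run_value_step1 C q' b m v t :
  cstate C \notin tmfinal ->
  tm_next (cstate C) (ctape C (chead C)) = [:: (q', b, m)] ->
  run_value (@Config _ _ tm q' [eta ctape C with chead C |-> b]
               (chead C + (m : nat)%:Z - 1)) v t ->
  run_value C (stweight (cstate C) * v) t.+1.
Proof.
move=> Cf nE H; have := @run_value_step C (fun=> v) t Cf.
rewrite nE big_seq1; apply=> // q1 b1 m1.
by rewrite inE => /eqP[-> -> ->].
Qed.

Variable w : seq bool.

Definition tape_of (s : store) (i : int) : cell :=
  if i is Posz k then content w s k else (None, set0).

Definition conf (K : seq prog) (ph : phase) (s : store) (i : nat) : config tm :=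
  @Config _ _ tm (at_ K ph) (tape_of s) i.

Lemma at_val (K : cont) : K \in conts ->
  ssval (insubd (SeqSub conts_nil) (K : cont)) = K.
Proof. by move=> Kc; rewrite -[ssval _]/(val _) insubdK. Qed.

Lemma at_final (K : seq prog) ph : (K : cont) \in conts ->
  (at_ K ph \in tmfinal) = (K == [::] :> cont).
Proof. by move=> Kc; rewrite inE /at_ at_val. Qed.

Lemma tape_upd (s : store) (i : nat) (b : cell) (s' : store) :
  b = content w s' i -> (forall j, j != i -> content w s j = content w s' j) ->
  [eta tape_of s with i%:Z |-> b] = tape_of s' :> (int -> cell).
Proof.
move=> bE H; apply/funext => -[j|j] //=.
by rewrite eqz_nat; case: eqP => [->//|/eqP/H].
Qed.

Lemma tape_id (s : store) (i : nat) :
  [eta tape_of s with i%:Z |-> content w s i] = tape_of s :> (int -> cell).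
Proof. exact: tape_upd. Qed.

Lemma tm_nextE K ph (a : cell) : (K : cont) \in conts ->
  tm_next (at_ K ph) a =
    if K is p :: K' then
      match ph.2 with
      | (false, false) =>
          if seeker p is Some v then
            if rmark v \in a.2 then at_found p K' a
            else [:: (at_ K (Go false), a, mright)]
          else at_home p K' a
      | (false, true) =>
          if p is Inc v then [:: (at_ K' Back, (a.1, rmark v |: a.2), mstay)] else [::]
      | (true, false) =>
          if None \in a.2 then [:: (at_ K (Go false), a, mstay)]
          else [:: (at_ K Back, a, mleft)]
      | (true, true) =>
          if None \in a.2 then
            if p is Rst v then [:: (at_ K' (Go false), (a.1, rmark v |: a.2), mstay)]
            else [::]
          else [:: (at_ K BackR, a, mleft)]
      end
    else [::].
Proof. by move=> Kc; rewrite /tm_next /at_ at_val //; case: K Kc. Qed.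

Lemma stweightE K ph : (K : cont) \in conts ->
  stweight (at_ K ph) =
    if (K, ph.2) is (Wt x :: _, (false, false)) then x else 1.
Proof.
by move=> Kc; rewrite /stweight /at_ at_val //; case: ph => [b [[] []]]; case: K Kc => [|[]].
Qed.

Lemma stweight_other K ph : (K : cont) \in conts -> ph.2 != (false, false) ->
  stweight (at_ K ph) = 1.
Proof. by move=> Kc; rewrite stweightE //; case: ph => [b [[] []]]; case: K Kc => [|[]]. Qed.

Lemma run_final K ph tp h v t : (K : cont) \in conts ->
  run_value (@Config _ _ tm (at_ K ph) tp h) v t -> K = [::] -> v = 1.
Proof.
move=> Kc H KE; inversion H => //.
by move: H0; rewrite at_final // KE eqxx.
Qed.

Lemma run_value_le (C : config tm) v t t' : run_value C v t -> (t <= t')%N ->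
  run_value C v t'.
Proof.
move=> H; elim: H t' => {C v t} [C t Cf t' _|C t f Cf _ IH [|t'] // tt'].
  exact: RunFinal.
by apply: RunStep => // e C' /IH; apply.
Qed.

Lemma run_back K s i v t : (K : cont) \in conts ->
  run_value (conf K (Go false) s 0) v t -> run_value (conf K Back s i) v (t + i.+1).
Proof.
move=> Kc H; case KE: K => [|p K'].
  have -> : v = 1 by apply: run_final H _.
  by apply: RunFinal; rewrite /= -KE at_final // KE.
rewrite -KE; have Knil : (K == [::] :> cont) = false by rewrite KE; apply/eqP.
elim: i => [|i IH]; rewrite ?addn1 ?[(t + i.+2)%N]addnS.
  have := @run_value_step1 (conf K Back s 0) (at_ K (Go false)) (content w s 0) mstay v t.
  rewrite /= at_final // Knil tm_nextE // KE /= inE /= -KE stweight_other // mul1r.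
  by apply=> //; rewrite (tape_id s 0).
have := @run_value_step1 (conf K Back s i.+1) (at_ K Back) (content w s i.+1) mleft v (t + i.+1).
rewrite /= at_final // Knil tm_nextE // KE /= inE /= -KE stweight_other // mul1r.
rewrite (tape_id s i.+1); apply=> //.
by have -> : i.+1%:Z + 0%N%:Z - 1 = i by lia.
Qed.

Lemma run_seek p K s v x t b : (p :: K : cont) \in conts -> seeker p = Some v ->
  (forall b, run_value (conf (p :: K) (Go b) s (rg s v)) x t) ->
  forall i, (i <= rg s v)%N ->
  run_value (conf (p :: K) (Go b) s i) x (t + (rg s v - i)).
Proof.
move=> Kc pv H i iv; have [d dE] : exists d, (rg s v - i)%N = d by eexists.
rewrite dE; elim: d i iv dE b => [|d IH] i iv dE b.
  have -> : i = rg s v by lia.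
  by rewrite addn0.
have := @run_value_step1 (conf (p :: K) (Go b) s i) (at_ (p :: K) (Go false)) (content w s i) mright x (t + d).
rewrite /= at_final // tm_nextE //= pv inE /= ifN; last by lia.
rewrite stweightE //= addnS tape_id.
have -> : i%:Z + 2%N%:Z - 1 = i.+1 by lia.
have -> : (if p is Wt y then y else 1) = 1 :> S by case: (p) pv.
rewrite mul1r; apply=> //; first exact/eqP.
by apply: IH; lia.
Qed.

Lemma run_tested p K v K' c' s s' x t b :
  seeker p = Some v -> (p :: K : cont) \in conts -> (K' : cont) \in conts ->
  at_found p K (content w s (rg s v)) = [:: (at_ K' Back, c', mstay)] ->
  [eta tape_of s with (rg s v)%:Z |-> c'] = tape_of s' :> (int -> cell) ->
  run_value (conf K' (Go false) s' 0) x t ->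
  run_value (conf (p :: K) (Go b) s 0) x (t + (rg s v + rg s v).+2).
Proof.
move=> pv Kc K'c fE tE H; have -> : (t + (rg s v + rg s v).+2 = (t + (rg s v).+1).+1 + (rg s v - 0))%N by lia.
apply: (run_seek _ Kc pv _ (leq0n _)) => {}b.
have := @run_value_step1 (conf (p :: K) (Go b) s (rg s v)) (at_ K' Back) c' mstay x (t + (rg s v).+1).
rewrite /= at_final // tm_nextE //= pv inE /= eqxx fE tE stweightE //=.
have -> : (if p is Wt y then y else 1) = 1 :> S by case: (p) pv.
have -> : (rg s v)%:Z + 1%N%:Z - 1 = rg s v by lia.
rewrite mul1r; apply=> //; first exact/eqP.
exact: run_back.
Qed.

Lemma run_local p K K' s x t b :
  seeker p = None -> (p :: K : cont) \in conts -> (K' : cont) \in conts ->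
  at_home p K (content w s 0) = [:: (at_ K' (Go false), content w s 0, mstay)] ->
  run_value (conf K' (Go false) s 0) x t ->
  run_value (conf (p :: K) (Go b) s 0) ((if p is Wt y then y else 1) * x) t.+1.
Proof.
move=> pv Kc K'c fE H.
have := @run_value_step1 (conf (p :: K) (Go b) s 0) (at_ K' (Go false)) (content w s 0) mstay x t.
rewrite /= at_final // tm_nextE //= pv fE (tape_id s 0) stweightE //=.
by apply=> //; apply/eqP.
Qed.

Lemma run_inc v K s x t b : (Inc v :: K : cont) \in conts ->
  run_value (conf K (Go false) (setr v (rg s v).+1 s) 0) x t ->
  run_value (conf (Inc v :: K) (Go b) s 0) x (t + (rg s v + rg s v + 4)).
Proof.
move=> Kc H; have K'c : (K : cont) \in conts.
  by apply: conts_succs Kc _; rewrite inE.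
have -> : (t + (rg s v + rg s v + 4) = (t + (rg s v).+2).+2 + (rg s v - 0))%N by lia.
apply: (@run_seek _ _ _ v _ _ _ Kc erefl _ 0 (leq0n _)) => {}b.
set c1 := ((content w s (rg s v)).1, (content w s (rg s v)).2 :\ rmark v).
set c2 := ((content w s (rg s v).+1).1, rmark v |: (content w s (rg s v).+1).2).
have := @run_value_step1 (conf (Inc v :: K) (Go b) s (rg s v)) (at_ (Inc v :: K) Put) c1 mright x (t + (rg s v).+2).+1.
rewrite /= at_final // tm_nextE //= inE /= eqxx stweightE //= mul1r.
apply=> //; first exact/eqP.
have -> : (rg s v)%:Z + 2%N%:Z - 1 = (rg s v).+1 by lia.
set tp := fun_of_simpl _.
have tpE : tp (rg s v).+1%:Z = content w s (rg s v).+1.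
  by rewrite /tp /= ifN //; apply/eqP; lia.
have := @run_value_step1 (@Config _ _ tm (at_ (Inc v :: K) Put) tp (rg s v).+1)
  (at_ K Back) c2 mstay x (t + (rg s v).+2).
rewrite /= at_final // tm_nextE //= stweightE //= mul1r.
apply=> //; first exact/eqP; first by rewrite tpE.
have -> : (rg s v).+1%:Z + 1%N%:Z - 1 = (rg s v).+1 by lia.
set s' := setr _ _ _ in H.
suff -> : [eta tp with (rg s v).+1%:Z |-> c2] = tape_of s' :> (int -> cell) by apply: run_back.
apply/funext => -[j|j] //=; rewrite !eqz_nat.
case: eqP => [->|jv].
  rewrite /c2 /content /=; congr pair; apply/setP => -[[r|X]|]; rewrite !inE //= rmarkE.
  by case: (r =P v) => //= _; rewrite eqxx.
rewrite /tp /= eqz_nat; case: (j =P rg s v) => [->|jv'].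
  rewrite /c1 /content /=; congr pair; apply/setP => -[[r|X]|]; rewrite !inE //= rmarkE.
  by case: (r =P v) => //= _; apply/esym; lia.
rewrite /content /=; congr pair; apply/setP => -[[r|X]|]; rewrite !inE //=.
by case: (r =P v) => // ->; lia.
Qed.

Lemma run_rst v K s x t b : (Rst v :: K : cont) \in conts ->
  run_value (conf K (Go false) (setr v 0 s) 0) x t ->
  run_value (conf (Rst v :: K) (Go b) s 0) x (t + (rg s v + rg s v + 4)).
Proof.
move=> Kc H; have K'c : (K : cont) \in conts.
  by apply: conts_succs Kc _; rewrite inE.
apply: (@run_value_le _ _ ((t + (rg s v).+1).+1 + (rg s v - 0))%N); last by lia.
apply: (@run_seek _ _ _ v _ _ _ Kc erefl _ 0 (leq0n _)) => {}b.
set c1 := ((content w s (rg s v)).1, (content w s (rg s v)).2 :\ rmark v).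
have := @run_value_step1 (conf (Rst v :: K) (Go b) s (rg s v)) (at_ (Rst v :: K) BackR) c1 mstay x (t + (rg s v).+1).
rewrite /= at_final // tm_nextE //= inE /= eqxx stweightE //= mul1r.
apply=> //; first exact/eqP.
have -> : (rg s v)%:Z + 1%N%:Z - 1 = rg s v by lia.
set tp := fun_of_simpl _.
have tpE i : tp (i : nat)%:Z = ((content w s i).1, (content w s i).2 :\ rmark v).
  rewrite /tp /= eqz_nat; case: eqP => [->//|ne].
  rewrite /content /=; congr pair; apply/setP => -[[r|X]|]; rewrite !inE //= rmarkE.
  by case: (r =P v) => //= ->; apply/eqP => /esym.
have {}IH : forall i, run_value (@Config _ _ tm (at_ (Rst v :: K) BackR) tp (i : nat)) x (t + i.+1).
  elim=> [|i IH].
    have := @run_value_step1 (@Config _ _ tm (at_ (Rst v :: K) BackR) tp 0)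
      (at_ K (Go false)) ((content w s 0).1, rmark v |: ((content w s 0).2 :\ rmark v)) mstay x t.
    rewrite /= at_final // tm_nextE // (tpE 0) !inE /= stweightE //= mul1r addn1.
    apply=> //; first exact/eqP.
    set s' := setr _ _ _ in H.
    suff -> : [eta tp with 0 |-> ((content w s 0).1, rmark v |: ((content w s 0).2 :\ rmark v))]
      = tape_of s' :> (int -> cell) by [].
    apply/funext => -[j|j] //=; rewrite eqz_nat; case: (j =P 0%N) => [->|j0].
      rewrite /content /=; congr pair; apply/setP => -[[r|X]|]; rewrite !inE //= rmarkE.
      by case: (r =P v).
    rewrite tpE /content /=; congr pair; apply/setP => -[[r|X]|]; rewrite !inE //= rmarkE.
    by case: (r =P v) => //= _; apply/esym/eqP => /esym.
  have := @run_value_step1 (@Config _ _ tm (at_ (Rst v :: K) BackR) tp i.+1)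
      (at_ (Rst v :: K) BackR) ((content w s i.+1).1, (content w s i.+1).2 :\ rmark v) mleft x (t + i.+1).
  rewrite /= at_final // tm_nextE // (tpE i.+1) !inE /= stweightE //= mul1r !addnS.
  apply=> //; first exact/eqP.
  have -> : i.+1%:Z + 0%N%:Z - 1 = i by lia.
  set tp' := fun_of_simpl _; have -> : tp' = tp; last by rewrite -addnS.
  by apply/funext => j; rewrite /tp' /=; case: eqP => [->|//]; rewrite tpE.
exact: IH.
Qed.

Theorem eval_run K s v t : eval w K s v t -> (K : cont) \in conts ->
  forall B b, (forall r, (rg s r <= B)%N) ->
  run_value (conf K (Go b) s 0) v (t * (2 * (B + t) + 6)).
Proof.
elim=> {K s v t}.
- move=> s t _ B b _; apply: RunFinal; by rewrite /= at_final ?conts_nil.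
- move=> K s v t _ IH Kc B b sB.
  have K'c : (K : cont) \in conts by apply: conts_succs Kc _; rewrite inE.
  apply: (@run_value_le _ _ (t * (2 * (B + t) + 6)).+1); last by nia.
  have := @run_local Skip K K s v (t * (2 * (B + t) + 6)) b erefl Kc K'c erefl (IH K'c B false sB).
  by rewrite mul1r.
- move=> K s t Kc B b sB.
  apply: (@run_value_le _ _ (t * (2 * (B + t) + 6)).+1); last by nia.
  have := @run_value_step (conf (Fail :: K) (Go b) s 0) (fun=> 0) (t * (2 * (B + t) + 6)).
  by rewrite /= at_final // tm_nextE //= big_nil; apply=> //; apply/eqP.
- move=> x K s v t _ IH Kc B b sB.
  have K'c : (K : cont) \in conts by apply: conts_succs Kc _; rewrite inE.
  apply: (@run_value_le _ _ (t * (2 * (B + t) + 6)).+1); last by nia.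
  exact: (@run_local (Wt x) K K s v (t * (2 * (B + t) + 6)) b erefl Kc K'c erefl (IH K'c B false sB)).
- move=> p q K s v t _ IH Kc B b sB.
  have K'c : (p :: q :: K : cont) \in conts by apply: conts_succs Kc _; rewrite inE.
  apply: (@run_value_le _ _ (t * (2 * (B + t) + 6)).+1); last by nia.
  have := @run_local (Seq p q) K _ s v (t * (2 * (B + t) + 6)) b erefl Kc K'c erefl (IH K'c B false sB).
  by rewrite mul1r.
- move=> p q K s v v' t _ IH1 _ IH2 Kc B b sB.
  have K1c : (p :: K : cont) \in conts by apply: conts_succs Kc _; rewrite !inE eqxx.
  have K2c : (q :: K : cont) \in conts by apply: conts_succs Kc _; rewrite !inE eqxx orbT.
  apply: (@run_value_le _ _ (t * (2 * (B + t) + 6)).+1); last by nia.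
  pose f (x : action) := if x.1.1 == at_ (p :: K) (Go false) then v else v'.
  have ne : (at_ (q :: K) (Go true) == at_ (p :: K) (Go false)) = false by apply/eqP => -[].
  have := @run_value_step (conf (Alt p q :: K) (Go b) s 0) f (t * (2 * (B + t) + 6)).
  rewrite /= at_final // tm_nextE //= big_cons big_seq1 stweightE //= /f /= eqxx ne !mul1r.
  apply=> //; first exact/eqP.
    by rewrite andbT inE; apply/eqP => -[].
  move=> q' c m; rewrite !inE => /orP[] /eqP[-> -> ->].
    by rewrite eqxx (tape_id s 0); apply: IH1.
  by rewrite ne (tape_id s 0); apply: IH2.
- move=> r K s v t _ IH Kc B b sB.
  have K'c : (K : cont) \in conts by apply: conts_succs Kc _; rewrite inE.
  apply: run_value_le; first (apply: run_inc => //; apply: (IH K'c B.+1)).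
    by move=> r' /=; case: eqP => _; have := sB r; have := sB r'; lia.
  have := sB r; nia.
- move=> r K s v t _ IH Kc B b sB.
  have K'c : (K : cont) \in conts by apply: conts_succs Kc _; rewrite inE.
  apply: run_value_le; first (apply: run_rst => //; apply: (IH K'c B)).
    by move=> r' /=; case: eqP => _ //; have := sB r'; lia.
  have := sB r; nia.
- move=> X r d K s v t _ IH Kc B b sB.
  have K'c : (K : cont) \in conts by apply: conts_succs Kc _; rewrite inE.
  apply: run_value_le; first (apply: (@run_tested (Wr X r d) K r K _ s _ v) => //; last exact: (IH K'c B)).
    apply: tape_upd => [|j jr]; rewrite /content /=; congr pair; apply/setP => -[[r'|Y]|].
    - by case: (d); rewrite !inE /=.
    - by case: (d); rewrite !inE tmarkE /= eqxx andbT; case: (Y =P X).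
    - by case: (d); rewrite !inE /=.
    - by rewrite !inE.
    - by rewrite !inE /= (negPf jr) andbF.
    - by rewrite !inE.
  have := sB r; nia.
- move=> r phi p q K s v t _ IH Kc B b sB.
  have K'c : ((if phi (content w s (rg s r)) then p else q) :: K : cont) \in conts.
    by apply: conts_succs Kc _; rewrite !inE; case: ifP => _; rewrite eqxx ?orbT.
  apply: run_value_le; first (apply: (@run_tested (If r phi p q) K r _ _ s s v) => //; last exact: (IH K'c B)).
  + by [].
  + exact: tape_id.
  + have := sB r; nia.
- move=> r phi p K s v t _ IH Kc B b sB.
  have K'c : ((if phi (content w s (rg s r)) then K else p :: Until r phi p :: K) : cont) \in conts.
    by apply: conts_succs Kc _; rewrite !inE; case: ifP => _; rewrite eqxx ?orbT.
  apply: run_value_le; first (apply: (@run_tested (Until r phi p) K r _ _ s s v) => //; last exact: (IH K'c B)).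
  + by [].
  + exact: tape_id.
  + have := sB r; nia.
Qed.

Definition store0 : store := Store (fun=> 0%N) (fun _ _ => false).

Lemma run_init v t : run_value (conf [:: p0] (Go false) store0 0) v t ->
  run_value (init tm w) v t.+1.
Proof.
move=> H; have nf : (None : tmstate) \notin tmfinal by rewrite inE.
have := @run_value_step1 (init tm w) (at_ [:: p0] (Go false)) (content w store0 0) mstay v t.
rewrite /= mul1r; apply=> //.
  rewrite /tm_next; congr [:: (_, _, _)]; rewrite /content; congr pair.
    by case: (w).
  by apply/setP => -[[r|X]|]; case: (w) => [|? ?]; rewrite !inE.
set tp := fun_of_simpl _; suff -> : tp = tape_of store0 by [].
apply/funext => -[j|j] //; rewrite /tp /= eqz_nat; case: (j =P 0%N) => [->//|j0].
have jE : (j == 0%N) = false by exact/eqP.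
rewrite /content; have -> : [set k | has_mark store0 j k] = set0.
  by apply/setP => -[[r|X]|]; rewrite !inE //= eq_sym.
by elim: (w) j {j0 jE} => [|b u IH] [|j] //=.
Qed.

End Programs.

Arguments Skip {S Rg Tk}.
Arguments Fail {S Rg Tk}.
Arguments Wt {S Rg Tk} x.
Arguments Inc {S Rg Tk} v.
Arguments Rst {S Rg Tk} v.
Arguments Wr {S Rg Tk} X v b.

Theorem NP_of_eval (S : pzSemiRingType) (Rg Tk : finType) (p : prog S Rg Tk)
    (P : seq bool -> S) (c k : nat) :
  (forall w, eval w [:: p] (store0 Rg Tk) (P w) (c * (size w).+1 ^ k)) -> NP P.
Proof.
move=> H; apply: (@NP_of_run_value _ _ (tm p) P (9 * (c.+1 * c.+1)) (k + k)) => w.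
set T := (c * (size w).+1 ^ k)%N.
have pc : ([:: p] : {classic (seq (prog S Rg Tk))}) \in conts p.
  by rewrite inE reach_self orbT.
have := eval_run (H w) pc (B := 0) false (fun=> isT); rewrite -/T => /run_init.
move/run_value_le; apply; rewrite expnD.
have : (0 < (size w).+1 ^ k)%N by rewrite expn_gt0.
rewrite /T; set m := (_ ^ k)%N; move: m => m m0; nia.
Qed.

Fixpoint lexi (A : eqType) (r : seq A) (s : seq A) : nat :=
  if s is a :: s' then (index a r * size r ^ size s' + lexi r s')%N else 0.

Section LexTuples.
Variables (A : eqType) (r : seq A).

Lemma size_lex_tuples k : size (lex_tuples r k) = (size r ^ k)%N.
Proof. by elim: k => //= k IH; rewrite size_allpairs IH expnS. Qed.

Lemma cons_tuple_inj k (a : A) : injective (fun t : k.-tuple A => cons_tuple a t).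
Proof. by move=> t t' /(congr1 val)[] /val_inj. Qed.

Lemma mem_lex_tuples k (t : k.-tuple A) : (t \in lex_tuples r k) = all (mem r) t.
Proof.
elim: k t => [|k IH] t; first by rewrite [t]tuple0 mem_seq1 eqxx.
case/tupleP: t => a t /=; rewrite -IH.
apply/allpairsP/andP => [[[b u] /= [br ur]]|[ar tr]].
  by case/(congr1 val) => -> /val_inj->.
by exists (a, t); split=> //; apply: val_inj.
Qed.

Lemma lex_tuples_uniq k : uniq r -> uniq (lex_tuples r k).
Proof.
move=> ur; elim: k => //= k IH; apply: allpairs_uniq => // -[a t] [b u] _ _ /=.
by case/(congr1 val) => -> /val_inj->.
Qed.

Lemma index_allpairs_cons k (a : A) (t : k.-tuple A) (s : seq A) L : a \in s -> t \in L ->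
  index (cons_tuple a t) [seq cons_tuple b u | b <- s, u <- L] =
  (index a s * size L + index t L)%N.
Proof.
move=> + tL; elim: s => // b s IH; rewrite in_cons /= index_cat [b == a]eq_sym.
have [->|ba /= as_] := eqVneq a b.
  by rewrite map_f // index_map //; apply: cons_tuple_inj.
rewrite size_map IH // mulSn addnA ifN //.
by apply/mapP => -[u _ /(congr1 val)[/eqP]]; rewrite (negPf ba).
Qed.

Lemma index_lex_tuples k (t : k.-tuple A) : all (mem r) t ->
  index t (lex_tuples r k) = lexi r t.
Proof.
elim: k t => [|k IH] t; first by rewrite [t]tuple0 /=.
case/tupleP: t => a t /= /andP[ar tr].
have -> : [tuple of a :: t] = cons_tuple a t by apply: val_inj.
rewrite -IH // [size t]size_tuple -size_lex_tuples.
by rewrite index_allpairs_cons // mem_lex_tuples.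
Qed.

Lemma lexi_lt (s : seq A) : all (mem r) s -> (lexi r s < size r ^ size s)%N.
Proof.
move=> sr; have := sr; rewrite -[s]/(val (in_tuple s)) -mem_lex_tuples.
by rewrite -index_mem index_lex_tuples // size_lex_tuples.
Qed.

Lemma lexi_inj k (t u : k.-tuple A) : all (mem r) t -> all (mem r) u ->
  lexi r t = lexi r u -> t = u.
Proof.
move=> tr ur; rewrite -!index_lex_tuples // => E.
have tL : t \in lex_tuples r k by rewrite mem_lex_tuples.
have uL : u \in lex_tuples r k by rewrite mem_lex_tuples.
by rewrite -(nth_index t tL) E nth_index.
Qed.

End LexTuples.

Lemma onth_index (A : eqType) (r : seq A) a : a \in r -> onth r (index a r) = Some a.
Proof. by move=> ar; rewrite onthE (nth_map a) ?index_mem // nth_index. Qed.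

Lemma onth_lt (A : Type) (r : seq A) i : (i < size r)%N -> exists a, onth r i = Some a.
Proof. by rewrite -onthTE; case: onth => // a _; exists a. Qed.

Lemma onth_uniq (A : eqType) (r : seq A) i a : uniq r -> onth r i = Some a ->
  a \in r /\ index a r = i.
Proof.
move=> ur ia; have ir : (i < size r)%N by rewrite -onthTE ia.
have <- : nth a r i = a by apply: onth_nth.
by rewrite mem_nth // index_uniq.
Qed.

Section Specifications.
Variables (S : pzSemiRingType) (Rg Tk : finType) (w : seq bool).
Local Notation prog := (prog S Rg Tk).
Local Notation store := (store Rg Tk).
Local Notation cell := (cell Rg Tk).
Implicit Types (p q : prog) (s : store) (K : seq prog).

Definition det p s s' c := forall K v t,
  eval w K s' v t -> eval w (p :: K) s v (t + c).

Definition eqr (u : Rg) (a : cell) : bool := rmark Tk u \in a.2.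
Definition zero (a : cell) : bool := None \in a.2.
Definition one_bit (a : cell) : bool := a.1 == Some true.
Definition on_track (X : Tk) (a : cell) : bool := tmark Rg X \in a.2.

Lemma eqrE u s i : eqr u (content w s i) = (rg s u == i).
Proof. by rewrite /eqr inE. Qed.

Lemma zeroE s i : zero (content w s i) = (i == 0%N).
Proof. by rewrite /zero inE. Qed.

Lemma on_trackE X s i : on_track X (content w s i) = tk s X i.
Proof. by rewrite /on_track inE. Qed.

Lemma store_ext s s' : rg s =1 rg s' -> tk s =2 tk s' -> s = s'.
Proof.
case: s s' => [r t] [r' t'] /= /funext-> H; congr Store.
by apply/funext => X; apply/funext => i.
Qed.

Lemma rg_setr v k s u : rg (setr v k s) u = if u == v then k else rg s u.
Proof. by []. Qed.

Lemma tk_setr v k s : tk (setr v k s) = tk s.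
Proof. by []. Qed.

Lemma setr_id v s : setr v (rg s v) s = s.
Proof. by apply: store_ext => // r /=; case: (r =P v) => [->|]. Qed.

Lemma setr_setr v i j s : setr v i (setr v j s) = setr v i s.
Proof. by apply: store_ext => // r /=; case: (r =P v). Qed.

Lemma setrC u v i j s : u != v -> setr u i (setr v j s) = setr v j (setr u i s).
Proof.
move=> /eqP uv; apply: store_ext => // r /=.
by case: (r =P u) => [->|//]; case: (u =P v).
Qed.

Lemma det_le p s s' c c' : det p s s' c -> (c <= c')%N -> det p s s' c'.
Proof. by move=> H cc K v t /H/eval_le; apply; rewrite leq_add2l. Qed.

Lemma det_inc v s : det (Inc v) s (setr v (rg s v).+1 s) 1.
Proof. by move=> K x t H; rewrite addn1; apply: EvalInc. Qed.

Lemma det_skip s : det Skip s s 1.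
Proof. by move=> K x t H; rewrite addn1; apply: EvalSkip. Qed.

Lemma det_seq p q s s1 s2 c c' : det p s s1 c -> det q s1 s2 c' ->
  det (Seq p q) s s2 (c' + c).+1.
Proof.
by move=> Hp Hq K x t H; rewrite addnS; apply: EvalSeq; rewrite addnA; apply/Hp/Hq.
Qed.

Definition For (y u : Rg) p : prog :=
  Seq (Until y (eqr u) (Seq p (Inc y))) (Rst y).

Lemma eval_for y u p K (n : nat) (s : nat -> store) (g : nat -> S -> S) c v t :
  (forall i, (i <= n)%N -> rg (s i) y = i /\ rg (s i) u = n) ->
  (forall i K v t, (i < n)%N ->
     eval w K (setr y i (s i.+1)) v t -> eval w (p :: K) (s i) (g i v) (t + c)) ->
  eval w K (setr y 0 (s n)) v t ->
  eval w (For y u p :: K) (s 0) (foldr g v (iota 0 n)) (t + (n * (c + 3) + 3)).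
Proof.
move=> Hs Hp H; rewrite !addnS; apply: EvalSeq; rewrite -addnS.
have loop : forall k i, (i + k = n)%N ->
    eval w (Until y (eqr u) (Seq p (Inc y)) :: Rst y :: K) (s i)
      (foldr g v (iota i k)) (t + (k * (c + 3) + 2)).
  elim=> [|k IH] i ikn.
    have [yE uE] := Hs i ltac:(lia); rewrite addn0 in ikn.
    have -> : (t + (0 * (c + 3) + 2) = t.+2)%N by lia.
    apply: EvalUntil.
    by rewrite eqrE yE uE -ikn eqxx; apply: EvalRst; rewrite ikn.
  have [yE uE] := Hs i ltac:(lia).
  have -> : (t + (k.+1 * (c + 3) + 2) = ((t + (k * (c + 3) + 2)).+1 + c).+2)%N by lia.
  apply: EvalUntil; rewrite eqrE yE uE ifN; last by lia.
  apply: EvalSeq; apply: Hp; first by lia.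
  apply: EvalInc => /=; rewrite eqxx setr_setr.
  have [yE' _] := Hs i.+1 ltac:(lia).
  have -> : setr y i.+1 (s i.+1) = s i.+1 by rewrite -{1}yE' setr_id.
  by apply: IH; lia.
by have := loop n 0%N (add0n n); congr (eval _ _ _ _ _); lia.
Qed.

Lemma det_for y u p (n : nat) (s : nat -> store) c s' :
  (forall i, (i <= n)%N -> rg (s i) y = i /\ rg (s i) u = n) ->
  (forall i, (i < n)%N -> det p (s i) (setr y i (s i.+1)) c) ->
  s' = setr y 0 (s n) ->
  det (For y u p) (s 0) s' (n * (c + 3) + 3).
Proof.
move=> Hs Hp -> K v t H.
have := @eval_for y u p K n s (fun _ v => v) c v t Hs _ H.
have -> : foldr (fun _ : nat => id) v (iota 0 n) = v by elim: (iota 0 n).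
by apply=> i K' v' t' /Hp; apply.
Qed.

Definition Guess (x u f : Rg) : prog :=
  Seq (Until f (fun a => ~~ zero a)
         (If x (eqr u) Fail (Alt (Inc f) (Inc x))))
      (Rst f).

Lemma eval_guess x u f K s (n : nat) (g : nat -> S) t :
  x != f -> x != u -> f != u -> rg s x = 0%N -> rg s f = 0%N -> rg s u = n ->
  (forall i, (i < n)%N -> eval w K (setr x i s) (g i) t) ->
  eval w (Guess x u f :: K) s (\sum_(i < n) g i) (t + (n * 4 + 8)).
Proof.
move=> xf xu fu x0 f0 un H; have nE : (t + (n * 4 + 8) = (t + (n * 4 + 7)).+1)%N by lia.
rewrite nE; apply: EvalSeq.
have loop : forall k i, (i + k = n)%N ->
    eval w (Until f (fun a => ~~ zero a)
         (If x (eqr u) Fail (Alt (Inc f) (Inc x))) :: Rst f :: K)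
      (setr x i s) (\sum_(i <= j < n) g j) (t + (k * 4 + 7)).
  elim=> [|k IH] i ikn.
    rewrite big_geq; last by lia.
    apply: (eval_le (t := t + 4)); last by lia.
    rewrite !addnS; apply: EvalUntil; rewrite /= [f == x]eq_sym (negPf xf) zeroE f0 /=.
    by apply: EvalIf; rewrite /= eqxx eqrE /= [u == x]eq_sym (negPf xu) un ifT; [apply: EvalFail|lia].
  rewrite big_ltn; last by lia.
  have -> : (t + (k.+1 * 4 + 7) = (t + (k * 4 + 7)).+4)%N by lia.
  apply: EvalUntil; rewrite /= [f == x]eq_sym (negPf xf) zeroE f0 /=.
  apply: EvalIf; rewrite /= eqxx eqrE /= [u == x]eq_sym (negPf xu) un ifF; last by lia.
  apply: EvalAlt.
    apply: EvalInc => /=; rewrite [f == x]eq_sym (negPf xf) f0.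
    apply: (eval_le (t := t + 2)); last by lia.
    rewrite !addnS; apply: EvalUntil; rewrite /= eqxx zeroE /=; apply: EvalRst.
    rewrite setr_setr setrC 1?eq_sym // -[in setr f 0%N s]f0 setr_id addn0.
    by apply: H; lia.
  apply: EvalInc; rewrite /= eqxx setr_setr.
  by apply: eval_le; first apply: IH; lia.
rewrite -(big_mkord xpredT) -[s in eval _ _ s](setr_id x) x0.
exact: loop.
Qed.

End Specifications.

Arguments setr : simpl never.

Fixpoint lexn (n : nat) (l : seq nat) : nat :=
  if l is i :: l' then (i * n ^ size l' + lexn n l')%N else 0.

Lemma lexiE (A : eqType) (r s : seq A) :
  lexi r s = lexn (size r) [seq index a r | a <- s].
Proof. by elim: s => //= a s ->; rewrite size_map. Qed.

Lemma take_onth (A : Type) (r : seq A) i a : onth r i = Some a ->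
  take i.+1 r = rcons (take i r) a.
Proof.
move=> ia; have ir : (i < size r)%N by rewrite -onthTE ia.
by rewrite (take_nth a) //; congr rcons; apply: onth_nth.
Qed.

(** * Programs evaluating weighted formulas *)

Section Compile.
Variables (S : pzSemiRingType) (tau : vocabulary) (Bd : nat) (Xs : seq sovar).

Definition reg : finType := (bool * bool * bool * 'I_Bd.+1)%type.
Definition track : finType := 'I_(size Xs).+1.
Local Notation prog := (prog S reg track).
Local Notation store := (store reg track).

(* [rv i] holds the rank of the variable bound at depth [i], [rf i] is a flag
   local to depth [i], [ry i] are loop counters, [rN] is the size of the
   universe, [rp] a pointer into the encoding or a track, [rL] the length of a
   track and [rW] that of the encoding, plus one. *)
Definition rv (i : nat) : reg := (false, false, false, inord i).
Definition rf (i : nat) : reg := (false, false, true, inord i).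
Definition ry (i : nat) : reg := (false, true, false, inord i).
Definition rN : reg := (false, true, true, ord0).
Definition rp : reg := (true, false, false, ord0).
Definition rW : reg := (true, false, true, ord0).
Definition rL : reg := (true, true, false, ord0).
Definition trk (X : sovar) : track := inord (index X Xs).

Lemma inord_neq i j : (i <= Bd)%N -> (j <= Bd)%N -> i != j ->
  (inord i : 'I_Bd.+1) != inord j.
Proof. by move=> iB jB; apply: contra => /eqP/(congr1 val); rewrite /= !inordK // => ->. Qed.

Lemma rv_neq i j : (i <= Bd)%N -> (j <= Bd)%N -> i != j -> rv i != rv j.
Proof. by move=> iB jB /(inord_neq iB jB)/eqP ij; apply/eqP => -[]. Qed.

Lemma rf_neq i j : (i <= Bd)%N -> (j <= Bd)%N -> i != j -> rf i != rf j.
Proof. by move=> iB jB /(inord_neq iB jB)/eqP ij; apply/eqP => -[]. Qed.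

Lemma ry_neq i j : (i <= Bd)%N -> (j <= Bd)%N -> i != j -> ry i != ry j.
Proof. by move=> iB jB /(inord_neq iB jB)/eqP ij; apply/eqP => -[]. Qed.

Fixpoint addpow (t : reg) (k : nat) : prog :=
  if k is k'.+1 then For (ry k') rN (addpow t k') else Inc t.

Fixpoint addpows (t : reg) (ks : seq nat) : prog :=
  if ks is k :: ks' then Seq (addpow t k) (addpows t ks') else Skip.

Fixpoint addlex (t : reg) (us : seq reg) : prog :=
  if us is u :: us' then
    Seq (For (ry (size us')) u (addpow t (size us'))) (addlex t us')
  else Skip.

Fixpoint pcost (k n : nat) : nat :=
  if k is k'.+1 then (n * (pcost k' n + 3) + 3)%N else 1.

Fixpoint pscost (ks : seq nat) (n : nat) : nat :=
  if ks is k :: ks' then (pscost ks' n + pcost k n).+1 else 1.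

Fixpoint lcost (l n : nat) : nat :=
  if l is l'.+1 then (lcost l' n + pcost l'.+1 n).+1 else 1.

Definition is_ry (u : reg) : bool := if u is (false, true, false, _) then true else false.

Lemma ry_not u i : ~~ is_ry u -> ry i != u.
Proof. by move: u => [[[[] []] []] j] //= _; apply/eqP => -[]. Qed.

Section Counting.
Variable w : seq bool.

Lemma det_addpow t k s : (k <= Bd.+1)%N -> (forall j, (j < k)%N -> rg s (ry j) = 0%N) ->
  ~~ is_ry t -> t != rN ->
  det w (addpow t k) s (setr t (rg s t + rg s rN ^ k) s) (pcost k (rg s rN)).
Proof.
elim: k s => [|k IH] s kB y0 ty tN; first by rewrite expn0 addn1; exact: det_inc.
set n := rg s rN; pose sg i := setr (ry k) i (setr t (rg s t + i * n ^ k) s).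
have yt : ry k != t by exact: ry_not.
have yN : ry k != rN by exact: ry_not.
have s0 : s = sg 0%N.
  by rewrite /sg mul0n addn0 setr_id -(y0 k) // setr_id.
rewrite [in det _ _ _]s0; apply: det_for.
- move=> i _; rewrite /sg !rg_setr eqxx; split=> //.
  by rewrite [rN == ry k]eq_sym (negPf yN) eq_sym (negPf tN).
- move=> i ni.
  have nE : rg (sg i) rN = n by rewrite /sg !rg_setr [rN == ry k]eq_sym (negPf yN) [rN == t]eq_sym (negPf tN).
  have -> : setr (ry k) i (sg i.+1) = setr t (rg (sg i) t + rg (sg i) rN ^ k) (sg i).
    rewrite nE /sg setr_setr [RHS]setrC 1?eq_sym // setr_setr !rg_setr.
    by rewrite [t == ry k]eq_sym (negPf yt) eqxx mulSn [(n ^ k + _)%N]addnC addnA.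
  rewrite -nE; apply: IH => //; first by lia.
  move=> j jk; rewrite /sg !rg_setr ifN; last by apply: ry_neq; lia.
  by rewrite ?rg_setr ifN ?y0 //; [lia | exact: ry_not].
- by rewrite /sg setr_setr expnS [RHS]setrC // -{1}(y0 k) // setr_id.
Qed.

Lemma det_addpows t ks s : all (fun k => k <= Bd.+1)%N ks ->
  (forall j, rg s (ry j) = 0%N) -> ~~ is_ry t -> t != rN ->
  det w (addpows t ks) s (setr t (rg s t + sumn [seq rg s rN ^ k | k <- ks])%N s)
    (pscost ks (rg s rN)).
Proof.
move=> + + ty tN; elim: ks s => [|k ks IH] s /=.
  by move=> _ _; rewrite addn0 setr_id; exact: det_skip.
move=> /andP[kB ksB] y0; have nE m : rg (setr t m s) rN = rg s rN by rewrite rg_setr eq_sym (negPf tN).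
apply: det_seq; first by apply: det_addpow => // j _; exact: y0.
have := IH (setr t (rg s t + rg s rN ^ k) s) ksB.
rewrite nE rg_setr eqxx setr_setr addnA; apply=> // j.
by rewrite ?rg_setr ifN ?y0 // ry_not.
Qed.

Lemma det_addlex t us s : (size us <= Bd.+1)%N ->
  (forall j, rg s (ry j) = 0%N) -> ~~ is_ry t -> t != rN ->
  all (fun u => [&& ~~ is_ry u, u != t & (rg s u < rg s rN)%N]) us ->
  det w (addlex t us) s (setr t (rg s t + lexn (rg s rN) [seq rg s u | u <- us])%N s)
    (lcost (size us) (rg s rN)).
Proof.
move=> + + ty tN; elim: us s => [|u us IH] s /=.
  by move=> _ _ _; rewrite addn0 setr_id; exact: det_skip.
move=> sB y0 /andP[/and3P[uy ut un] us_ok]; rewrite size_map.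
set k := size us in sB IH *; set n := rg s rN in un *.
have Nt : (rN == t) = false by rewrite eq_sym (negPf tN).
have nE m : rg (setr t m s) rN = n by rewrite rg_setr Nt.
have yt : ry k != t by exact: ry_not.
have yN : ry k != rN by exact: ry_not.
have yu : ry k != u by exact: ry_not.
apply: (det_seq (s1 := setr t (rg s t + rg s u * n ^ k) s)); last first.
  have := IH (setr t (rg s t + rg s u * n ^ k) s).
  rewrite nE rg_setr eqxx setr_setr addnA.
  have -> : [seq rg (setr t (rg s t + rg s u * n ^ k)%N s) u' | u' <- us] = [seq rg s u' | u' <- us].
    by apply/eq_in_map => u' /(allP us_ok)/and3P[_ /negPf u't _]; rewrite rg_setr u't.
  apply=> //; first by lia.
    by move=> j; rewrite ?rg_setr ifN ?y0 // ry_not.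
  by apply: sub_all us_ok => u' /and3P[-> u't]; rewrite rg_setr (negPf u't).
apply: (det_le (c := rg s u * (pcost k n + 3) + 3)); last by rewrite /=; nia.
pose sg i := setr (ry k) i (setr t (rg s t + i * n ^ k) s).
have s0 : s = sg 0%N.
  by rewrite /sg mul0n addn0 setr_id -(y0 k) // setr_id.
have nE' i : rg (sg i) rN = n by rewrite /sg !rg_setr [rN == ry k]eq_sym (negPf yN) Nt.
rewrite [X in det _ _ X _ _]s0; apply: det_for.
- move=> i _; rewrite /sg !rg_setr eqxx; split=> //.
  by rewrite [u == ry k]eq_sym (negPf yu) (negPf ut).
- move=> i ni.
  have -> : setr (ry k) i (sg i.+1) = setr t (rg (sg i) t + rg (sg i) rN ^ k) (sg i).
    rewrite nE' /sg setr_setr [RHS]setrC 1?eq_sym // setr_setr !rg_setr.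
    by rewrite [t == ry k]eq_sym (negPf yt) eqxx mulSn [(n ^ k + _)%N]addnC addnA.
  rewrite -(nE' i); apply: det_addpow => //; first by lia.
  move=> j jk; rewrite /sg !rg_setr ifN; last by apply: ry_neq; lia.
  by rewrite ?rg_setr ifN ?y0 // ry_not.
- by rewrite /sg setr_setr [RHS]setrC // -{1}(y0 k) // setr_id.
Qed.

End Counting.
End Compile.

Lemma exists_tupleE (A : finType) k (I : {set k.-tuple A})
    (rho : nat -> option A) (xs : k.-tuple nat) (t : k.-tuple A) :
  map rho xs = map Some t ->
  [exists u in I, map rho xs == map Some (tval u)] = (t \in I).
Proof.
move=> xt; rewrite xt; apply/existsP/idP => [[u /andP[uI /eqP E]]|tI].
  suff -> : t = u by [].
  by apply/val_inj; apply: inj_map E; apply: Some_inj.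
by exists t; rewrite tI eqxx.
Qed.

Section CompileFormulas.
Variables (S : pzSemiRingType) (tau : vocabulary) (Bd : nat) (Xs : seq sovar).
Hypothesis arity_le : forall R : sym tau, (arity R <= Bd.+1)%N.
Local Notation prog := (prog S (reg Bd) (track Xs)).
Local Notation store := (store (reg Bd) (track Xs)).
Local Notation trk X := (trk Xs X).
Local Notation zero := (@zero (reg Bd) (track Xs)).
Local Notation eqr u := (@eqr (reg Bd) (track Xs) u).

Definition before (R : sym tau) : seq nat :=
  [seq arity R' | R' <- take (index R (enum (sym tau))) (enum (sym tau))].

Definition regs (env : nat -> nat) (xs : seq nat) : seq (reg Bd) :=
  [seq rv Bd (env x) | x <- xs].

Fixpoint bcomp (d : nat) (env : nat -> nat) (b : bformula (with_lt tau))
    (pt pf : prog) : prog :=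
  match b with
  | BFalse => pf
  | BRel R xs =>
      match R with
      | Some R =>
          Seq (addpows S Xs (rp Bd) (before R)) (Seq (addlex S Xs (rp Bd) (regs env xs))
            (If (rp Bd) (@one_bit (reg Bd) (track Xs))
              (Seq (Rst (rp Bd)) pt) (Seq (Rst (rp Bd)) pf)))
      | None =>
          if regs env xs is [:: u; v] then
            Seq (For (ry Bd 0) v (If (ry Bd 0) (eqr u) (Inc (rf Bd d)) Skip))
              (If (rf Bd d) zero pf (Seq (Rst (rf Bd d)) pt))
          else pf
      end
  | BVar X xs =>
      Seq (addlex S Xs (rp Bd) (regs env xs))
        (If (rp Bd) (@on_track (reg Bd) (track Xs) (trk X))
          (Seq (Rst (rp Bd)) pt) (Seq (Rst (rp Bd)) pf))
  | BEq x y => If (rv Bd (env x)) (eqr (rv Bd (env y))) pt pf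
  | BNot b => bcomp d env b pf pt
  | BOr b1 b2 => bcomp d env b1 pt (bcomp d env b2 pt pf)
  | BEx x b =>
      Seq (For (rv Bd d) (rN Bd)
             (bcomp d.+1 [eta env with x |-> d] b (Inc (rf Bd d)) Skip))
        (If (rf Bd d) zero pf (Seq (Rst (rf Bd d)) pt))
  | BExSO _ _ => pf
  end.

Fixpoint bcost (b : bformula (with_lt tau)) (n : nat) : nat :=
  match b with
  | BRel R xs =>
      if R is Some R then (pscost (before R) n + lcost (arity R) n + 5)%N
      else (n * 5 + 7)%N
  | BVar X xs => (lcost (ar X) n + 5)%N
  | BNot b => bcost b n
  | BOr b1 b2 => (bcost b1 n + bcost b2 n)%N
  | BEx x b => (n * (bcost b n + 4) + 7)%N
  | _ => 1
  end.

(* [bneed] and [wneed] bound both the depth of the quantifiers and the arities of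
   the second-order variables. *)
Fixpoint bneed (b : bformula (with_lt tau)) : nat :=
  match b with
  | BVar X _ => ar X
  | BNot b => bneed b
  | BOr b1 b2 => (bneed b1 + bneed b2)%N
  | BEx _ b => (bneed b).+1
  | _ => 0
  end.

Fixpoint wcomp (d : nat) (env : nat -> nat) (f : wformula S (with_lt tau)) : prog :=
  match f with
  | WBool b => bcomp d env b Skip Fail
  | WConst x => Wt x
  | WAdd f1 f2 => Alt (wcomp d env f1) (wcomp d env f2)
  | WMul f1 f2 => Seq (wcomp d env f1) (wcomp d env f2)
  | WSum x f =>
      Seq (Guess S (track Xs) (rv Bd d) (rN Bd) (rf Bd d))
        (Seq (wcomp d.+1 [eta env with x |-> d] f) (Rst (rv Bd d)))
  | WProd x f => For (rv Bd d) (rN Bd) (wcomp d.+1 [eta env with x |-> d] f)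
  | _ => Skip
  end.

Fixpoint wcost (f : wformula S (with_lt tau)) (n : nat) : nat :=
  match f with
  | WBool b => (bcost b n + 1)%N
  | WAdd f1 f2 | WMul f1 f2 => (wcost f1 n + wcost f2 n + 1)%N
  | WSum _ f => (n * 4 + wcost f n + 11)%N
  | WProd _ f => (n * (wcost f n + 3) + 3)%N
  | _ => 1
  end.

Fixpoint wneed (f : wformula S (with_lt tau)) : nat :=
  match f with
  | WBool b => bneed b
  | WAdd f1 f2 | WMul f1 f2 => (wneed f1 + wneed f2)%N
  | WSum _ f | WProd _ f => (wneed f).+1
  | _ => 0
  end.

Section Correctness.
Variables (A : structure (with_lt tau)) (r : seq A) (w : seq bool).
Hypothesis r_uniq : uniq r.
Hypothesis r_all : forall a, a \in r.
Hypothesis r_lt : forall a b : A, ltA A a b = (index a r < index b r)%N.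
Local Notation n := (size r).
Hypothesis w_reads : forall R (t : (arity R).-tuple A),
  (t \in @interp _ A (Some R)) =
  (onth w (sumn [seq (n ^ k)%N | k <- before R] + lexi r t)%N == Some true).

Record regs_inv (d : nat) (env : nat -> nat) (V : seq nat) (W : seq sovar)
    (s : store) (rho : nat -> option A) (eta : so_assignment A) : Prop := Inv {
  inv_N : rg s (rN Bd) = n;
  inv_var : forall x, x \in V -> (env x < d)%N /\
    exists2 a, rho x = Some a & rg s (rv Bd (env x)) = index a r;
  inv_rv0 : forall i, (d <= i <= Bd)%N -> rg s (rv Bd i) = 0%N;
  inv_rf0 : forall i, (d <= i <= Bd)%N -> rg s (rf Bd i) = 0%N;
  inv_ry0 : forall i, rg s (ry Bd i) = 0%N;
  inv_rp0 : rg s (rp Bd) = 0%N;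
  inv_track : forall X (t : (ar X).-tuple A), X \in W ->
    (t \in eta X) = tk s (trk X) (lexi r t)
}.

Lemma inv_push d env V W s rho eta x i a c : regs_inv d env V W s rho eta ->
  (d <= Bd)%N -> onth r i = Some a ->
  regs_inv d.+1 [eta env with x |-> d] (x :: V) W
    (setr (rv Bd d) i (setr (rf Bd d) c s)) [eta rho with x |-> Some a] eta.
Proof.
case=> iN iV iv if_ iy ip it dB ia; split=> //.
- move=> y; rewrite in_cons /=; case: (y =P x) => [-> _|yx /= yV].
    rewrite ltnSn eqxx; split=> //; exists a => //.
    by have [_ ->] := onth_uniq r_uniq ia.
  have [yd [b rb yE]] := iV _ yV; split; first by lia.
  by exists b => //; rewrite ?rg_setr ifN ?rv_neq //; lia.
- move=> j dj; rewrite !rg_setr ifN ?rv_neq //; try lia.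
  by apply: iv; lia.
- by move=> j dj; rewrite !rg_setr ifN ?rf_neq ?if_ //; lia.
Qed.

Lemma inv_vals d env V W s rho eta k (xs : k.-tuple nat) : regs_inv d env V W s rho eta ->
  all (mem V) xs ->
  exists2 t : k.-tuple A, map rho xs = map Some t &
    [seq rg s u | u <- regs env xs] = [seq index a r | a <- t].
Proof.
move=> H; elim: k xs => [|k IH] xs; first by exists [tuple]; rewrite [xs]tuple0.
case/tupleP: xs => x xs /= /andP[xV /IH[t tE tE']].
have [_ [a xa xE]] := inv_var H xV.
by exists (cons_tuple a t) => /=; rewrite ?xa ?xE ?tE // [RHS]/= -tE'.
Qed.

Lemma rf_ry i j : (rf Bd i == ry Bd j) = false. Proof. by apply/eqP => -[]. Qed.

Lemma rf_rv i j : (rf Bd i == rv Bd j) = false. Proof. by apply/eqP => -[]. Qed.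

Lemma eval_lookup phi us s k (b : bool) pt pf K v t :
  rg s (rN Bd) = n -> (forall i, rg s (ry Bd i) = 0%N) -> rg s (rp Bd) = k ->
  (size us <= Bd.+1)%N ->
  all (fun u => [&& ~~ is_ry u, u != rp Bd & (rg s u < n)%N]) us ->
  phi (content w (setr (rp Bd) (k + lexn n [seq rg s u | u <- us]) s)
         (k + lexn n [seq rg s u | u <- us])) = b ->
  eval w ((if b then pt else pf) :: K) (setr (rp Bd) 0 s) v t ->
  eval w (Seq (addlex S Xs (rp Bd) us)
            (If (rp Bd) phi (Seq (Rst (rp Bd)) pt) (Seq (Rst (rp Bd)) pf)) :: K) s v
    (t + (lcost (size us) n + 4)).
Proof.
move=> sN y0 sp us_size us_ok phiE H.
have -> : (t + (lcost (size us) n + 4) = (t.+3 + lcost (size us) n).+1)%N by lia.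
apply: EvalSeq; rewrite -sN; apply: (det_addlex (s := s)) => //; rewrite ?sN //.
apply: EvalIf; rewrite rg_setr eqxx sp phiE.
have -> : (if b then Seq (Rst (rp Bd)) pt else Seq (Rst (rp Bd)) pf) =
  Seq (Rst (rp Bd)) (if b then pt else pf) by case: (b).
by apply: EvalSeq; apply: EvalRst; rewrite setr_setr.
Qed.

Lemma regs_ok d env V W s rho eta xs : regs_inv d env V W s rho eta -> all (mem V) xs ->
  all (fun u => [&& ~~ is_ry u, u != rp Bd & (rg s u < n)%N]) (regs env xs).
Proof.
move=> H /allP xV; rewrite all_map; apply/allP => x /xV xV' /=.
by have [_ [a _ ->]] := inv_var H xV'; rewrite index_mem r_all.
Qed.

Lemma index_r_inj (a b : A) : index a r = index b r -> a = b.
Proof. by move=> E; rewrite -(nth_index a (r_all a)) E nth_index. Qed.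

Lemma eval_bcomp b d env V W s rho eta pt pf K v t :
  bfirst_order b -> bclosed V W b -> (d + bneed b <= Bd)%N ->
  regs_inv d env V W s rho eta ->
  eval w ((if bsem rho eta b then pt else pf) :: K) s v t ->
  eval w (bcomp d env b pt pf :: K) s v (t + bcost b n).
Proof.
elim: b d env V s rho pt pf K v t => [|R xs|X xs|x y|b IH|b1 IH1 b2 IH2|x b IH|X b IH]
  d env V s rho pt pf K v t fo cl need H.
- by move/eval_le; apply; lia.
- case: R xs fo cl need => [R|] xs fo cl need /= Hv.
    have [u xu uE] := inv_vals H cl.
    have -> : (t + (pscost (before R) n + lcost (arity R) n + 5) =
      (t + (lcost (arity R) n + 4) + pscost (before R) n).+1)%N by lia.
    apply: EvalSeq; rewrite -{2}(inv_N H); apply: det_addpows => //.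
    - by apply/allP => _ /mapP[R' _ ->].
    - exact: inv_ry0 H.
    rewrite (inv_N H) (inv_rp0 H) add0n.
    have -> : lcost (arity R) n = lcost (size (regs env xs)) n by rewrite size_map size_tuple.
    have E m : [seq rg (setr (rp Bd) m s) u | u <- regs env xs] = [seq index a r | a <- u].
      by rewrite -uE; apply/eq_in_map => u' /(allP (regs_ok H cl))/and3P[_ /negPf u'p _]; rewrite rg_setr u'p.
    apply: (eval_lookup (b := bsem rho eta (BRel (tau := with_lt tau) (R := Some R) xs))) => //.
    - exact: inv_N H.
    - by move=> i; rewrite rg_setr (inv_ry0 H).
    - by rewrite size_map size_tuple arity_le.
    - apply/allP => u' /(allP (regs_ok H cl))/and3P[-> u'p]; rewrite u'p rg_setr.
      by rewrite (negPf u'p).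
    - by rewrite E setr_setr /= (exists_tupleE _ xu) w_reads -lexiE /one_bit.
    - by rewrite setr_setr -(inv_rp0 H) setr_id.
  have [u xu uE] := inv_vals H cl.
  case/tupleP: xs fo cl need xu uE Hv => x xs; case/tupleP: xs => y xs; rewrite [xs]tuple0 {xs}.
  case/tupleP: u => a u; case/tupleP: u => b u; rewrite [u]tuple0 {u} => fo cl need xu [aE bE] Hv.
  rewrite /= in aE bE; move: need; rewrite /= addn0 => need.
  have f0 : rg s (rf Bd d) = 0%N by apply: (inv_rf0 H); lia.
  have y0 := inv_ry0 H 0.
  have f0' : setr (rf Bd d) 0 s = s by rewrite -{1}f0 setr_id.
  have y0' : setr (ry Bd 0) 0 s = s by rewrite -{2}y0 setr_id.
  pose sg i := setr (ry Bd 0) i (setr (rf Bd d) (index a r < i)%N s).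
  have -> : s = sg 0%N by rewrite /sg ltn0 f0' y0'.
  have bn : (index b r < n)%N by rewrite index_mem.
  apply: (eval_le (t := (t.+3 + (index b r * (2 + 3) + 3)).+1)); last by lia.
  apply: EvalSeq; apply: (det_for (n := index b r) (s' := setr (rf Bd d) (index a r < index b r)%N s)).
  - by move=> i _; rewrite /sg !rg_setr eqxx.
  - move=> i ib K' v' t' H'; rewrite addn2; apply: EvalIf.
    have iE : rg (sg i) (ry Bd 0) = i by rewrite /sg rg_setr eqxx.
    have uE : rg (sg i) (rv Bd (env x)) = index a r.
      by rewrite /sg !rg_setr -aE; case: eqP => [[]|_] //; case: eqP => [[]|_].
    rewrite eqrE uE iE.
    case: eqP => ai.
      have fE : rg (sg i) (rf Bd d) = 0%N by rewrite /sg rg_setr rf_ry rg_setr eqxx ai ltnn.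
      apply: EvalInc; rewrite fE.
      have -> // : setr (rf Bd d) 1 (sg i) = setr (ry Bd 0) i (sg i.+1).
      by rewrite /sg setr_setr [LHS]setrC ?rf_ry // setr_setr ai ltnSn.
    apply: EvalSkip; move: H'; rewrite /sg !setr_setr.
    by have -> : (index a r < i.+1)%N = (index a r < i)%N by lia.
  - by rewrite /sg setr_setr [RHS]setrC // y0'.
  apply: EvalIf; rewrite rg_setr eqxx zeroE.
  have /esym semE := exists_tupleE (@interp _ A None) xu.
  move: Hv; rewrite -semE.
  have -> : ([tuple of a :: [tuple of b :: [tuple]]] \in @interp _ A None) = (index a r < index b r)%N.
    rewrite -r_lt /ltA; congr (_ \in _); exact: val_inj.
  case: ltnP => _ Hv /=; last by rewrite f0'; apply: eval_le Hv _; lia.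
  by apply: EvalSeq; apply: EvalRst; rewrite setr_setr f0'.
- move=> Hv; have [u xu uE] := inv_vals H (proj2 (andP cl)).
  have E : [seq rg s u | u <- regs env xs] = [seq index a r | a <- u] by [].
  apply: eval_le; first (apply: (eval_lookup (k := 0) (b := bsem rho eta (BVar (with_lt tau) xs))) => //).
  - exact: inv_N H.
  - exact: inv_ry0 H.
  - exact: inv_rp0 H.
  - by rewrite size_map size_tuple; move: need => /=; lia.
  - exact: regs_ok H (proj2 (andP cl)).
  - rewrite add0n E on_trackE tk_setr -lexiE /= (exists_tupleE _ xu).
    by rewrite (inv_track H) //; case/andP: cl.
  - by rewrite -(inv_rp0 H) setr_id; exact: Hv.
  - by rewrite /= size_map size_tuple; lia.
- move: cl => /andP[xV yV] Hv; have [_ [a xa xE]] := inv_var H xV; have [_ [b yb yE]] := inv_var H yV.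
  rewrite /= addn1; apply: EvalIf; rewrite eqrE xE yE.
  move: Hv; rewrite /= xa yb; suff -> : [exists a0, (Some a == Some a0) && (Some b == Some a0)] = (index b r == index a r).
    by case: eqP.
  apply/existsP/eqP => [[c /andP[/eqP[->] /eqP[->]]] //|/index_r_inj ->].
  by exists a; rewrite eqxx.
- by move=> Hv; apply: IH cl need H _ => //; move: Hv => /=; case: bsem.
- move: fo cl => /andP[fo1 fo2] /andP[cl1 cl2].
  rewrite [bcost _ _]addnC addnA => Hv; apply: (IH1 _ _ V _ rho) => //; first by move: need => /=; lia.
  move: Hv => /=; case: bsem => /=; first by move/eval_le; apply; lia.
  by move=> Hv; apply: (IH2 _ _ V _ rho) => //; move: need => /=; lia.
- move=> /= Hv; rewrite /= in fo cl need.
  have f0 : rg s (rf Bd d) = 0%N by apply: (inv_rf0 H); lia.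
  have v0 : rg s (rv Bd d) = 0%N by apply: (inv_rv0 H); lia.
  have f0' : setr (rf Bd d) 0 s = s by rewrite -{1}f0 setr_id.
  have v0' : setr (rv Bd d) 0 s = s by rewrite -{1}v0 setr_id.
  pose P a := bsem [eta rho with x |-> Some a] eta b.
  pose sg i := setr (rv Bd d) i (setr (rf Bd d) (count P (take i r)) s).
  have -> : s = sg 0%N by rewrite /sg take0 /= f0' v0'.
  apply: (eval_le (t := (t.+3 + (n * (bcost b n + 1 + 3) + 3)).+1)); last by lia.
  apply: EvalSeq; apply: (det_for (n := n) (s' := setr (rf Bd d) (count P r) s)).
  - by move=> i _; rewrite /sg !rg_setr eqxx /= (inv_N H).
  - move=> i /onth_lt[a ia] K' v' t' H'.
    have := inv_push x (count P (take i r)) H (ltac:(lia) : d <= Bd)%N ia.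
    rewrite -/(sg i) => regs_inv'.
    have -> : (t' + (bcost b n + 1) = t'.+1 + bcost b n)%N by lia.
    apply: (IH _ _ _ _ _ _ _ _ _ _ fo cl _ regs_inv'); first by lia.
    move: H'; rewrite {1}/sg setr_setr (take_onth ia) -cats1 count_cat /= addn0 -/(P a).
    case: (P a) => H'.
      have fE : rg (sg i) (rf Bd d) = count P (take i r) by rewrite /sg rg_setr rf_rv rg_setr eqxx.
      apply: EvalInc; rewrite fE.
      have -> // : setr (rf Bd d) (count P (take i r)).+1 (sg i) = setr (rv Bd d) i (setr (rf Bd d) (count P (take i r) + 1) s).
      by rewrite /sg addn1 [LHS]setrC ?rf_rv // setr_setr.
    by apply: EvalSkip; move: H'; rewrite addn0.
  - by rewrite /sg setr_setr take_size [RHS]setrC // v0'.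
  apply: EvalIf; rewrite rg_setr eqxx zeroE.
  have cP : (count P r == 0%N) = ~~ [exists a, P a].
    rewrite -leqn0 leqNgt -has_count; congr (~~ _).
    by apply/hasP/existsP => [[a _ Pa]|[a Pa]]; exists a.
  rewrite cP.
  move: Hv cP; rewrite -/P; case: existsP => _ Hv cP /=.
    by apply: EvalSeq; apply: EvalRst; rewrite setr_setr f0'.
  move/eqP: cP => ->; rewrite f0'; apply: eval_le Hv _; lia.
- by [].
Qed.

Lemma foldr_onth (F : A -> S) v :
  foldr (fun i v => oapp F 1 (onth r i) * v) v (iota 0 n) = (\prod_(a <- r) F a) * v.
Proof.
clear; elim: r => [|a r' IH] /=; first by rewrite big_nil mul1r.
rewrite big_cons -mulrA -IH; congr (_ * _).
by rewrite -[1%N]addn0 iotaDl foldr_map.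
Qed.

Lemma sum_onth (F : A -> S) : \sum_(i < n) oapp F 0 (onth r i) = \sum_a F a.
Proof.
transitivity (\sum_(a <- r) F a); last first.
  by apply/perm_big/uniq_perm => [||a]; rewrite ?index_enum_uniq // r_all mem_index_enum.
clear; elim: r => [|a r' IH] /=; first by rewrite big_nil big_ord0.
by rewrite big_cons -IH big_ord_recl.
Qed.

Lemma eval_wcomp f d env V W s rho eta K v t :
  wfirst_order f -> wclosed V W f -> (d + wneed f <= Bd)%N ->
  regs_inv d env V W s rho eta -> eval w K s v t ->
  eval w (wcomp d env f :: K) s (wsem r rho eta f * v) (t + wcost f n).
Proof.
elim: f d env V s rho K v t => [b|x|f1 IH1 f2 IH2|f1 IH1 f2 IH2|x f IH|x f IH|X f IH|X f IH]
  d env V s rho K v t fo cl need H Hv.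
- rewrite /= [(bcost b n + 1)%N]addnC addnA addn1.
  apply: (eval_bcomp fo cl need H) => /=; case: bsem.
    by rewrite mul1r; apply: EvalSkip.
  by rewrite mul0r; apply: EvalFail.
- by rewrite /= addn1; apply: EvalWt.
- move: fo cl => /andP[fo1 fo2] /andP[cl1 cl2]; rewrite /= in need.
  rewrite /= addn1 addnS mulrDl; apply: EvalAlt.
    apply: (eval_le (t := (t + wcost f1 n)%N)); last by lia.
    by apply: (IH1 _ _ _ _ _ _ _ _ fo1 cl1 _ H Hv); lia.
  apply: (eval_le (t := (t + wcost f2 n)%N)); last by lia.
  by apply: (IH2 _ _ _ _ _ _ _ _ fo2 cl2 _ H Hv); lia.
- move: fo cl => /andP[fo1 fo2] /andP[cl1 cl2]; rewrite /= in need.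
  rewrite /= addn1 addnS [(wcost f1 n + _)%N]addnC addnA -mulrA; apply: EvalSeq.
  apply: (IH1 _ _ _ _ _ _ _ _ fo1 cl1 _ H); first by lia.
  by apply: (IH2 _ _ _ _ _ _ _ _ fo2 cl2 _ H Hv); lia.
- rewrite /= in fo cl need.
  have f0 : rg s (rf Bd d) = 0%N by apply: (inv_rf0 H); lia.
  have v0 : rg s (rv Bd d) = 0%N by apply: (inv_rv0 H); lia.
  have f0' : setr (rf Bd d) 0 s = s by rewrite -{1}f0 setr_id.
  have v0' : setr (rv Bd d) 0 s = s by rewrite -{1}v0 setr_id.
  have -> : (t + wcost (WSum x f) n = (t.+1 + wcost f n).+1 + (n * 4 + 8) + 1)%N by move=> /=; lia.
  rewrite /= addn1 -sum_onth mulr_suml; apply: EvalSeq.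
  apply: (eval_guess (g := fun i => oapp _ 0 (onth r i) * v)) => //.
  + exact: inv_N H.
  move=> i /onth_lt[a ia]; rewrite ia /=; apply: EvalSeq.
  have := inv_push x 0 H (ltac:(lia) : d <= Bd)%N ia; rewrite f0' => H'.
  apply: (IH _ _ _ _ _ _ _ _ fo cl _ H'); first by lia.
  by apply: EvalRst; rewrite setr_setr v0'.
- rewrite /= in fo cl need.
  have f0 : rg s (rf Bd d) = 0%N by apply: (inv_rf0 H); lia.
  have v0 : rg s (rv Bd d) = 0%N by apply: (inv_rv0 H); lia.
  have f0' : setr (rf Bd d) 0 s = s by rewrite -{1}f0 setr_id.
  have v0' : setr (rv Bd d) 0 s = s by rewrite -{1}v0 setr_id.
  rewrite /= -foldr_onth -[s in eval _ _ s]v0'.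
  apply: (eval_for (s := fun i => setr (rv Bd d) i s)).
  + by move=> i _; rewrite rg_setr eqxx; split=> //; rewrite rg_setr /= (inv_N H).
  + move=> i K' v' t' /onth_lt[a ia]; rewrite setr_setr => Hv'; rewrite ia /=.
    have := inv_push x 0 H (ltac:(lia) : d <= Bd)%N ia; rewrite f0' => H'.
    by apply: (IH _ _ _ _ _ _ _ _ fo cl _ H' Hv'); lia.
  + by rewrite setr_setr v0'.
- by [].
- by [].
Qed.

End Correctness.
End CompileFormulas.

Definition polyb (C : nat -> nat) : Prop :=
  exists c k, forall n, (C n <= c * n.+1 ^ k)%N.

Lemma polyb_const c : polyb (fun=> c).
Proof. by exists c, 0%N => n; rewrite expn0 muln1. Qed.

Lemma polyb_id : polyb id.
Proof. by exists 1%N, 1%N => n; rewrite expn1 mul1n. Qed.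

Lemma polyb_add C D : polyb C -> polyb D -> polyb (fun n => C n + D n)%N.
Proof.
move=> [c [k Ck]] [d [l Dl]]; exists (c + d)%N, (k + l)%N => n.
rewrite mulnDl leq_add //.
  by apply: leq_trans (Ck n) _; rewrite leq_mul2l leq_pexp2l ?leq_addr ?orbT.
by apply: leq_trans (Dl n) _; rewrite leq_mul2l leq_pexp2l ?leq_addl ?orbT.
Qed.

Lemma polyb_mul C D : polyb C -> polyb D -> polyb (fun n => C n * D n)%N.
Proof.
move=> [c [k Ck]] [d [l Dl]]; exists (c * d)%N, (k + l)%N => n.
by rewrite expnD mulnACA leq_mul.
Qed.

Lemma polyb_expn C k : polyb C -> polyb (fun n => C n ^ k)%N.
Proof.
move=> HC; elim: k => [|k IH]; first exact: polyb_const.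
have [c [l H]] := polyb_mul HC IH; by exists c, l => n; rewrite expnS.
Qed.

Lemma polyb_pcost k : polyb (pcost k).
Proof.
elim: k => [|k IH] /=; first exact: polyb_const.
apply: polyb_add (polyb_const _); apply: polyb_mul polyb_id _.
exact: polyb_add IH (polyb_const _).
Qed.

Lemma polyb_pscost ks : polyb (pscost ks).
Proof.
elim: ks => [|k ks IH] /=; first exact: polyb_const.
by have := polyb_add (polyb_const 1) (polyb_add IH (polyb_pcost k)).
Qed.

Lemma polyb_lcost l : polyb (lcost l).
Proof.
elim: l => [|l IH]; first exact: polyb_const.
by have := polyb_add (polyb_const 1) (polyb_add IH (polyb_pcost l.+1)).
Qed.

Lemma polyb_bcost tau (b : bformula (with_lt tau)) : polyb (bcost b).
Proof.
elim: b => [|[R|] xs|X xs|x y|b IH|b1 IH1 b2 IH2|x b IH|X b IH] //=; try exact: polyb_const.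
- exact: polyb_add (polyb_add (polyb_pscost _) (polyb_lcost _)) (polyb_const _).
- exact: polyb_add (polyb_mul polyb_id (polyb_const _)) (polyb_const _).
- exact: polyb_add (polyb_lcost _) (polyb_const _).
- exact: polyb_add.
- exact: polyb_add (polyb_mul polyb_id (polyb_add IH (polyb_const _))) (polyb_const _).
Qed.

Lemma polyb_wcost S tau (f : wformula S (with_lt tau)) : polyb (wcost f).
Proof.
elim: f => [b|x|f1 IH1 f2 IH2|f1 IH1 f2 IH2|x f IH|x f IH|X f IH|X f IH] /=; try exact: polyb_const.
- exact: polyb_add (polyb_bcost b) (polyb_const _).
- exact: polyb_add (polyb_add IH1 IH2) (polyb_const _).
- exact: polyb_add (polyb_add IH1 IH2) (polyb_const _).
- exact: polyb_add (polyb_add (polyb_mul polyb_id (polyb_const _)) IH) (polyb_const _).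
- exact: polyb_add (polyb_mul polyb_id (polyb_add IH (polyb_const _))) (polyb_const _).
Qed.

Fixpoint bitseqs (k : nat) : seq (seq bool) :=
  if k is k'.+1 then [seq true :: b | b <- bitseqs k'] ++ [seq false :: b | b <- bitseqs k']
  else [:: [::]].

Lemma mem_bitseqs k b : (b \in bitseqs k) = (size b == k).
Proof.
elim: k b => [|k IH] [|c b] //=; rewrite mem_cat.
  by apply/negbTE/negP => /orP[] /mapP[].
rewrite eqSS -IH; case: c.
  rewrite mem_map; last by move=> ? ? [].
  by case: (b \in _) => //=; apply/negbTE/negP => /mapP[].
rewrite orbC mem_map; last by move=> ? ? [].
by case: (b \in _) => //=; apply/negbTE/negP => /mapP[].
Qed.

Lemma bitseqs_uniq k : uniq (bitseqs k).
Proof.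
elim: k => //= k IH; rewrite cat_uniq !map_inj_uniq ?IH /=; try by move=> ? ? [].
by rewrite andbT; apply/hasPn => _ /mapP[b _ ->]; apply/mapP => -[].
Qed.

Section SetBits.
Variables (A : finType) (r : seq A) (k : nat).
Hypothesis r_uniq : uniq r.
Hypothesis r_all : forall a, a \in r.

Definition set_of_bits (b : seq bool) : {set k.-tuple A} :=
  [set t | nth false b (lexi r (val t))].

Lemma sum_bitseqs (S : nmodType) (F : {set k.-tuple A} -> S) :
  \sum_(b <- bitseqs (size r ^ k)) F (set_of_bits b) = \sum_I F I.
Proof.
rewrite -(big_map set_of_bits xpredT F); apply/perm_big/uniq_perm.
- rewrite map_inj_in_uniq ?bitseqs_uniq // => b b'; rewrite !mem_bitseqs => /eqP sb /eqP sb' E.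
  apply: (@eq_from_nth _ false); rewrite ?sb' // => i ib; rewrite sb in ib.
  have [t ti] : exists t : k.-tuple A, lexi r (val t) = i.
    rewrite -(size_lex_tuples r k) in ib; have [t ti] := onth_lt ib.
    have [tL tE] := onth_uniq (lex_tuples_uniq k r_uniq) ti.
    by exists t; rewrite -index_lex_tuples // -mem_lex_tuples.
  by move/setP/(_ t): E; rewrite !inE ti.
- exact: index_enum_uniq.
- move=> I; rewrite mem_index_enum; apply/mapP; exists [seq t \in I | t <- lex_tuples r k].
    by rewrite mem_bitseqs size_map size_lex_tuples.
  apply/setP => t; rewrite inE.
  have tr : all (mem r) t by apply/allP => a _; rewrite /= r_all.
  have tL : t \in lex_tuples r k by rewrite mem_lex_tuples.
  by rewrite -index_lex_tuples // (nth_map t) ?index_mem // nth_index.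
Qed.

End SetBits.

Section GuessTrack.
Variables (S : pzSemiRingType) (Rg Tk : finType) (w : seq bool).

Definition setts (X : Tk) (b : seq bool) (s : store Rg Tk) : store Rg Tk :=
  Store (rg s) (fun Y j => if (Y == X) && (j < size b)%N then nth false b j else tk s Y j).

Lemma sett_setts X b c s : sett X (size b) c (setts X b s) = setts X (rcons b c) s.
Proof.
apply: store_ext => // Y j /=; rewrite size_rcons nth_rcons.
case: (Y =P X) => //= _; case: (ltngtP j (size b)) => jb; rewrite ?ltnS ?jb //=.
- by rewrite ltnW.
- by rewrite leqNgt jb.
- by rewrite leqnn.
Qed.

Definition GuessTrack (X : Tk) (p u : Rg) : prog S Rg Tk :=
  For p u (Alt (Wr X p true) (Wr X p false)).

Lemma eval_guess_track X p u K s m (F : seq bool -> S) t :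
  p != u -> rg s p = 0%N -> rg s u = m ->
  (forall b, size b = m -> eval w K (setts X b s) (F b) t) ->
  eval w (GuessTrack X p u :: K) s (\sum_(b <- bitseqs m) F b) (t + (m * 5 + 3)).
Proof.
move=> pu p0 um H.
have -> : (t + (m * 5 + 3) = (t + (m * 5 + 2)).+1)%N by lia.
apply: EvalSeq.
have loop k b : (size b + k = m)%N ->
    eval w (Until p (@eqr Rg Tk u) (Seq (Alt (Wr X p true) (Wr X p false)) (Inc p)) :: Rst p :: K)
      (setr p (size b) (setts X b s)) (\sum_(b' <- bitseqs k) F (b ++ b')) (t + (k * 5 + 2)).
  elim: k b => [|k IH] b bk.
    have -> : (t + (0 * 5 + 2) = t.+2)%N by lia.
    rewrite big_seq1 cats0; apply: EvalUntil; rewrite eqrE !rg_setr eqxx /=.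
    rewrite [u == p]eq_sym (negPf pu) um -bk addn0 eqxx; apply: EvalRst.
    rewrite setr_setr; have -> : setr p 0 (setts X b s) = setts X b s.
      by rewrite -p0 -[rg s p]/(rg (setts X b s) p) setr_id.
    by apply: H; lia.
  have -> : (t + (k.+1 * 5 + 2) = (t + (k * 5 + 2)).+1.+4)%N by lia.
  apply: EvalUntil; rewrite eqrE !rg_setr eqxx /= [u == p]eq_sym (negPf pu) um ifN; last by lia.
  rewrite big_cat !big_map; apply: EvalSeq.
  have step c : eval w (Wr X p c :: Inc p :: Until p (@eqr Rg Tk u) (Seq (Alt (Wr X p true) (Wr X p false)) (Inc p)) :: Rst p :: K)
      (setr p (size b) (setts X b s)) (\sum_(b' <- bitseqs k) F (b ++ c :: b')) (t + (k * 5 + 2)).+2.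
    apply: EvalWr; apply: EvalInc; rewrite rg_setr eqxx.
    have -> : sett X (size b) c (setr p (size b) (setts X b s)) = setr p (size b) (setts X (rcons b c) s).
      by rewrite -sett_setts; apply: store_ext.
    rewrite [rg _ _]/= eqxx setr_setr -[(size b).+1](size_rcons b c).
    have := IH (rcons b c); rewrite size_rcons => /(_ (ltac:(lia))).
    by under eq_bigr do rewrite cat_rcons.
  by apply: EvalAlt; apply: eval_le (step _) _.
have := loop m [::] (add0n m); rewrite /=.
have -> : setts X [::] s = s by apply: store_ext => // Y j /=; rewrite andbF.
by have -> : setr p 0 s = s by rewrite -p0 setr_id.
Qed.

End GuessTrack.

Definition code_length (tau : vocabulary) (n : nat) : nat :=
  sumn [seq (n ^ k)%N | k <- [seq arity R | R <- enum (sym tau)]].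

Section Machine.
Variables (S : pzSemiRingType) (tau : vocabulary) (Bd : nat) (Xs : seq sovar).
Variable psi : wformula S (with_lt tau).
Hypothesis arity_le : forall R : sym tau, (arity R <= Bd.+1)%N.
Hypothesis Xs_le : forall X, X \in Xs -> (ar X <= Bd.+1)%N.
Hypothesis psi_need : (wneed psi <= Bd)%N.
Hypothesis psi_fo : wfirst_order psi.
Local Notation prog := (prog S (reg Bd) (track Xs)).
Local Notation store := (store (reg Bd) (track Xs)).
Local Notation rN := (rN Bd).
Local Notation rp := (rp Bd).
Local Notation rL := (rL Bd).
Local Notation rW := (rW Bd).
Local Notation store0 := (store0 (reg Bd) (track Xs)).

Definition gcomp (Ys : seq sovar) : prog :=
  foldr (fun X p => Seq (addpow S Xs rL (ar X))
           (Seq (GuessTrack S (trk Xs X) rp rL) (Seq (Rst rL) p)))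
    (wcomp Bd Xs 0 (fun=> 0%N) psi) Ys.

Definition gcost (Ys : seq sovar) (n : nat) : nat :=
  foldr (fun X c => (c + (pcost (ar X) n + (n ^ ar X * 5 + 7)))%N)
    (wcost psi n) Ys.

Definition arities : seq nat := [seq arity R | R <- enum (sym tau)].

Definition machine_program : prog :=
  Seq (Until rW (fun a : cell (reg Bd) (track Xs) => a.1 == None) (Inc rW))
  (Seq (Inc rW)
  (Seq (Guess S (track Xs) rN rW (rf Bd 0))
  (Seq (addpows S Xs rp arities)
  (Seq (Inc rp)
  (If rp (@eqr (reg Bd) (track Xs) rW) (Seq (Rst rp) (gcomp Xs)) Fail))))).

Definition loaded (w : seq bool) (i : nat) : store :=
  setr rN i (setr rW (size w).+1 store0).

Lemma eval_machine_program (w : seq bool) (v : nat -> S) T :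
  (forall i, (i <= size w)%N -> (pscost arities i <= T)%N) ->
  (forall i, (i <= size w)%N -> code_length tau i = size w ->
     eval w [:: gcomp Xs] (loaded w i) (v i) T) ->
  eval w [:: machine_program] store0
    (\sum_(i < (size w).+1) if code_length tau i == size w then v i else 0)
    (T + T + size w * 7 + 30).
Proof.
move=> HT Hv; set m := size w in HT Hv *.
apply: (eval_le (t := (T + T + m * 7 + 29).+1)); last by lia.
apply: EvalSeq.
have loop k i K x t : (i + k = m)%N -> eval w K (setr rW m store0) x t ->
    eval w (Until rW (fun a : cell (reg Bd) (track Xs) => a.1 == None) (Inc rW) :: K)
      (setr rW i store0) x (t + (k * 2 + 1)).
  elim: k i => [|k IH] i ikm Ht.
    have -> : (t + (0 * 2 + 1) = t.+1)%N by lia.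
    rewrite addn0 in ikm; rewrite ikm; apply: EvalUntil.
    by rewrite rg_setr eqxx /= onth_default.
  have -> : (t + (k.+1 * 2 + 1) = (t + (k * 2 + 1)).+2)%N by lia.
  apply: EvalUntil; rewrite rg_setr eqxx [content _ _ _]/content /=.
  have /onth_lt[b ->] : (i < size w)%N by lia.
  by apply: EvalInc; rewrite rg_setr eqxx setr_setr; apply: IH => //; lia.
have s0 : store0 = setr rW 0 store0 by rewrite -[0%N]/(rg store0 rW) setr_id.
rewrite {1}s0; apply: (eval_le (t := (T + T + m * 5 + 28 + (m * 2 + 1)))%N); last by lia.
apply: loop => //.
apply: (eval_le (t := (T + T + m * 4 + 23).+4)); last by lia.
apply: EvalSeq; apply: EvalInc; rewrite rg_setr eqxx setr_setr; apply: EvalSeq.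
apply: (eval_le (t := (T + T + 10 + (m.+1 * 4 + 8))%N)); last by lia.
apply: (eval_guess (g := fun i => if code_length tau i == m then v i else 0)) => // i im.
rewrite -/(loaded w i); set s := loaded w i.
have yE j : rg s (ry Bd j) = 0%N by [].
have NE : rg s rN = i by [].
apply: (eval_le (t := (T + 9 + pscost arities (rg s rN)).+1)); last first.
  by have := HT i (ltac:(lia)); rewrite NE; lia.
apply: EvalSeq; apply: det_addpows => //.
  by apply/allP => _ /mapP[R _ ->].
rewrite NE -/(code_length tau i) [rg s rp]/= add0n.
apply: (eval_le (t := T.+2.+4)); last by lia.
apply: EvalSeq; apply: EvalInc; rewrite rg_setr eqxx setr_setr; apply: EvalIf.
rewrite eqrE !rg_setr eqxx.
have -> : (if rW == rp then (code_length tau i).+1 else rg s rW) = m.+1 by [].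
rewrite eqSS eq_sym; case: eqP => cl; last exact: EvalFail.
apply: EvalSeq; apply: EvalRst; rewrite setr_setr.
have -> : setr rp 0 s = s by rewrite -[0%N]/(rg s rp) setr_id.
by apply: eval_le (Hv i _ cl) _; lia.
Qed.

Lemma trk_inj X Y : X \in Xs -> Y \in Xs -> trk Xs X = trk Xs Y -> X = Y.
Proof.
move=> XX YX /(congr1 val); rewrite /= !inordK ?ltnS ?index_size // => E.
by rewrite -(nth_index X XX) E nth_index.
Qed.

Section Value.
Variables (A : structure (with_lt tau)) (r : seq A) (w : seq bool).
Hypothesis r_uniq : uniq r.
Hypothesis r_all : forall a, a \in r.
Hypothesis r_lt : forall a b : A, ltA A a b = (index a r < index b r)%N.
Hypothesis w_reads : forall R (t : (arity R).-tuple A),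
  (t \in @interp _ A (Some R)) =
  (onth w (sumn [seq (size r ^ k)%N | k <- before R] + lexi r t)%N == Some true).

Lemma eval_gcomp Ys W s eta : {subset Ys <= Xs} -> {subset W <= Xs} ->
  regs_inv r 0 (fun=> 0%N) [::] W s (fun=> None) eta -> rg s rL = 0%N ->
  wclosed [::] W (foldr (@WSumSO S _) psi Ys) ->
  eval w [:: gcomp Ys] s (wsem r (fun=> None) eta (foldr (@WSumSO S _) psi Ys))
    (gcost Ys (size r) + 1).
Proof.
elim: Ys W s eta => [|X Ys IH] W s eta YX WX H L0 cl.
  rewrite addnC -[wsem _ _ _ _]mulr1.
  by apply: (eval_wcomp arity_le r_uniq r_all r_lt w_reads psi_fo cl _ H) => //; apply: EvalNil.
have XX : X \in Xs by apply: YX; rewrite inE eqxx.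
set n := size r; rewrite [gcost _ _]/= [wsem _ _ _ _]/=.
set c := gcost Ys n; have NE : rg s rN = n := inv_N H.
have -> : (c + (pcost (ar X) n + (n ^ ar X * 5 + 7)) + 1 =
  (((c + 1).+2 + (n ^ ar X * 5 + 3)).+1 + pcost (ar X) n).+1)%N by lia.
apply: EvalSeq; rewrite -[in pcost _ _]NE; apply: det_addpow => //.
- exact: Xs_le.
- by move=> j _; exact: inv_ry0 H j.
rewrite NE L0 add0n; apply: EvalSeq.
rewrite -(sum_bitseqs (r := r)) //.
apply: (eval_guess_track (F := fun b => wsem _ _ _ _)) => //.
- exact: inv_rp0 H.
move=> b sb; apply: eval_le; first apply: EvalSeq; first apply: EvalRst.
  have -> : setr rL 0 (setts (trk Xs X) b (setr rL (n ^ ar X) s)) = setts (trk Xs X) b s.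
    by apply: store_ext => // u; rewrite /setr /=; case: (u =P rL) => [->|].
  apply: (IH (X :: W)) => //.
  - by move=> Y YY; apply: YX; rewrite inE YY orbT.
  - by move=> Y; rewrite inE => /orP[/eqP->|/WX].
  - case: H => iN iV iv if_ iy ip it; split=> // Y t YW.
    have YX' : Y \in Xs by move: YW; rewrite inE => /orP[/eqP->|/WX].
    rewrite [tk _ _ _]/=; case: (Y =P X) => [E|YX1].
      move: t {YW}; rewrite E => t; rewrite dfwith_in eqxx /= inE sb ifT //.
      by rewrite -[X in (_ < X ^ _)%N]/(size r) -{2}(size_tuple t); apply: lexi_lt; apply/allP => a _; rewrite /= r_all.
    rewrite dfwith_out; last by apply/eqP => /esym.
    rewrite ifF; first by apply: it; move: YW; rewrite inE => /orP[/eqP|].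
    by apply/negbTE; rewrite negb_and; apply/orP; left; apply/eqP => /(trk_inj YX' XX).
exact: leqnn.
Qed.

End Value.
End Machine.

Section OrderEnum.
Variables (A : finType) (lt : rel A).
Hypothesis lt_linear : linear_order lt.

Lemma order_enum_uniq : uniq (order_enum lt).
Proof. by rewrite sort_uniq enum_uniq. Qed.

Lemma mem_order_enum a : a \in order_enum lt.
Proof. by rewrite mem_sort mem_enum. Qed.

Lemma size_order_enum : size (order_enum lt) = #|A|.
Proof. by rewrite size_sort -cardE. Qed.

Lemma order_enum_lt a b :
  lt a b = (index a (order_enum lt) < index b (order_enum lt))%N.
Proof.
have [irr tr tot] := lt_linear.
have le_tr : transitive (fun x y => (x == y) || lt x y).
  move=> y x z /orP[/eqP->//|xy] /orP[/eqP<-|yz]; first by rewrite xy orbT.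
  by rewrite (tr _ _ _ xy yz) orbT.
have le_tot : total (fun x y => (x == y) || lt x y).
  move=> x y; have [->|xy] := eqVneq x y; first by [].
  by have /orP[->|->] := tot _ _ xy; rewrite /= ?orbT.
have srt := sort_sorted le_tot (enum A).
have idx x y : (index x (order_enum lt) < index y (order_enum lt))%N -> lt x y.
  move=> xy; have /orP[/eqP E|//] := sorted_ltn_index le_tr srt _ _ (mem_order_enum x) (mem_order_enum y) xy.
  by rewrite E ltnn in xy.
apply/idP/idP => [ab|/idx//]; rewrite ltnNge leq_eqVlt; apply/negP => /orP[/eqP E|/idx ba].
  have ba : b = a by rewrite -(nth_index a (mem_order_enum b)) E nth_index // mem_order_enum.
  by rewrite ba irr in ab.
by have := tr _ _ _ ab ba; rewrite irr.
Qed.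

End OrderEnum.

Lemma onth_flatten (T : eqType) (U : Type) (g : T -> seq U) (L : seq T) x j :
  x \in L -> (j < size (g x))%N ->
  onth (flatten [seq g y | y <- L])
    (sumn [seq size (g y) | y <- take (index x L) L] + j) = onth (g x) j.
Proof.
move=> + jx; elim: L => //= y L IH; rewrite in_cons [y == x]eq_sym.
have [<-|xy /= xL] := eqVneq x y; first by rewrite /= add0n onth_cat jx.
by rewrite onth_cat -addnA ltnNge leq_addr /= addKn IH.
Qed.

Section Encoding.
Variables (tau : vocabulary).

Lemma code_lengthE n : code_length tau n = (\sum_(R : sym tau) n ^ arity R)%N.
Proof.
rewrite /code_length sumnE !big_map; apply/perm_big/uniq_perm => [||R].
- by rewrite -enumT enum_uniq.
- exact: index_enum_uniq.
- by rewrite -enumT mem_enum mem_index_enum.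
Qed.

Section Enc.
Variables (A : structure tau) (lt : rel A).
Hypothesis lt_linear : linear_order lt.

Lemma size_enc : size (enc lt) = code_length tau #|A|.
Proof.
rewrite /enc size_flatten /shape -map_comp /code_length -map_comp; congr sumn.
by apply: eq_map => R /=; rewrite size_map size_lex_tuples size_order_enum.
Qed.

Lemma enc_reads R (t : (arity R).-tuple A) :
  (t \in interp A R) =
  (onth (enc lt) (sumn [seq (size (order_enum lt) ^ k)%N | k <- before R] +
     lexi (order_enum lt) t)%N == Some true).
Proof.
set r := order_enum lt.
have tr : all (mem r) t by apply/allP => a _; exact: mem_order_enum.
have tL : t \in lex_tuples r (arity R) by rewrite mem_lex_tuples.
pose g R := [seq t \in interp A R | t <- lex_tuples r (arity R)].
have -> : sumn [seq (size r ^ k)%N | k <- before R] =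
    sumn [seq size (g R') | R' <- take (index R (enum (sym tau))) (enum (sym tau))].
  rewrite /before -map_comp; congr sumn; apply: eq_map => R' /=.
  by rewrite size_map size_lex_tuples.
rewrite (@onth_flatten _ _ g) ?mem_enum //.
  by rewrite onth_map -index_lex_tuples // onth_index //= ; case: (t \in _).
by rewrite size_map -index_lex_tuples // index_mem.
Qed.

End Enc.

Hypothesis htau : exists R : sym tau, (0 < arity R)%N.

Lemma code_length_gt i j : (i < j)%N -> (code_length tau i < code_length tau j)%N.
Proof.
move=> ij; have [R R0] := htau; rewrite !code_lengthE (bigD1 R) //= [X in (_ < X)%N](bigD1 R) //=.
rewrite -addSn leq_add // ?ltn_exp2r // leq_sum // => R' _.
by rewrite leq_wexp2r // ltnW.
Qed.

Lemma code_length_inj : injective (code_length tau).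
Proof.
move=> i j E; apply/eqP; case: ltngtP => // /code_length_gt; rewrite E ltnn //.
Qed.

Lemma leq_code_length i : (i <= code_length tau i)%N.
Proof.
have [R R0] := htau; rewrite code_lengthE (bigD1 R) //=.
apply: leq_trans (leq_addr _ _); case: i => // i.
by rewrite -{1}[i.+1]expn1 leq_pexp2l.
Qed.

End Encoding.

Lemma eval_inj (S : pzSemiRingType) (Rg Tk : finType) (p : prog S Rg Tk) w x y t t' :
  eval w [:: p] (store0 Rg Tk) x t -> eval w [:: p] (store0 Rg Tk) y t' -> x = y.
Proof.
have pc : ([:: p] : {classic (seq (prog S Rg Tk))}) \in conts p.
  by rewrite inE reach_self orbT.
have H v t1 : eval w [:: p] (store0 Rg Tk) v t1 -> is_behavior (tm p) w v.
  by move=> /(eval_run)-/(_ p pc 0%N false (fun=> isT))/run_init/run_value_behavior.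
by move=> /H Hx /H; apply: is_behavior_inj.
Qed.

Theorem wESO_NP (S : pzSemiRingType) (tau : vocabulary)
    (htau : exists R : sym tau, (0 < arity R)%N) (phi : wformula S (with_lt tau)) :
  wESO phi -> sentence phi ->
  exists P : seq bool -> S, NP P /\
    forall A : structure (with_lt tau), linear_order (ltA A) ->
      P (@enc tau (reduct A) (ltA A)) = value_along (order_enum (ltA A)) phi.
Proof.
move=> [Xs [psi [psi_fo phiE]]] cl.
pose Bd := ((\max_(R : sym tau) arity R) + (\max_(X <- Xs) ar X) + wneed psi)%N.
have arity_le (R : sym tau) : (arity R <= Bd.+1)%N.
  by apply: leqW; rewrite /Bd -addnA (leq_trans _ (leq_addr _ _)) // (leq_bigmax R).
have Xs_le X : X \in Xs -> (ar X <= Bd.+1)%N.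
  move=> XX; apply: leqW; rewrite /Bd addnAC (leq_trans _ (leq_addl _ _)) //.
  exact: (@leq_bigmax_seq _ _ _ _ X).
have psi_need : (wneed psi <= Bd)%N by rewrite leq_addl.
pose p := machine_program Bd Xs psi.
have polyG : polyb (fun n => pscost (arities tau) n + (gcost psi Xs n + 1))%N.
  apply: polyb_add (polyb_pscost _) _; apply: polyb_add (polyb_const _).
  elim: (Xs) => [|X Ys IH]; first exact: polyb_wcost.
  apply: polyb_add IH _; apply: polyb_add (polyb_pcost _) _.
  exact: polyb_add (polyb_mul (polyb_expn _ polyb_id) (polyb_const _)) (polyb_const _).
have [c [k ck]] := polyG; pose T m := (c * m.+1 ^ k)%N.
have TE i m : (i <= m)%N -> (pscost (arities tau) i + (gcost psi Xs i + 1) <= T m)%N.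
  by move=> im; apply: leq_trans (ck i) _; rewrite leq_mul2l leq_wexp2r ?orbT.
have loadedP (A : structure (with_lt tau)) (r : seq A) w :
    uniq r -> (forall a, a \in r) ->
    (forall a b : A, ltA A a b = (index a r < index b r)%N) ->
    (forall R (t : (arity R).-tuple A), (t \in @interp _ A (Some R)) =
      (onth w (sumn [seq (size r ^ k)%N | k <- before R] + lexi r t)%N == Some true)) ->
    (size r <= size w)%N ->
    eval w [:: gcomp Bd Xs psi Xs] (loaded Bd Xs w (size r)) (value_along r phi) (T (size w)).
  move=> ur ra rlt rw rsz; have := TE _ _ rsz => Tle.
  rewrite phiE; apply: eval_le; first apply: (@eval_gcomp S tau Bd Xs psi _ _ _ _ A r w ur ra rlt rw Xs [::]) => //.
    by rewrite -phiE.
  exact: leq_trans (leq_addl _ _) Tle.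
have polyT : polyb (fun m => T m + T m + m * 7 + 30)%N.
  have PT : polyb T by exists c, k.
  exact: polyb_add (polyb_add (polyb_add PT PT) (polyb_mul polyb_id (polyb_const _))) (polyb_const _).
have [c' [k' ck']] := polyT.
have /choice[P HP] : forall w, exists v, eval w [:: p] (store0 _ _) v (c' * (size w).+1 ^ k')%N.
  move=> w; have /choice[v Hv] : forall i, exists v, (i <= size w)%N -> code_length tau i = size w ->
      eval w [:: gcomp Bd Xs psi Xs] (loaded Bd Xs w i) v (T (size w)).
    move=> i; pose A := @Structure (with_lt tau) 'I_i (fun R =>
      match R return {set (arity (R : sym (with_lt tau))).-tuple 'I_i} with
      | Some R => [set t : (arity R).-tuple 'I_i | onth w (sumn [seq (i ^ k)%N | k <- before R] +
                      lexi (enum 'I_i) t)%N == Some true]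
      | None => [set t : 2.-tuple 'I_i | (tnth t ord0 < tnth t ord_max)%N]
      end).
    exists (@value_along S _ A (enum 'I_i) phi) => iw _.
    have := loadedP A (enum 'I_i) w; rewrite size_enum_ord; apply=> //.
    - exact: enum_uniq.
    - by move=> a; rewrite mem_enum.
    - by move=> a b; rewrite /ltA inE /= !index_enum_ord.
    - by move=> R t; rewrite inE.
  exists (\sum_(i < (size w).+1) if code_length tau i == size w then v i else 0).
  apply: eval_le (ck' (size w)); apply: eval_machine_program => //.
  by move=> i /TE; apply: leq_trans; rewrite leq_addr.
exists P; split; first exact: NP_of_eval HP.
move=> A lin; set w := enc _; set r := order_enum _.
have rsz : size r = #|A| by rewrite size_order_enum.
have wsz : size w = code_length tau #|A| by rewrite (@size_enc _ (reduct A)).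
have rw : (size r <= size w)%N by rewrite rsz wsz leq_code_length.
apply: eval_inj (HP w) _.
pose v i := if i == size r then value_along r phi else 0.
have -> : value_along r phi = \sum_(i < (size w).+1) if code_length tau i == size w then v i else 0.
  rewrite (bigD1 (Ordinal (rw : (size r < (size w).+1)%N))) //=.
  have -> : (code_length tau (size r) == size w) = true by rewrite rsz wsz eqxx.
  rewrite /v eqxx.
  rewrite big1 ?addr0 // => i /eqP ine; case: eqP => // il; case: eqP => // iE.
  by case: ine; apply: val_inj.
apply: eval_machine_program => //.
  by move=> i /TE; apply: leq_trans; rewrite leq_addr.
move=> i iw il; have -> : i = size r by apply: (code_length_inj htau); rewrite il rsz.
rewrite /v eqxx; apply: loadedP => //.
- exact: order_enum_uniq.
- by move=> a; exact: mem_order_enum.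
- by move=> a b; apply: order_enum_lt.
- by move=> R t; apply: (@enc_reads _ (reduct A)).
Qed.

(** * Accepting computations as sets of events *)

Section TransitionParts.
Variables (Q G : Type).
Implicit Type e : transition Q G.
Definition tread e : G := let: (_, a, _, _, _) := e in a.
Definition dst e : Q := let: (_, _, q, _, _) := e in q.
Definition twrite e : G := let: (_, _, _, b, _) := e in b.
Definition tmove e : 'I_3 := let: (_, _, _, _, m) := e in m.
End TransitionParts.

Section Histories.
Variables (S : pzSemiRingType) (Sigma : finType) (M : wtm S Sigma).
Local Notation tr := (transition (state M) (work M)).
Implicit Types (es : seq tr) (w : seq Sigma).

Definition hpos es : int := \sum_(e <- es) ((tmove e : nat)%:Z - 1).

Definition state_after es : state M := last (start M) (map (@dst _ _) es).

(* After the run [es] the last symbol written at cell [p], or else the initial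
   symbol of this cell, is [a]. *)
Definition holds_symbol w es (p : int) (a : work M) : Prop :=
  (exists j e, [/\ onth es j = Some e, hpos (take j es) = p, twrite e = a &
     forall k, (j < k < size es)%N -> hpos (take k es) != p]) \/
  ((forall k, (k < size es)%N -> hpos (take k es) != p) /\ ctape (init M w) p = a).

Lemma hpos_rcons es e : hpos (rcons es e) = hpos es + (tmove e : nat)%:Z - 1.
Proof. by rewrite /hpos -cats1 big_cat big_seq1 /= addrA. Qed.

Lemma run_rcons es e C : run (rcons es e) C = obind (fire (M := M) e) (run es C).
Proof.
elim: es C => [|e' es IH] C /=; first by case: fire.
by case: (fire e' C) => [C'|] //=; rewrite IH.
Qed.

Lemma take_rcons_lt (T : Type) (s : seq T) x k : (k <= size s)%N -> take k (rcons s x) = take k s.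
Proof.
by rewrite -cats1 take_cat leq_eqVlt => /orP[/eqP->|->//]; rewrite ltnn subnn take0 cats0 take_size.
Qed.

Lemma onth_rcons (T : Type) (s : seq T) x k :
  onth (rcons s x) k = if (k < size s)%N then onth s k else if k == size s then Some x else None.
Proof.
rewrite -cats1 onth_cat; case: ltngtP => // ks.
  have -> : (k - size s = (k - size s).-1.+1)%N by lia.
  by rewrite /= onth0n.
by rewrite ks subnn.
Qed.

Lemma holds_symbol_rcons w es e p a :
  holds_symbol w (rcons es e) p a <->
  if hpos es == p then twrite e = a else holds_symbol w es p a.
Proof.
split.
- case=> [[j [e' [je jp ja jk]]]|[np ip]].
    rewrite onth_rcons in je; case: ltngtP je => js //.
      move=> je; have := jk (size es); rewrite size_rcons js ltnSn take_rcons_lt // take_size.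
      move=> /(_ isT)/negPf->; left; exists j, e'; split=> //.
        by rewrite -jp take_rcons_lt // ltnW.
      move=> k /andP[jk' ks]; rewrite -(take_rcons_lt e) 1?ltnW //; apply: jk.
      by rewrite jk' size_rcons ltnW.
    by case=> e'E; rewrite -jp js take_rcons_lt // take_size eqxx e'E.
  have := np (size es); rewrite size_rcons ltnSn take_rcons_lt // take_size => /(_ isT)/negPf->.
  right; split=> // k ks; rewrite -(take_rcons_lt e) 1?ltnW //; apply: np.
  by rewrite size_rcons ltnW.
- case: eqP => [pE wE|/eqP pE [[j [e' [je jp ja jk]]]|[np ip]]].
  + left; exists (size es), e; split=> //.
    * by rewrite onth_rcons ltnn eqxx.
    * by rewrite take_rcons_lt // take_size.
    * by move=> k; rewrite size_rcons; lia.
  + have js : (j < size es)%N by rewrite -onthTE je.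
    left; exists j, e'; split=> //.
    * by rewrite onth_rcons js.
    * by rewrite take_rcons_lt // ltnW.
    * move=> k; rewrite size_rcons ltnS => /andP[jk']; rewrite leq_eqVlt => /orP[/eqP->|ks].
        by rewrite take_rcons_lt // take_size.
      by rewrite take_rcons_lt 1?ltnW //; apply: jk; rewrite jk'.
  + right; split=> // k; rewrite size_rcons ltnS leq_eqVlt => /orP[/eqP->|ks].
      by rewrite take_rcons_lt // take_size.
    by rewrite take_rcons_lt 1?ltnW //; apply: np.
Qed.

Lemma run_after w es C : run es (init M w) = Some C ->
  [/\ cstate C = state_after es, chead C = hpos es &
      forall p a, holds_symbol w es p a <-> ctape C p = a].
Proof.
elim/last_ind: es C => [|es e IH] C.
  case=> <-; rewrite /state_after /hpos big_nil; split=> // p a; split.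
    by case=> [[j [e []]]|[]//]; rewrite onth0n.
  by right.
rewrite run_rcons; case rE: (run es _) => [C'|] //=.
have [sE hE tE] := IH _ rE; case: e => [[[[p a] q] b] m] /=.
case: ifP => // _ [<-]; split=> /=.
- by rewrite /state_after map_rcons last_rcons.
- by rewrite hpos_rcons hE.
- move=> p' a'; rewrite holds_symbol_rcons -hE [p' == _]eq_sym.
  by case: eqP => [|_].
Qed.

Definition valid_step w es i (e : tr) : Prop :=
  [/\ e \in delta M, src e = state_after (take i es) &
      holds_symbol w (take i es) (hpos (take i es)) (tread e)].

Lemma run_validP w es :
  isSome (run es (init M w)) <-> (forall i e, onth es i = Some e -> valid_step w es i e).
Proof.
elim/last_ind: es => [|es e IH]; first by split=> // _ i e; rewrite onth0n.
have validE i e' : (i <= size es)%N -> valid_step w (rcons es e) i e' <-> valid_step w es i e'.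
  by move=> ies; rewrite /valid_step take_rcons_lt.
have fireE C : run es (init M w) = Some C ->
    isSome (fire e C) <-> valid_step w es (size es) e.
  move=> rE; have [sE hE tE] := run_after rE.
  rewrite /valid_step take_size /fire; case: e {IH validE} => [[[[p a] q] b] m] /=.
  rewrite sE hE; split.
    by case: ifP => // /and3P[eD /eqP-> /eqP ta] _; split=> //; apply/tE.
  by case=> eD pE /tE aE; rewrite eD -pE eqxx aE eqxx.
rewrite run_rcons; split.
  case rE: (run es _) => [C|] //= fC i e'; rewrite onth_rcons; case: ltngtP => // ies.
    by move=> ie; apply/validE; [exact: ltnW|apply: (proj1 IH) => //; rewrite rE].
  by case=> <-; rewrite ies; apply/validE => //; apply/(fireE C rE).
move=> H; have : isSome (run es (init M w)).
  apply/IH => i e' ie; have ies : (i < size es)%N by rewrite -onthTE ie.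
  by apply/validE; [exact: ltnW|apply: H; rewrite onth_rcons ies].
case rE: (run es _) => [C|] //= _; apply/(fireE C rE)/validE => //.
by apply: H; rewrite onth_rcons ltnn eqxx.
Qed.

Lemma acceptingP w es :
  accepting (M := M) w es <->
  (forall i e, onth es i = Some e -> valid_step w es i e) /\ state_after es \in final M.
Proof.
rewrite /accepting; split.
  case rE: (run es _) => [C|] // Cf; have [<- _ _] := run_after rE; split=> //.
  by apply/run_validP; rewrite rE.
case=> /run_validP; case rE: (run es _) => [C|] // _; by have [-> _ _] := run_after rE.
Qed.

Lemma hpos_bound es : (- (size es)%:Z <= hpos es <= (size es)%:Z).
Proof.
elim/last_ind: es => [|es e IH]; first by rewrite /hpos big_nil.
rewrite hpos_rcons size_rcons; have := ltn_ord (tmove e); move: IH; lia.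
Qed.

End Histories.

Section Chi.
Variables (S : pzSemiRingType) (Sigma : finType) (M : wtm S Sigma).
Local Notation tr := (transition (state M) (work M)).
Local Notation hpos := (@hpos S Sigma M).

(* [chi] states that [G] is the set of events of an accepting computation, the
   elements of [U] coding triples (time, cell, transition).  It only compares
   times and cells, so that it is first-order over an ordered structure. *)
Section Formula.
Variables (U : finType) (time cpos : U -> nat) (has_event : tr -> U -> bool).
Variables (is_cell origin : U -> bool) (init_symbol : work M -> U -> bool).
Variable (G : {set U}).
Implicit Types (u v x : U).

Definition on_event (P : pred tr) u : bool := [exists e, has_event e u && P e].
Definition same_time u v : bool := ~~ (time u < time v)%N && ~~ (time v < time u)%N.
Definition same_cell u v : bool := ~~ (cpos u < cpos v)%N && ~~ (cpos v < cpos u)%N.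
Definition next_cell u v : bool :=
  [&& is_cell u, is_cell v, (cpos u < cpos v)%N &
      [forall x, is_cell x ==> ~~ ((cpos u < cpos x)%N && (cpos x < cpos v)%N)]].
Definition next_time u v : bool :=
  (time u < time v)%N && [forall x, ~~ ((time u < time x)%N && (time x < time v)%N)].

Definition chi_event : bool :=
  [forall u, (u \in G) ==> on_event (mem (delta M)) u && is_cell u].
Definition chi_unique : bool :=
  [forall u, forall v, (u \in G) && (v \in G) && same_time u v ==> (u == v)].
Definition chi_initial : bool :=
  [forall u, forall v, (u \in G) && (time v < time u)%N ==>
     [exists x, (x \in G) && same_time x v]].
Definition chi_start : bool :=
  [forall u, (u \in G) && [forall v, ~~ (time v < time u)%N] ==>
     origin u && on_event (fun e => src e == start M) u].
Definition chi_step : bool :=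
  [forall u, forall v, (u \in G) && (v \in G) && next_time u v ==>
     on_event (fun e => on_event (fun e' => dst e == src e') v) u &&
     (on_event (fun e => tmove e == 0%N :> nat) u && next_cell v u ||
      on_event (fun e => tmove e == 1%N :> nat) u && same_cell u v ||
      on_event (fun e => tmove e == 2%N :> nat) u && next_cell u v)].
Definition chi_read : bool :=
  [forall u, (u \in G) ==>
     [exists v, (v \in G) && (time v < time u)%N && same_cell v u &&
        on_event (fun e => on_event (fun e' => twrite e == tread e') u) v &&
        [forall x, (x \in G) && (time v < time x)%N && (time x < time u)%N ==>
           ~~ same_cell x u]] ||
     [forall x, (x \in G) && (time x < time u)%N ==> ~~ same_cell x u] &&
     on_event (fun e => init_symbol (tread e) u) u].
Definition chi_final : bool :=
  [forall u, (u \in G) && [forall v, (v \in G) ==> ~~ (time u < time v)%N] ==>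
     on_event (fun e => dst e \in final M) u].
Definition chi_empty : bool := [exists u, u \in G] || (start M \in final M).

Definition chi : bool :=
  [&& chi_event, chi_unique, chi_initial, chi_start, chi_step, chi_read,
      chi_final & chi_empty].

End Formula.

Section Correctness.
Variables (w : seq Sigma) (U : finType) (time cpos : U -> nat) (ev : U -> option tr).
Variables (is_cell origin : U -> bool) (init_symbol : work M -> U -> bool).
Variables (N1 o : nat) (L : seq nat).
Hypothesis time_lt : forall u, (time u < N1)%N.
Hypothesis block_inj : forall u v e, time u = time v -> cpos u = cpos v ->
  ev u = Some e -> ev v = Some e -> u = v.
Hypothesis block_surj : forall i c e, (i < N1)%N -> c \in L ->
  exists u, [/\ time u = i, cpos u = c & ev u = Some e].
Hypothesis L_sorted : sorted ltn L.
Hypothesis o_ge : (N1 <= o)%N.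
Hypothesis L_size : (o + N1 < size L)%N.
Hypothesis is_cellE : forall u, is_cell u = (cpos u \in L).
Hypothesis originE : forall u, origin u = (cpos u == nth 0%N L o).

(* [L] lists the numbers of the cells in use; its item [o] is the initial
   position of the head. *)
Definition cellat (p : int) : nat := nth 0%N L (absz (o%:Z + p)%R).

Hypothesis init_symbolE : forall u a (p : int), (`|p| < N1)%N -> cpos u = cellat p ->
  init_symbol a u = (ctape (init M w) p == a).

Local Notation has_event := (fun e u => ev u == Some e).
Local Notation chi G := (chi time cpos has_event is_cell origin init_symbol G).
Local Notation on_event := (on_event has_event).
Local Notation same_time := (same_time time).
Local Notation same_cell := (same_cell cpos).
Local Notation next_cell := (next_cell cpos is_cell).
Local Notation next_time := (next_time time).

Definition graph (es : seq tr) : {set U} :=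
  [set u | [&& ev u != None, onth es (time u) == ev u &
               cpos u == cellat (hpos (take (time u) es))]].

Lemma on_eventE P u e : ev u = Some e -> on_event P u = P e.
Proof.
move=> ue; apply/existsP/idP => [[e' /andP[/eqP]]|Pe].
  by rewrite ue => -[->].
by exists e; rewrite ue eqxx.
Qed.

Lemma same_timeE u v : same_time u v = (time u == time v).
Proof. by rewrite /same_time -!leqNgt andbC -eqn_leq. Qed.

Lemma same_cellE u v : same_cell u v = (cpos u == cpos v).
Proof. by rewrite /same_cell -!leqNgt andbC -eqn_leq. Qed.

Let e0 : tr := (start M, blank M, start M, blank M, ord0).

Lemma nth_L_lt i j : (i < size L)%N -> (j < size L)%N ->
  (nth 0 L i < nth 0 L j)%N = (i < j)%N.
Proof.
have L_lt a b : (a < b)%N -> (b < size L)%N -> (nth 0 L a < nth 0 L b)%N.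
  move=> ab bL; apply: (sorted_ltn_nth ltn_trans) => //; rewrite inE //.
  exact: ltn_trans bL.
move=> iL jL; case: (ltngtP i j) => [ij|ji|->]; last by rewrite ltnn.
  by rewrite L_lt.
by apply/negbTE; rewrite -leqNgt ltnW // L_lt.
Qed.

Lemma nth_L_inj i j : (i < size L)%N -> (j < size L)%N ->
  nth 0%N L i = nth 0%N L j -> i = j.
Proof.
move=> iL jL E; apply/eqP; case: ltngtP => // ij; last first.
  by have := nth_L_lt jL iL; rewrite E ltnn ij.
by have := nth_L_lt iL jL; rewrite E ltnn ij.
Qed.

Lemma N1_gt0 (u : U) : (0 < N1)%N.
Proof. by have := time_lt u; case: N1. Qed.

Lemma next_cellP u v :
  reflect (exists i, [/\ (i.+1 < size L)%N, cpos u = nth 0%N L i & cpos v = nth 0%N L i.+1])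
    (next_cell u v).
Proof.
rewrite /next_cell !is_cellE; apply: (iffP and4P) => [[uL vL uv /forallP nx]|[i [iL ui vi]]].
  have [i iL ui] : exists2 i, (i < size L)%N & cpos u = nth 0%N L i.
    by exists (index (cpos u) L); rewrite ?index_mem ?nth_index.
  have [j jL vj] : exists2 j, (j < size L)%N & cpos v = nth 0%N L j.
    by exists (index (cpos v) L); rewrite ?index_mem ?nth_index.
  rewrite ui vj nth_L_lt // in uv nx; have iL' : (i.+1 < size L)%N by exact: leq_ltn_trans jL.
  exists i; split=> //; rewrite vj; congr nth; apply/eqP; rewrite eqn_leq uv andbT.
  have [x [_ xE _]] := block_surj e0 (N1_gt0 u) (mem_nth 0%N iL').
  have := nx x; rewrite is_cellE xE mem_nth //= !nth_L_lt // ltnSn /=.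
  by rewrite -leqNgt.
have iL' : (i < size L)%N by exact: ltnW.
rewrite ui vi !mem_nth // nth_L_lt //; split=> //.
apply/forallP => x; apply/implyP; rewrite is_cellE => xL.
by rewrite -(nth_index 0%N xL) !nth_L_lt ?index_mem //; lia.
Qed.

Lemma cell_index (p : int) : (`|p| <= N1)%N -> ((absz (o%:Z + p)%R) < size L)%N.
Proof. by lia. Qed.

Lemma cellat_mem (p : int) : (`|p| <= N1)%N -> cellat p \in L.
Proof. by move=> pN; rewrite mem_nth // cell_index. Qed.

Lemma cellat_inj (p q : int) : (`|p| <= N1)%N -> (`|q| <= N1)%N ->
  cellat p = cellat q -> p = q.
Proof. by move=> pN qN /(nth_L_inj (cell_index pN) (cell_index qN)); lia. Qed.

Lemma next_cell_right u v (p : int) : (`|p| < N1)%N -> cpos u = cellat p ->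
  next_cell u v = (cpos v == cellat (p + 1)).
Proof.
move=> pN up; have iL : ((absz (o%:Z + p)%R).+1 < size L)%N by lia.
have E : (absz (o%:Z + (p + 1))%R) = (absz (o%:Z + p)%R).+1%N by lia.
apply/next_cellP/eqP => [[i [iL' ui ->]]|->].
  rewrite /cellat E; congr (nth _ _ _.+1); apply: nth_L_inj; rewrite -?ui //; lia.
by exists (absz (o%:Z + p)%R); rewrite /cellat E.
Qed.

Lemma next_cell_left u v (p : int) : (`|p| < N1)%N -> cpos u = cellat p ->
  next_cell v u = (cpos v == cellat (p - 1)).
Proof.
move=> pN up; have iL : ((absz (o%:Z + p)%R) < size L)%N by lia.
have E : (absz (o%:Z + p)%R) = (absz (o%:Z + (p - 1))%R).+1%N by lia.
apply/next_cellP/eqP => [[i [iL' -> ui]]|->].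
  rewrite /cellat; congr (nth _ _ _).
  suff : i.+1 = (absz (o%:Z + p)%R) by rewrite E => -[].
  by apply: nth_L_inj; rewrite -?ui //; lia.
by exists (absz (o%:Z + (p - 1))%R); rewrite -E up.
Qed.

Lemma next_timeP u v : reflect (time v = (time u).+1) (next_time u v).
Proof.
apply: (iffP andP) => [[uv /forallP nx]|vE]; last first.
  by rewrite vE ltnSn; split=> //; apply/forallP => x; lia.
apply/eqP; rewrite eqn_leq uv andbT leqNgt; apply/negP => lt.
have tN : ((time u).+1 < N1)%N by exact: ltn_trans lt (time_lt v).
have [x [xE _ _]] := block_surj e0 tN (cellat_mem (p := 0) (leq0n _)).
by have := nx x; rewrite xE ltnSn lt.
Qed.

Lemma hpos_take_lt es i : (i < N1)%N -> (`|hpos (take i es)| < N1)%N.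
Proof.
move=> iN; have := hpos_bound (take i es).
have : (size (take i es) <= i)%N by rewrite size_take_min geq_minl.
lia.
Qed.

Lemma graphP es u : reflect
  (exists e, [/\ ev u = Some e, onth es (time u) = Some e &
                 cpos u = cellat (hpos (take (time u) es))]) (u \in graph es).
Proof.
rewrite inE; apply: (iffP and3P) => [[une /eqP ue /eqP uc]|[e [ue ee uc]]].
  by move: une ue; case: (ev u) => // e _ ue; exists e.
by rewrite ue ee uc !eqxx.
Qed.

Lemma graph_event es i e : (size es <= N1)%N -> onth es i = Some e ->
  exists u, [/\ u \in graph es, time u = i & ev u = Some e].
Proof.
move=> esN ie; have iN : (i < N1)%N by apply: leq_trans esN; rewrite -onthTE ie.
have [u [ui uc ue]] := block_surj e iN (cellat_mem (ltnW (hpos_take_lt es iN))).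
by exists u; split=> //; apply/graphP; exists e; rewrite ui.
Qed.

Lemma graph_inj es es' : (size es <= N1)%N -> (size es' <= N1)%N ->
  graph es = graph es' -> es = es'.
Proof.
move=> sN sN' E; apply: eq_from_onth => i.
case ie: (onth es i) => [e|].
  have [u [uG ui ue]] := graph_event sN ie.
  by move: uG; rewrite E => /graphP[e' [ue' ie' _]]; rewrite -ui ie' -ue' ue.
case ie': (onth es' i) => [e|] //.
have [u [uG ui ue]] := graph_event sN' ie'.
by move: uG; rewrite -E => /graphP[e' [ue' ie'' _]]; rewrite -ui ie'' in ie.
Qed.

Lemma state_afterS es i e : onth es i = Some e -> state_after (M := M) (take i.+1 es) = dst e.
Proof. by move=> ie; rewrite (take_onth ie) /state_after map_rcons last_rcons. Qed.

Lemma hposS es i e : onth es i = Some e ->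
  hpos (take i.+1 es) = hpos (take i es) + (tmove e : nat)%:Z - 1.
Proof. by move=> ie; rewrite (take_onth ie) hpos_rcons. Qed.

Lemma holds_symbol_take es i p a : (i <= size es)%N ->
  holds_symbol (M := M) w (take i es) p a <->
  (exists j e, [/\ (j < i)%N, onth es j = Some e, hpos (take j es) = p, twrite e = a &
     forall k, (j < k < i)%N -> hpos (take k es) != p]) \/
  ((forall k, (k < i)%N -> hpos (take k es) != p) /\ ctape (init M w) p = a).
Proof.
move=> ies; have szE : size (take i es) = i by rewrite size_take_min; apply/minn_idPl.
have onE j : (j < i)%N -> onth (take i es) j = onth es j.
  by move=> ji; rewrite -[in RHS](cat_take_drop i es) onth_cat szE ji.
have tE j : (j < i)%N -> take j (take i es) = take j es.
  by move=> ji; rewrite take_takel // ltnW.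
split=> [[[j [e [je jp ja jk]]]|[np ip]]|[[j [e [ji je jp ja jk]]]|[np ip]]].
- have ji : (j < i)%N by rewrite -szE -onthTE je.
  left; exists j, e; split=> //; [by rewrite -onE | by rewrite -tE |].
  move=> k /andP[jk' ki]; rewrite -tE //; apply: jk; rewrite szE jk' //.
- by right; split=> // k ki; rewrite -tE //; apply: np; rewrite szE.
- left; exists j, e; split=> //; [by rewrite onE | by rewrite tE |].
  by move=> k; rewrite szE => /andP[jk' ki]; rewrite tE //; apply: jk; rewrite jk'.
- by right; split=> // k; rewrite szE => ki; rewrite tE //; apply: np.
Qed.

Lemma chi_shape G : chi G -> exists2 es, (size es <= N1)%N & G = graph es.
Proof.
case/and5P=> /forallP Hev /forallP Huniq /forallP Hinit /forallP Hstart /andP[/forallP Hstep _].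
have evG u : u \in G -> exists e, ev u = Some e.
  by move=> uG; have /implyP/(_ uG)/andP[/existsP[e /andP[/eqP ue _]] _] := Hev u; exists e.
have uniqG u v : u \in G -> v \in G -> time u = time v -> u = v.
  move=> uG vG uv; have /forallP/(_ v)/implyP := Huniq u.
  by rewrite uG vG same_timeE uv eqxx => /(_ isT)/eqP.
pose f i := [pick u | (u \in G) && (time u == i)].
have fN1 : exists i, f i == None.
  exists N1; rewrite /f; case: pickP => // u /andP[_ /eqP uN].
  by have := time_lt u; rewrite uN ltnn.
pose m := ex_minn fN1.
have [fm m_min] : f m = None /\ forall i, f i = None -> (m <= i)%N.
  by rewrite /m; case: ex_minnP => i /eqP fi i_min; split=> // j /eqP /i_min.
have mN : (m <= N1)%N.
  apply: m_min; rewrite /f; case: pickP => // u /andP[_ /eqP uN].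
  by have := time_lt u; rewrite uN ltnn.
have ltm i : (i < m)%N -> exists u, [/\ f i = Some u, u \in G & time u = i].
  move=> im; case fi: (f i) => [u|]; last by have := m_min _ fi; rewrite leqNgt im.
  by move: fi; rewrite /f; case: pickP => // u' /andP[u'G /eqP u'i] [<-]; exists u'.
have timeG u : u \in G -> (time u < m)%N.
  move=> uG; rewrite ltnNge; apply/negP => mu.
  have fmN v : v \in G -> time v != m.
    move=> vG; apply/negP => vm; move: fm; rewrite /f; case: pickP => // /(_ v).
    by rewrite vG vm.
  have mu' : (m < time u)%N by rewrite ltn_neqAle eq_sym fmN.
  have mN' : (m < N1)%N by exact: ltn_trans mu' (time_lt u).
  have [v [vm _ _]] := block_surj e0 mN' (cellat_mem (p := 0) (leq0n _)).
  have /forallP/(_ v)/implyP := Hinit u; rewrite uG vm mu' => /(_ isT)/existsP[x /andP[xG]].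
  by rewrite same_timeE vm; apply/negP/fmN.
have fE u : u \in G -> f (time u) = Some u.
  move=> uG; have [v [-> vG vu]] := ltm _ (timeG _ uG); congr Some; exact: uniqG.
pose g i := odflt e0 (obind ev (f i)).
pose es := [seq g i | i <- iota 0 m].
have es_size : size es = m by rewrite size_map size_iota.
have esE u : u \in G -> onth es (time u) = ev u.
  move=> uG; rewrite onth_map onthE (nth_map 0%N) ?size_iota ?timeG //.
  rewrite nth_iota ?timeG //= /g add0n fE //=; by have [e ->] := evG _ uG.
have posG i u : u \in G -> time u = i -> cpos u = cellat (hpos (take i es)).
  elim: i u => [|i IH] u uG ui.
    have /implyP := Hstart u; rewrite uG; have -> : [forall v, ~~ (time v < time u)%N].
      by apply/forallP => v; rewrite ui.
    move=> /(_ isT)/andP[]; rewrite originE => /eqP-> _.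
    by rewrite take0 /hpos big_nil /cellat addr0.
  have im : (i < m)%N by have := timeG _ uG; rewrite ui; apply: leq_trans.
  have [v [_ vG vi]] := ltm _ im.
  have /forallP/(_ u)/implyP := Hstep v; rewrite vG uG; have -> : next_time v u.
    by apply/next_timeP; rewrite ui vi.
  have [e ve] := evG _ vG; have esi : onth es i = Some e by rewrite -vi esE.
  move=> /(_ isT)/andP[_]; rewrite !(on_eventE _ ve) (hposS esi).
  have vc := IH _ vG vi; have pN := hpos_take_lt es (leq_trans im mN).
  rewrite (next_cell_left _ pN vc) (next_cell_right _ pN vc) same_cellE vc.
  case/orP => [/orP[]|] /andP[/eqP-> /eqP].
  - by move=> ->; rewrite addr0.
  - by move=> <-; rewrite addrK.
  - by move=> ->; congr cellat; lia.
exists es; first by rewrite es_size.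
apply/setP => u; apply/idP/graphP => [uG|[e [ue esu uc]]].
  have [e ue] := evG _ uG; exists e; rewrite esE //; split=> //; exact: posG.
have um : (time u < m)%N by rewrite -es_size -onthTE esu.
have [v [_ vG vu]] := ltm _ um.
have ve : ev v = Some e by rewrite -esE // vu.
suff -> : u = v by [].
by apply: block_inj ue ve; rewrite // uc (posG _ _ vG vu).
Qed.

Lemma accepting_chi es : (size es <= N1)%N -> accepting (M := M) w es -> chi (graph es).
Proof.
move=> esN /acceptingP[valid fin].
have lt_size i e : onth es i = Some e -> (i < size es)%N by move=> ie; rewrite -onthTE ie.
have ltN i e : onth es i = Some e -> (i < N1)%N by move=> /lt_size ies; exact: leq_trans ies esN.
apply/and5P; split; last apply/and4P; last split.
- apply/forallP => u; apply/implyP => /graphP[e [ue ie uc]].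
  rewrite (on_eventE _ ue) is_cellE uc cellat_mem ?andbT; last exact/ltnW/hpos_take_lt/ltN/ie.
  by have [] := valid _ _ ie.
- apply/forallP => u; apply/forallP => v; apply/implyP => /andP[/andP[]].
  move=> /graphP[e [ue ie uc]] /graphP[e' [ve ie' vc]]; rewrite same_timeE => /eqP uv.
  apply/eqP; apply: (@block_inj _ _ e) => //; first by rewrite uc vc uv.
  by rewrite ve -ie' -uv ie.
- apply/forallP => u; apply/forallP => v; apply/implyP => /andP[/graphP[e [ue ie uc]] vu].
  have /onth_lt[e' ie'] : (time v < size es)%N by exact: ltn_trans vu (lt_size _ _ ie).
  have [x [xG xv _]] := graph_event esN ie'; apply/existsP; exists x.
  by rewrite xG same_timeE xv eqxx.
- apply/forallP => u; apply/implyP => /andP[/graphP[e [ue ie uc]] /forallP u0].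
  have tu0 : time u = 0%N.
    have [v [v0 _ _]] := block_surj e0 (N1_gt0 u) (cellat_mem (p := 0) (leq0n _)).
    by have := u0 v; rewrite v0 -leqNgt leqn0 => /eqP.
  rewrite (on_eventE _ ue) originE uc tu0 take0 /hpos big_nil /cellat addr0 eqxx /=.
  by have [_ -> _] := valid _ _ ie; rewrite tu0 take0.
- apply/forallP => u; apply/forallP => v; apply/implyP => /andP[/andP[]].
  move=> /graphP[e [ue ie uc]] /graphP[e' [ve ie' vc]] /next_timeP uv.
  rewrite !(on_eventE _ ue) (on_eventE _ ve).
  have [_ -> _] := valid _ _ ie'; rewrite uv (state_afterS ie) eqxx /=.
  have pN := hpos_take_lt es (ltN _ _ ie).
  rewrite (next_cell_left _ pN uc) (next_cell_right _ pN uc) same_cellE vc uc uv (hposS ie).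
  case: (tmove e) => [[|[|[|k]]] k3] //=.
  + by rewrite addr0 eqxx.
  + by rewrite addrK eqxx.
  + by apply/eqP; congr cellat; lia.
- apply/forallP => u; apply/implyP => /graphP[e [ue ie uc]].
  have uN := ltN _ _ ie; have pN := hpos_take_lt es uN.
  have [_ _ /(holds_symbol_take _ _ (ltnW (lt_size _ _ ie)))] := valid _ _ ie.
  have cellE v e' : onth es (time v) = Some e' -> cpos v = cellat (hpos (take (time v) es)) ->
      same_cell v u = (hpos (take (time v) es) == hpos (take (time u) es)).
    move=> ve vc; rewrite same_cellE vc uc; apply/eqP/eqP => [|->//].
    by apply: cellat_inj; apply/ltnW => //; apply/hpos_take_lt/ltN/ve.
  case=> [[j [e' [ju je jp jw jk]]]|[np ip]]; apply/orP; [left|right].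
    have [v [vG vj ve]] := graph_event esN je; apply/existsP; exists v.
    have [e1 [_ ve1 vc]] := graphP _ _ vG.
    rewrite vG vj ju (cellE _ _ ve1 vc) vj jp eqxx (on_eventE _ ve) (on_eventE _ ue) jw eqxx /=.
    apply/forallP => x; apply/implyP => /andP[/andP[/graphP[e2 [_ xe xc]] jx] xu].
    by rewrite (cellE _ _ xe xc); apply: jk; rewrite jx.
  rewrite (on_eventE _ ue) (init_symbolE _ pN uc) ip eqxx andbT.
  apply/forallP => x; apply/implyP => /andP[/graphP[e2 [_ xe xc]] xu].
  by rewrite (cellE _ _ xe xc); apply: np.
- apply/forallP => u; apply/implyP => /andP[/graphP[e [ue ie uc]] /forallP last_u].
  rewrite (on_eventE _ ue); move: fin; suff <- : take (time u).+1 es = es by rewrite (state_afterS ie).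
  rewrite take_oversize // leqNgt; apply/negP => /onth_lt[e' ie'].
  have [v [vG vi _]] := graph_event esN ie'.
  by have /implyP/(_ vG) := last_u v; rewrite vi ltnSn.
- rewrite /chi_empty; case: es esN fin {valid lt_size ltN} => [|e es] esN fin; first by rewrite fin orbT.
  by have [u [uG _ _]] := @graph_event (e :: es) 0 e esN erefl; apply/orP; left; apply/existsP; exists u.
Qed.

Lemma chi_accepting es : (size es <= N1)%N -> chi (graph es) -> accepting (M := M) w es.
Proof.
move=> esN /and5P[/forallP Hev _ _ /forallP Hstart /and4P[/forallP Hstep /forallP Hread /forallP Hfin Hempty]].
have lt_size i e : onth es i = Some e -> (i < size es)%N by move=> ie; rewrite -onthTE ie.
have ltN i e : onth es i = Some e -> (i < N1)%N by move=> /lt_size ies; exact: leq_trans ies esN.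
apply/acceptingP; split; last first.
  case: (lastP es) esN Hfin Hempty lt_size ltN => [|es' e] esN Hfin.
    case/orP => // /existsP[u /graphP[e []]]; by rewrite onth0n.
  move=> _ lt_size ltN; have ie : onth (rcons es' e) (size es') = Some e by rewrite onth_rcons ltnn eqxx.
  have [u [uG ui ue]] := graph_event esN ie; have /implyP := Hfin u.
  rewrite uG (on_eventE _ ue) /state_after map_rcons last_rcons; apply.
  apply/forallP => v; apply/implyP => /graphP[e' [_ /lt_size]].
  by rewrite size_rcons ltnS ui -leqNgt.
move=> i e ie; have [u [uG ui ue]] := graph_event esN ie.
have uN := ltN _ _ ie; have pN := hpos_take_lt es uN.
have [e1 [_ _]] := graphP _ _ uG; rewrite ui => uc.
split.
- by have /implyP/(_ uG)/andP[] := Hev u; rewrite (on_eventE _ ue).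
- case: i ie ui {uc pN uN} => [|i] ie ui.
    have /implyP := Hstart u; rewrite uG (on_eventE _ ue) take0 => H.
    suff /H/andP[_ /eqP->] : true && [forall v, ~~ (time v < time u)%N] by [].
    by apply/forallP => v; rewrite ui.
  have /onth_lt[e' ie'] : (i < size es)%N by apply: ltnW; exact: lt_size ie.
  have [v [vG vi ve]] := graph_event esN ie'; rewrite (state_afterS ie').
  have /forallP/(_ u)/implyP := Hstep v; rewrite uG vG.
  have -> : next_time v u by apply/next_timeP; rewrite ui vi.
  by move=> /(_ isT)/andP[]; rewrite (on_eventE _ ve) (on_eventE _ ue) => /eqP.
- have cellE v e' : onth es (time v) = Some e' -> cpos v = cellat (hpos (take (time v) es)) ->
      same_cell v u = (hpos (take (time v) es) == hpos (take i es)).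
    move=> ve vc; rewrite same_cellE vc uc; apply/eqP/eqP => [|->//].
    by apply: cellat_inj; apply/ltnW => //; apply/hpos_take_lt/ltN/ve.
  apply/holds_symbol_take; first exact/ltnW/lt_size/ie.
  have /implyP/(_ uG) := Hread u; rewrite ui.
  case/orP => [/existsP[v /andP[/andP[/andP[/andP[vG vi] vc]]]]|/andP[/forallP np]].
    have [e' [ve ie' vc']] := graphP _ _ vG.
    rewrite (on_eventE _ ve) (on_eventE _ ue) => /eqP we /forallP jk.
    left; exists (time v), e'; split=> //.
      by apply/eqP; rewrite -(cellE _ _ ie' vc').
    move=> k /andP[vk ki]; have /onth_lt[e2 ke] : (k < size es)%N by exact: ltn_trans ki (lt_size _ _ ie).
    have [x [xG xk xe]] := graph_event esN ke; have [e3 [_ xe3 xc]] := graphP _ _ xG.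
    by have /implyP := jk x; rewrite xG xk vk ki (cellE _ _ xe3 xc) xk => /(_ isT).
  rewrite (on_eventE _ ue) (init_symbolE _ pN uc) => /eqP ip; right; split=> // k ki.
  have /onth_lt[e2 ke] : (k < size es)%N by exact: ltn_trans ki (lt_size _ _ ie).
  have [x [xG xk xe]] := graph_event esN ke; have [e3 [_ xe3 xc]] := graphP _ _ xG.
  by have /implyP := np x; rewrite xG xk ki (cellE _ _ xe3 xc) xk => /(_ isT).
Qed.

End Correctness.
End Chi.

(** * Definability over ordered structures *)

Lemma bclosed_sub (tau : vocabulary) (f : bformula tau) V V' W W' :
  {subset V <= V'} -> {subset W <= W'} -> bclosed V W f -> bclosed V' W' f.
Proof.
elim: f V V' W W' => [|R xs|X xs|x y|f IH|f IHf g IHg|x f IH|X f IH] V V' W W' VV WW //=.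
- by apply: sub_all => x /VV.
- by case/andP => /WW-> /sub_all; apply => x /VV.
- by case/andP => /VV-> /VV->.
- exact: IH.
- by case/andP => /(IHf _ _ _ _ VV WW)-> /(IHg _ _ _ _ VV WW)->.
- by apply: IH => // y; rewrite !inE => /orP[->|/VV->]; rewrite ?orbT.
- by apply: IH => // Y; rewrite !inE => /orP[->|/WW->]; rewrite ?orbT.
Qed.

Section BlockQuantifiers.
Variables (S : pzSemiRingType) (tau : vocabulary) (A : structure tau).

Fixpoint upd (rho : nat -> option A) (xs : seq nat) (t : seq A) : nat -> option A :=
  if (xs, t) is (x :: xs', a :: t') then upd [eta rho with x |-> Some a] xs' t' else rho.

Lemma upd_notin rho xs t x : x \notin xs -> upd rho xs t x = rho x.
Proof.
elim: xs t rho => [|y xs IH] [|a t] rho //=; rewrite in_cons negb_or => /andP[xy xxs].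
by rewrite IH //= (negPf xy).
Qed.

Lemma map_upd rho xs t : uniq xs -> size xs = size t -> map (upd rho xs t) xs = map Some t.
Proof.
elim: xs t rho => [|y xs IH] [|a t] rho //= /andP[yxs uxs] [st].
by rewrite IH // upd_notin //= eqxx.
Qed.

Lemma map_upd_notin rho xs t ys : ~~ has (mem xs) ys -> map (upd rho xs t) ys = map rho ys.
Proof.
move=> /hasPn H; apply/eq_in_map => y /H yxs; exact: upd_notin.
Qed.

Lemma bsem_exs rho eta f k xs : size xs = k ->
  bsem rho eta (foldr (@BEx tau) f xs) =
  [exists t : k.-tuple A, bsem (upd rho xs t) eta f].
Proof.
move=> <-{k}; elim: xs rho => [|x xs IH] rho /=.
  by apply/idP/existsP => [H|[t]] //; exists [tuple].
apply/existsP/existsP => [[a]|[t]].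
  by rewrite IH => /existsP[t Ht]; exists (cons_tuple a t).
case/tupleP: t => a t /= Ht; exists a; rewrite IH; apply/existsP; by exists t.
Qed.

Lemma wsem_prods (r : seq A) rho eta (f : wformula S tau) k xs : size xs = k ->
  wsem r rho eta (foldr (@WProd S tau) f xs) =
  \prod_(t <- lex_tuples r k) wsem r (upd rho xs t) eta f.
Proof.
move=> <-{k}; elim: xs rho => [|x xs IH] rho /=; first by rewrite big_seq1.
rewrite big_allpairs_dep /=; apply: eq_bigr => a _; exact: IH.
Qed.

End BlockQuantifiers.

Section OrderedFormulas.
Variable tau : vocabulary.
Local Notation bf := (bformula (with_lt tau)).

Definition enumerates (A : structure (with_lt tau)) (r : seq A) : Prop :=
  [/\ uniq r, forall a, a \in r & forall a b : A, ltA A a b = (index a r < index b r)%N].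

Definition BLt (x y : nat) : bf := @BRel (with_lt tau) None [tuple x; y].
Definition BAnd (f g : bf) : bf := BNot (BOr (BNot f) (BNot g)).

Fixpoint rank_is (q x : nat) : bf :=
  if q is q'.+1 then
    BEx x.+1 (BAnd (BLt x.+1 x) (BAnd (rank_is q' x.+1)
      (BNot (BEx x.+2 (BAnd (BLt x.+1 x.+2) (BLt x.+2 x))))))
  else BNot (BEx x.+1 (BLt x.+1 x)).

Fixpoint lex_lt (xs ys : seq nat) : bf :=
  if (xs, ys) is (x :: xs', y :: ys') then
    BOr (BLt x y) (BAnd (BEq _ x y) (lex_lt xs' ys'))
  else BFalse _.

Lemma rank_is_fo q x : bfirst_order (rank_is q x).
Proof. by elim: q x => //= q IH x; rewrite IH. Qed.

Lemma rank_is_closed q x V W : x \in V -> bclosed V W (rank_is q x).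
Proof.
elim: q x V => [|q IH] x V xV /=; first by rewrite !inE eqxx xV orbT.
by rewrite IH !inE ?eqxx ?xV ?orbT.
Qed.

Lemma lex_lt_fo xs ys : bfirst_order (lex_lt xs ys).
Proof. by elim: xs ys => [|x xs IH] [|y ys] //=; rewrite IH. Qed.

Lemma lex_lt_closed xs ys V W : all (mem V) xs -> all (mem V) ys ->
  bclosed V W (lex_lt xs ys).
Proof.
elim: xs ys => [|x xs IH] [|y ys] //= /andP[xV xsV] /andP[yV ysV].
by rewrite /= xV yV IH.
Qed.

Section Sem.
Variables (A : structure (with_lt tau)) (r : seq A).
Hypothesis Ar : enumerates r.
Implicit Types (rho : nat -> option A) (eta : so_assignment A).

Lemma index_enumerates_inj a b : index a r = index b r -> a = b.
Proof. by case: Ar => _ ra _ E; rewrite -(nth_index a (ra a)) E nth_index. Qed.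

Lemma bsem_and rho eta f g : bsem rho eta (BAnd f g) = bsem rho eta f && bsem rho eta g.
Proof. by rewrite /= negb_or !negbK. Qed.

Lemma bsem_lt rho eta x y a c : rho x = Some a -> rho y = Some c ->
  bsem rho eta (BLt x y) = (index a r < index c r)%N.
Proof.
move=> xa yc; case: Ar => _ _ <-.
rewrite /BLt [LHS](@exists_tupleE _ 2 _ _ _ [tuple a; c]) //=; by rewrite xa yc.
Qed.

Lemma bsem_eq rho eta x y a c : rho x = Some a -> rho y = Some c ->
  bsem rho eta (BEq _ x y) = (a == c).
Proof.
move=> xa yc /=; rewrite xa yc; apply/existsP/eqP => [[z /andP[/eqP[->] /eqP[->]]] //|->].
by exists c; rewrite eqxx.
Qed.

Lemma bsem_rank_is rho eta q x a : rho x = Some a ->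
  bsem rho eta (rank_is q x) = (index a r == q).
Proof.
have [ur ra _] := Ar.
elim: q x a rho => [|q IH] x a rho xa.
  have H c : bsem [eta rho with x.+1 |-> Some c] eta (BLt x.+1 x) = (index c r < index a r)%N.
    by apply: bsem_lt; rewrite /= ?eqxx // ltn_eqF.
  rewrite -[LHS]/(~~ [exists c, bsem [eta rho with x.+1 |-> Some c] eta (BLt x.+1 x)]).
  rewrite -leqn0 leqNgt; congr (~~ _); apply/existsP/idP => [[c]|a0].
    by rewrite H; apply: leq_ltn_trans.
  have r0 : (0 < size r)%N by rewrite -has_predT; apply/hasP; exists a.
  by exists (nth a r 0); rewrite H index_uniq.
have xS : (x == x.+1) = false by rewrite ltn_eqF.
have xSS : (x == x.+2) = false by rewrite ltn_eqF // ltnW.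
have xSS' : (x.+1 == x.+2) = false by rewrite ltn_eqF.
have H c : bsem [eta rho with x.+1 |-> Some c] eta (BAnd (BLt x.+1 x) (BAnd (rank_is q x.+1)
      (BNot (BEx x.+2 (BAnd (BLt x.+1 x.+2) (BLt x.+2 x)))))) =
   [&& (index c r < index a r)%N, index c r == q & ~~ [exists z, (index c r < index z r < index a r)%N]].
  set rho' := fun_of_simpl _.
  have c1 : rho' x.+1 = Some c by rewrite /rho' /= eqxx.
  have a1 : rho' x = Some a by rewrite /rho' /= xS.
  rewrite !bsem_and (bsem_lt _ c1 a1) (IH _ c _ c1).
  rewrite -[bsem _ _ (BNot _)]/(~~ [exists z, bsem [eta rho' with x.+2 |-> Some z] eta
    (BAnd (BLt x.+1 x.+2) (BLt x.+2 x))]).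
  congr [&& _, _ & ~~ _]; apply: eq_existsb => z; rewrite bsem_and.
  by rewrite (@bsem_lt _ _ _ _ c z) ?(@bsem_lt _ _ _ _ z a) //= ?c1 ?a1 ?xS ?xSS ?xSS' ?eqxx.
rewrite -[LHS]/[exists c, bsem [eta rho with x.+1 |-> Some c] eta (BAnd (BLt x.+1 x)
   (BAnd (rank_is q x.+1) (BNot (BEx x.+2 (BAnd (BLt x.+1 x.+2) (BLt x.+2 x))))))].
apply/existsP/eqP => [[c]|aq].
  rewrite H => /and3P[ca /eqP cq nz]; apply/eqP; rewrite eqn_leq -{2}cq ca andbT leqNgt.
  apply: contra nz => lt; have qr : (q.+1 < size r)%N by apply: ltn_trans lt _; rewrite index_mem.
  by apply/existsP; exists (nth a r q.+1); rewrite index_uniq // cq ltnSn.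
have qr : (q < size r)%N by rewrite ltnW // -aq index_mem.
exists (nth a r q); rewrite H index_uniq // aq ltnSn eqxx /=.
by apply/existsP => -[z]; lia.
Qed.

Lemma lexi_lt_all (s : seq A) : (lexi r s < size r ^ size s)%N.
Proof. by apply: lexi_lt; apply/allP => a _; case: Ar => _ ra _; rewrite /= ra. Qed.

Lemma bsem_lex_lt rho eta xs ys s s' : map rho xs = map Some s -> map rho ys = map Some s' ->
  size s = size s' -> bsem rho eta (lex_lt xs ys) = (lexi r s < lexi r s')%N.
Proof.
elim: xs ys s s' => [|x xs IH] [|y ys] [|a s] [|c s'] // [xa xs_s] [yc ys_s'] [ss'].
rewrite -[LHS]/(bsem rho eta (BLt x y) || bsem rho eta (BAnd (BEq _ x y) (lex_lt xs ys))).
rewrite (bsem_lt _ xa yc) bsem_and (bsem_eq _ xa yc) (IH ys s s') //=.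
have := lexi_lt_all s; have := lexi_lt_all s'; rewrite ss'; set m := (_ ^ _)%N => s'm sm.
have -> : (a == c) = (index a r == index c r) by apply/eqP/eqP => [->|/index_enumerates_inj].
case: ltngtP => [ac|ca|->] /=.
- by apply/esym; nia.
- by apply/esym; nia.
- by rewrite ltn_add2l.
Qed.

End Sem.
End OrderedFormulas.

Section Definable.
Variables (tau : vocabulary) (b : nat).

Definition Xb : sovar := (0%N, b).
Definition vars (i : nat) : seq nat := iota (i * b) b.

Definition bpred : Type := forall A : structure (with_lt tau),
  seq A -> (nat -> b.-tuple A) -> {set b.-tuple A} -> bool.

(* The blocks of variables [vars i] for [i < k] are free in the formula; [bl i]
   is the value of the [i]-th block. *)
Definition definable (k : nat) (P : bpred) : Prop :=
  exists f : bformula (with_lt tau),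
    [/\ bfirst_order f, bclosed (iota 0 (k * b)) [:: Xb] f &
      forall (A : structure (with_lt tau)) (r : seq A) (bl : nat -> b.-tuple A) (G : {set b.-tuple A})
          (rho : nat -> option A) (eta : so_assignment A),
        enumerates r -> (forall i, (i < k)%N -> map rho (vars i) = map Some (bl i)) ->
        eta Xb = G -> bsem rho eta f = P A r bl G].

Lemma def_ext k (P Q : bpred) : definable k P ->
  (forall A r bl G, enumerates r -> P A r bl G = Q A r bl G) -> definable k Q.
Proof.
move=> [f [fo cl H]] E; exists f; split=> // A r bl G rho eta Ar blE GE.
by rewrite -E //; apply: H.
Qed.

Lemma def_false k : definable k (fun _ _ _ _ => false).
Proof. by exists (BFalse _). Qed.

Lemma def_not k P : definable k P -> definable k (fun A r bl G => ~~ P A r bl G).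
Proof.
move=> [f [fo cl H]]; exists (BNot f); split=> // A r bl G rho eta Ar blE GE.
by rewrite /= (H A r bl G).
Qed.

Lemma def_true k : definable k (fun _ _ _ _ => true).
Proof. exact: def_not (def_false k). Qed.

Lemma def_const k c : definable k (fun _ _ _ _ => c).
Proof. by case: c; [exact: def_true | exact: def_false]. Qed.

Lemma def_or k P Q : definable k P -> definable k Q ->
  definable k (fun A r bl G => P A r bl G || Q A r bl G).
Proof.
move=> [f [fo cl H]] [g [fo' cl' H']]; exists (BOr f g); split=> /=.
- by rewrite fo.
- by rewrite cl.
- by move=> A r bl G rho eta Ar blE GE; rewrite (H A r bl G) // (H' A r bl G).
Qed.

Lemma def_and k P Q : definable k P -> definable k Q ->
  definable k (fun A r bl G => P A r bl G && Q A r bl G).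
Proof.
move=> /def_not dP /def_not dQ; apply: def_ext (def_not (def_or dP dQ)) _.
by move=> A r bl G _; rewrite negb_or !negbK.
Qed.

Lemma def_imp k P Q : definable k P -> definable k Q ->
  definable k (fun A r bl G => P A r bl G ==> Q A r bl G).
Proof.
move=> /def_not dP dQ; apply: def_ext (def_or dP dQ) _.
by move=> A r bl G _; rewrite implybE.
Qed.

Lemma def_exists_fin k (T : finType) (P : T -> bpred) :
  (forall x, definable k (P x)) -> definable k (fun A r bl G => [exists x, P x A r bl G]).
Proof.
move=> dP; suff H (s : seq T) : definable k (fun A r bl G => has (fun x => P x A r bl G) s).
  apply: def_ext (H (enum T)) _ => A r bl G _.
  apply/hasP/existsP => [[x _ Px]|[x Px]]; exists x => //; by rewrite mem_enum.
elim: s => [|x s IH]; first exact: def_false.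
exact: def_or (dP x) IH.
Qed.

Lemma def_exists k P : definable k.+1 P ->
  definable k (fun A r bl G => [exists u, P A r [eta bl with k |-> u] G]).
Proof.
move=> [f [fo cl H]]; exists (foldr (@BEx _) f (vars k)); split.
- by elim: (vars k).
- have {}cl : bclosed (iota 0 (k * b) ++ vars k) [:: Xb] f.
    by apply: bclosed_sub cl => // x; rewrite -iotaD mulSn addnC.
  elim: (vars k) (iota 0 (k * b)) cl => [|x xs IH] V cl /=; first by rewrite cats0 in cl.
  apply: IH; apply: bclosed_sub cl => // y; rewrite !(mem_cat, inE).
  by case/or3P => ->; rewrite ?orbT.
- move=> A r bl G rho eta Ar blE GE; rewrite (@bsem_exs _ A _ _ _ b) ?size_iota //.
  apply: eq_existsb => u; apply: H => // i; rewrite ltnS leq_eqVlt => /orP[/eqP->|ik].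
    by rewrite map_upd /= ?eqxx ?iota_uniq // size_iota size_tuple.
  rewrite map_upd_notin /= ?ltn_eqF ?blE //; apply/hasPn => y.
  by rewrite /vars inE !mem_iota; nia.
Qed.

Lemma def_forall k P : definable k.+1 P ->
  definable k (fun A r bl G => [forall u, P A r [eta bl with k |-> u] G]).
Proof.
move=> /def_not/def_exists/def_not d; apply: def_ext d _ => A r bl G _.
by rewrite negb_exists; apply: eq_forallb => u; rewrite negbK.
Qed.

Lemma size_sub (T : Type) a l (u : b.-tuple T) : (a + l <= b)%N ->
  size (take l (drop a u)) = l.
Proof. by move=> alb; rewrite size_takel // size_drop size_tuple; lia. Qed.

Lemma map_sub (A : structure (with_lt tau)) (rho : nat -> option A) a l i (u : b.-tuple A) :
  map rho (vars i) = map Some u ->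
  map rho (take l (drop a (vars i))) = map Some (take l (drop a u)).
Proof. by move=> E; rewrite map_take map_drop E -map_drop -map_take. Qed.

Lemma sub_vars a l i : (a + l <= b)%N -> take l (drop a (vars i)) = iota (i * b + a) l.
Proof. by move=> alb; rewrite drop_iota take_iota; congr iota; lia. Qed.

Lemma sub_vars_closed k i a l : (i < k)%N ->
  all (mem (iota 0 (k * b))) (take l (drop a (vars i))).
Proof.
move=> ik; apply/allP => x /mem_take/mem_drop; rewrite /vars ?inE !mem_iota; nia.
Qed.

Lemma def_mem k i : (i < k)%N -> definable k (fun A r bl G => bl i \in G).
Proof.
move=> ik; have sz : size (vars i) == b by rewrite size_iota.
exists (@BVar (with_lt tau) Xb (Tuple sz)); split=> //.
- rewrite /= inE eqxx /=; apply/allP => x; rewrite /vars ?inE !mem_iota; nia.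
- move=> A r bl G rho eta Ar blE <-; exact: (exists_tupleE _ (xs := Tuple sz) (blE i ik)).
Qed.

Lemma def_lex k i j a l : (i < k)%N -> (j < k)%N -> (a + l <= b)%N ->
  definable k (fun A r bl G =>
    lexi r (take l (drop a (bl i))) < lexi r (take l (drop a (bl j))))%N.
Proof.
move=> ik jk alb; exists (lex_lt tau (take l (drop a (vars i))) (take l (drop a (vars j)))); split.
- exact: lex_lt_fo.
- by apply: lex_lt_closed; apply: sub_vars_closed.
- move=> A r bl G rho eta Ar blE _.
  by apply: (bsem_lex_lt Ar); [apply/map_sub/blE|apply/map_sub/blE|rewrite !size_sub].
Qed.

Lemma def_rank k i a q : (i < k)%N -> (a < b)%N ->
  definable k (fun A r bl G => lexi r (take 1 (drop a (bl i))) == q).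
Proof.
move=> ik ab; exists (rank_is tau q (i * b + a)); split.
- exact: rank_is_fo.
- by apply: rank_is_closed; rewrite mem_iota; nia.
- move=> A r bl G rho eta Ar blE _.
  have alb : (a + 1 <= b)%N by rewrite addn1.
  have := map_sub a 1 (blE i ik); have := size_sub (bl i) alb; rewrite sub_vars //.
  case: (take 1 _) => [|c [|? ?]] //= _ [xc].
  by rewrite (bsem_rank_is Ar _ _ xc) muln1 addn0.
Qed.

Lemma def_eq k i j : (i < k)%N -> (j < k)%N -> definable k (fun A r bl G => bl i == bl j).
Proof.
move=> ik jk; have alb : (0 + b <= b)%N by [].
apply: def_ext (def_and (def_not (def_lex ik jk alb)) (def_not (def_lex jk ik alb))) _.
move=> A r bl G Ar; rewrite -!leqNgt andbC -eqn_leq !drop0.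
have ra (u : b.-tuple A) : all (mem r) u by apply/allP => x _; case: Ar => _ H _; exact: H.
have tE (u : b.-tuple A) : take b u = u by rewrite take_oversize // size_tuple.
by rewrite !tE; apply/eqP/eqP => [/(lexi_inj (ra (bl i)) (ra (bl j)))|->].
Qed.

Lemma def_rel k i (R : sym tau) a : (i < k)%N -> (a + arity R <= b)%N ->
  definable k (fun A r bl G =>
    [exists t in @interp _ A (Some R), tval t == take (arity R) (drop a (bl i))]).
Proof.
move=> ik alb; have sz : size (take (arity R) (drop a (vars i))) == arity R.
  by rewrite sub_vars // size_iota.
exists (@BRel (with_lt tau) (Some R) (Tuple sz)); split=> //.
- by apply: sub_vars_closed.
- move=> A r bl G rho eta Ar blE _ /=; rewrite (map_sub _ _ (blE i ik)).
  apply: eq_existsb => t; congr (_ && _); rewrite eq_sym.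
  by apply/eqP/eqP => [/(inj_map Some_inj)|->].
Qed.

Lemma lexi_nseq (A : eqType) (a : A) (r : seq A) l : lexi (a :: r) (nseq l a) = 0%N.
Proof. by elim: l => //= l ->; rewrite eqxx. Qed.

Lemma def_zero k i a l : (i < k)%N -> (a + l <= b)%N ->
  definable k (fun A r bl G => lexi r (take l (drop a (bl i))) == 0%N).
Proof.
move=> ik alb.
apply: def_ext (def_forall (def_not (def_lex (ltnSn k) (ltnW ik : i < k.+1)%N alb))) _.
move=> A r bl G Ar; rewrite /= eqxx ltn_eqF //.
apply/forallP/eqP => [H|-> u]; last by rewrite ltn0.
have [l0|l_gt0] := posnP l; first by rewrite l0 take0.
have b_gt0 : (0 < b)%N by lia.
case: r Ar H => [|c r] Ar H.
  by have [_ ra _] := Ar; have := ra (tnth (bl i) (Ordinal b_gt0)).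
apply/eqP; rewrite -leqn0; have := H [tuple of nseq b c]; rewrite -leqNgt /= => H'.
apply: leq_trans H' _.
have -> : take l (drop a (nseq b c)) = nseq l c by rewrite drop_nseq take_nseq //; lia.
by rewrite lexi_nseq.
Qed.

End Definable.

Section DefinableBlocks.
Variables (tau : vocabulary) (b : nat).

Lemma def_existsb k (Q : forall A : structure (with_lt tau),
    seq A -> (nat -> b.-tuple A) -> {set b.-tuple A} -> b.-tuple A -> bool) :
  (forall A r bl G u u', Q A r [eta bl with k |-> u'] G u = Q A r bl G u) ->
  definable k.+1 (fun A r bl G => Q A r bl G (bl k)) ->
  definable k (fun A r bl G => [exists u, Q A r bl G u]).
Proof.
move=> QE /def_exists d; apply: def_ext d _ => A r bl G _.
by apply: eq_existsb => u; rewrite /= eqxx QE.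
Qed.

Lemma def_forallb k (Q : forall A : structure (with_lt tau),
    seq A -> (nat -> b.-tuple A) -> {set b.-tuple A} -> b.-tuple A -> bool) :
  (forall A r bl G u u', Q A r [eta bl with k |-> u'] G u = Q A r bl G u) ->
  definable k.+1 (fun A r bl G => Q A r bl G (bl k)) ->
  definable k (fun A r bl G => [forall u, Q A r bl G u]).
Proof.
move=> QE /def_forall d; apply: def_ext d _ => A r bl G _.
by apply: eq_forallb => u; rewrite /= eqxx QE.
Qed.

End DefinableBlocks.

Section Blocks.
Variables (S : pzSemiRingType) (tau : vocabulary) (Sigma : finType) (M : wtm S Sigma).
Variables (d : bool -> Sigma) (K : nat).
Hypothesis arity_le : forall R : sym tau, (arity R <= K)%N.
Local Notation tr := (transition (state M) (work M)).
Local Notation syms := (enum (sym tau)).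

(* A block of variables stands for a time, a cell of the tape and a
   transition. *)
Definition bsize : nat := (K + K.+2)%N.
Local Notation b := bsize.

Section Coordinates.
Variables (A : structure (with_lt tau)) (r : seq A).
Implicit Type (u : b.-tuple A).

Definition btime u : nat := lexi r (take K (drop 0 u)).
Definition bcell u : nat := lexi r (take K.+1 (drop K u)).
(* Cells are numbered lexicographically by a tag in [0 .. #|tau| + 1] and a
   [K]-tuple: tag 0 is for the cells on the left of the input, tag [i + 1] for
   the encoding of the [i]-th relation and the last tag for the cells on the
   right of the input. *)
Definition btag u : nat := lexi r (take 1 (drop K u)).
Definition btail u : nat := lexi r (take K (drop K.+1 u)).
Definition bevent_index u : nat := lexi r (take 1 (drop (K + K.+1) u)).
Definition bevent (e : tr) u : bool := bevent_index u == index e (enum {: tr}).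

Definition bpadded (R : sym tau) u : bool :=
  (btag u == (index R syms).+1) &&
  (lexi r (take (K - arity R) (drop K.+1 u)) == 0%N).

Definition bis_cell u : bool :=
  [|| btag u == 0%N, btag u == (size syms).+1 | [exists R, bpadded R u]].

Definition borigin u : bool := (btag u == 1%N) && (btail u == 0%N).

Definition bbit (R : sym tau) u : bool :=
  [exists t in @interp _ A (Some R),
     tval t == take (arity R) (drop (K.+1 + (K - arity R)) u)].

Definition binit (a : work M) u : bool :=
  ((btag u == 0%N) || (btag u == (size syms).+1)) && (a == blank M) ||
  [exists R, (btag u == (index R syms).+1) &&
     (bbit R u && (a == emb M (d true)) || ~~ bbit R u && (a == emb M (d false)))].

Definition bchi (G : {set b.-tuple A}) : bool :=
  chi btime bcell bevent bis_cell borigin binit G.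

End Coordinates.

Section Atoms.
Variables (k i : nat).
Hypothesis ik : (i < k)%N.

Lemma def_btime j : (j < k)%N ->
  definable k (fun A r (bl : nat -> b.-tuple A) G => btime r (bl i) < btime r (bl j))%N.
Proof. by move=> jk; apply: def_lex => //; rewrite /b; lia. Qed.

Lemma def_bcell j : (j < k)%N ->
  definable k (fun A r (bl : nat -> b.-tuple A) G => bcell r (bl i) < bcell r (bl j))%N.
Proof. by move=> jk; apply: def_lex => //; rewrite /b; lia. Qed.

Lemma def_btag q : definable k (fun A r (bl : nat -> b.-tuple A) G => btag r (bl i) == q).
Proof. by apply: def_rank => //; rewrite /b; lia. Qed.

Lemma def_bevent e : definable k (fun A r (bl : nat -> b.-tuple A) G => bevent r e (bl i)).
Proof. by apply: def_rank => //; rewrite /b; lia. Qed.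

Lemma def_bis_cell : definable k (fun A r (bl : nat -> b.-tuple A) G => bis_cell r (bl i)).
Proof.
rewrite /bis_cell; apply: def_or (def_btag _) _; apply: def_or (def_btag _) _.
apply: def_exists_fin => R; apply: def_and (def_btag _) _.
by apply: def_zero => //; rewrite /b; lia.
Qed.

Lemma def_borigin : definable k (fun A r (bl : nat -> b.-tuple A) G => borigin r (bl i)).
Proof. by apply: def_and (def_btag _) _; apply: def_zero => //; rewrite /b; lia. Qed.

Lemma def_binit a : definable k (fun A r (bl : nat -> b.-tuple A) G => binit r a (bl i)).
Proof.
have dbit R : definable k (fun A r (bl : nat -> b.-tuple A) G => bbit R (bl i)).
  by apply: def_rel => //; have := arity_le R; rewrite /b; lia.
rewrite /binit; apply: def_or.
  by apply: def_and; [apply: def_or; apply: def_btag | apply: def_const].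
apply: def_exists_fin => R; apply: def_and (def_btag _) _; apply: def_or.
  by apply: def_and; [exact: dbit | apply: def_const].
by apply: def_and; [apply: def_not; exact: dbit | apply: def_const].
Qed.

End Atoms.

Ltac def_step :=
  first
  [ apply: def_forallb; first (by []); move=> /=
  | apply: def_existsb; first (by []); move=> /=
  | by apply: def_mem
  | by apply: def_btime
  | by apply: def_bcell
  | by apply: def_bevent
  | by apply: def_bis_cell
  | by apply: def_borigin
  | by apply: def_binit
  | by apply: def_eq
  | apply: def_const
  | apply: def_exists_fin => ?
  | apply: def_not
  | apply: def_and
  | apply: def_or
  | apply: def_imp ].

Lemma def_bchi : definable 0 (fun A r (bl : nat -> b.-tuple A) G => bchi r G).
Proof.
rewrite /bchi /chi; repeat apply: def_and.
- rewrite /chi_event /on_event. repeat def_step.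
- rewrite /chi_unique /same_time; repeat def_step.
- rewrite /chi_initial /same_time; repeat def_step.
- rewrite /chi_start /on_event; repeat def_step.
- rewrite /chi_step /next_cell /same_cell /next_time /on_event; repeat def_step.
- rewrite /chi_read /same_cell /on_event; repeat def_step.
- rewrite /chi_final /on_event; repeat def_step.
- rewrite /chi_empty; repeat def_step.
Qed.

End Blocks.

Section Lexi.
Variables (A : eqType) (r : seq A).
Hypothesis r_uniq : uniq r.
Hypothesis r_all : forall a, a \in r.

Lemma lexi_cat s t : lexi r (s ++ t) = (lexi r s * size r ^ size t + lexi r t)%N.
Proof.
by elim: s => //= a s ->; rewrite size_cat expnD mulnDl -mulnA addnA.
Qed.

Lemma lexi_bound s : (lexi r s < size r ^ size s)%N.
Proof. by apply: lexi_lt; apply/allP => a _; rewrite /= r_all. Qed.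

Lemma lexi_lex_tuples k : [seq lexi r (val t) | t <- lex_tuples r k] = iota 0 (size r ^ k).
Proof.
apply: eq_from_onth => i; rewrite onth_map.
have [ik|ik] := ltnP i (size r ^ k); last first.
  by rewrite !onth_default ?size_iota ?size_lex_tuples.
have [t ti] : exists t, onth (lex_tuples r k) i = Some t by apply: onth_lt; rewrite size_lex_tuples.
have [tL tE] := onth_uniq (lex_tuples_uniq k r_uniq) ti.
rewrite ti onthE (nth_map 0%N) ?size_iota // nth_iota //= add0n -tE.
by rewrite index_lex_tuples // -mem_lex_tuples.
Qed.

Lemma lexi_surj k m : (m < size r ^ k)%N -> exists t : k.-tuple A, lexi r (val t) = m.
Proof.
move=> mk; have : m \in iota 0 (size r ^ k) by rewrite mem_iota.
by rewrite -lexi_lex_tuples => /mapP[t _ ->]; exists t.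
Qed.

Lemma lexi_inj_seq s t : size s = size t -> lexi r s = lexi r t -> s = t.
Proof.
move=> st E; have ra s' : all (mem r) s' by apply/allP => a _; rewrite /= r_all.
have sz : size s == size t by apply/eqP.
by have /(congr1 val) := lexi_inj (t := Tuple sz) (u := in_tuple t) (ra _) (ra _) E.
Qed.

End Lexi.

Section Instance.
Variables (S : pzSemiRingType) (tau : vocabulary) (Sigma : finType) (M : wtm S Sigma).
Variables (d : bool -> Sigma) (K : nat).
Hypothesis arity_le : forall R : sym tau, (arity R <= K)%N.
Hypothesis htau : exists R : sym tau, (0 < arity R)%N.
Local Notation tr := (transition (state M) (work M)).
Local Notation syms := (enum (sym tau)).
Local Notation b := (bsize K).
Variables (A : structure (with_lt tau)) (r : seq A).
Hypothesis Ar : enumerates r.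
Local Notation n := (size r).
Hypothesis n_syms : (size syms + 2 <= n)%N.
Hypothesis n_tr : (#|{: tr}| <= n)%N.
Local Notation N := (n ^ K)%N.
Implicit Types u v : b.-tuple A.

Let r_uniq : uniq r. Proof. by case: Ar. Qed.
Let r_all a : a \in r. Proof. by case: Ar. Qed.

Fixpoint cells (i : nat) (Rs : seq (sym tau)) : seq (nat * bool) :=
  if Rs is R :: Rs' then
    [seq ((i * N + lexi r (val t))%N, t \in @interp _ A (Some R)) | t <- lex_tuples r (arity R)]
      ++ cells i.+1 Rs'
  else [::].

Definition bits : seq bool :=
  flatten [seq [seq t \in @interp _ A (Some R) | t <- lex_tuples r (arity R)] | R <- syms].

Definition word : seq Sigma := map d bits.

Definition tape_cells : seq nat :=
  iota 0 N ++ map fst (cells 1 syms) ++ iota ((size syms).+1 * N) N.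

Lemma n_gt0 : (0 < n)%N. Proof. by lia. Qed.

Lemma cells_bits i Rs : map snd (cells i Rs) =
  flatten [seq [seq t \in @interp _ A (Some R) | t <- lex_tuples r (arity R)] | R <- Rs].
Proof. by elim: Rs i => //= R Rs IH i; rewrite map_cat IH -map_comp. Qed.

Lemma cells_fst i R Rs : map fst (cells i (R :: Rs)) =
  iota (i * N) (n ^ arity R) ++ map fst (cells i.+1 Rs).
Proof.
rewrite /= map_cat -map_comp -[in RHS](addn0 (i * N)%N) iotaDl -lexi_lex_tuples // -map_comp.
by congr (_ ++ _).
Qed.

Lemma expn_arity_le (R : sym tau) : (n ^ arity R <= N)%N.
Proof. by rewrite leq_pexp2l ?n_gt0. Qed.

Lemma cells_mem i Rs c (v : bool) : (c, v) \in cells i Rs -> exists k (R : sym tau) (t : (arity R).-tuple A),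
  [/\ onth Rs k = Some R, c = ((i + k) * N + lexi r t)%N & v = (t \in @interp _ A (Some R))].
Proof.
elim: Rs i => //= R Rs IH i; rewrite mem_cat => /orP[/mapP[t _ [-> ->]]|/IH[k [R' [t [kR cE vE]]]]].
  by exists 0%N, R, t; rewrite addn0.
by exists k.+1, R', t; rewrite addnS -addSn.
Qed.

Lemma mem_cells i Rs k (R : sym tau) (t : (arity R).-tuple A) : onth Rs k = Some R ->
  (((i + k) * N + lexi r t)%N, t \in @interp _ A (Some R)) \in cells i Rs.
Proof.
elim: Rs i k => [|R' Rs IH] i [|k] //=.
  case=> ->; rewrite mem_cat addn0; apply/orP; left.
  by apply/mapP; exists t => //; rewrite mem_lex_tuples; apply/allP => a _; rewrite /= r_all.
by move=> kR; rewrite mem_cat addnS -addSn IH ?orbT.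
Qed.

Lemma cells_sorted i Rs : pairwise ltn (map fst (cells i Rs)) /\
  all (fun c => (i * N <= c < (i + size Rs) * N)%N) (map fst (cells i Rs)).
Proof.
elim: Rs i => [|R Rs IH] i //.
have [IH1 IH2] := IH i.+1; have RN := expn_arity_le R.
rewrite cells_fst pairwise_cat all_cat IH1 -sorted_pairwise ?iota_ltn_sorted //; last exact: ltn_trans.
split.
  rewrite !andbT; apply/allrelP => x y; rewrite mem_iota => /andP[_ xi] /(allP IH2)/andP[iy _].
  by apply: leq_trans iy; rewrite mulSn addnC; apply: leq_trans xi _; rewrite leq_add2l.
apply/andP; split; apply/allP => c.
  by rewrite mem_iota /= => /andP[-> ci]; nia.
by move=> /(allP IH2)/andP[ic ci] /=; rewrite (leq_trans _ ic) ?leq_mul2r ?leqnSn ?orbT //= addnS -addSn.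
Qed.

Lemma tape_cells_sorted : sorted ltn tape_cells.
Proof.
have [c1 c2] := cells_sorted 1 syms; rewrite sorted_pairwise; last exact: ltn_trans.
rewrite /tape_cells !pairwise_cat c1 -!sorted_pairwise ?iota_ltn_sorted //; try exact: ltn_trans.
rewrite /= !andbT; apply/andP; split; apply/allrelP => x y.
  rewrite mem_iota mem_cat => /andP[_ xN] /orP[/(allP c2)/andP[yN _]|].
    by move: xN yN; rewrite add0n mul1n; apply: leq_trans.
  by rewrite mem_iota mulSn => /andP[yN _]; move: xN; rewrite add0n => /leq_trans; apply; apply: leq_trans yN; rewrite leq_addr.
move=> /(allP c2)/andP[_ xJ]; rewrite mem_iota => /andP[yJ _].
by apply: leq_trans xJ yJ.
Qed.

Lemma size_tape_cells : (N + N < size tape_cells)%N.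
Proof.
rewrite /tape_cells !size_cat !size_iota size_map.
suff : (0 < size (cells 1 syms))%N by lia.
have [R R0] := htau; have Rs : R \in syms by rewrite mem_enum.
case E: syms Rs => [|R' Rs] // _.
by rewrite /= size_cat size_map size_lex_tuples ltn_addr // expn_gt0 n_gt0.
Qed.

Lemma bcellE u : bcell r u = (btag r u * N + btail r u)%N.
Proof.
rewrite /bcell /btag /btail; have -> : take K.+1 (drop K u) = take 1 (drop K u) ++ take K (drop K.+1 u).
  by have := takeD 1 K (drop K (val u)); rewrite drop_drop.
by rewrite lexi_cat size_sub //; rewrite /bsize; lia.
Qed.

Lemma btail_lt u : (btail r u < N)%N.
Proof.
by rewrite -[X in (_ < _ ^ X)%N](size_sub (b := b) (a := K.+1) u); [exact: lexi_bound | rewrite /bsize; lia].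
Qed.

Lemma btime_lt u : (btime r u < N)%N.
Proof.
by rewrite -[X in (_ < _ ^ X)%N](size_sub (b := b) (a := 0) u); [exact: lexi_bound | rewrite /bsize; lia].
Qed.

Lemma tag_tail i j x y : (x < N)%N -> (y < N)%N ->
  (i * N + x = j * N + y)%N -> i = j /\ x = y.
Proof.
move=> xN yN E; have N0 : (0 < N)%N by apply: leq_ltn_trans xN.
have ij : i = j.
  by have := congr1 (divn^~ N) E; rewrite !divnMDl // !divn_small // !addn0.
by split=> //; move: E; rewrite ij => /addnI.
Qed.

Lemma btail_split (R : sym tau) u : btail r u =
  (lexi r (take (K - arity R) (drop K.+1 u)) * n ^ arity R +
   lexi r (take (arity R) (drop (K.+1 + (K - arity R)) u)))%N.
Proof.
have RK := arity_le R; rewrite /btail -{1}(subnK RK) takeD drop_drop lexi_cat.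
rewrite [((K - arity R) + K.+1)%N]addnC.
by rewrite [size (take (arity R) _)]size_sub //; rewrite /bsize; lia.
Qed.

Lemma onth_syms (R : sym tau) k : onth syms k = Some R -> k = index R syms.
Proof. by move=> kR; have [_ ->] := onth_uniq (enum_uniq _) kR. Qed.

Lemma bpaddedP (R : sym tau) u : reflect
  (exists2 t : (arity R).-tuple A, bcell r u = ((index R syms).+1 * N + lexi r (val t))%N &
     tval t = take (arity R) (drop (K.+1 + (K - arity R)) u)) (bpadded r R u).
Proof.
have RK := arity_le R.
have sz : size (take (arity R) (drop (K.+1 + (K - arity R)) u)) == arity R.
  by rewrite size_sub //; rewrite /bsize; lia.
rewrite /bpadded bcellE (btail_split R); apply: (iffP andP) => [[/eqP-> /eqP->]|[t E tE]].
  by exists (Tuple sz).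
have tN : (lexi r t < N)%N.
  apply: leq_trans (expn_arity_le R); rewrite -[X in (_ < _ ^ X)%N](size_tuple t).
  exact: lexi_bound.
have := btail_lt u; rewrite (btail_split R) => bN; have [-> E2] := tag_tail bN tN E.
split=> //; move: E2; rewrite tE => /(congr1 (fun x => x - lexi r t)%N); rewrite tE addnK subnn => /eqP.
by rewrite muln_eq0 expn_eq0 (gtn_eqF n_gt0) /= orbF.
Qed.

Lemma mem_tape_cells u : (bcell r u \in tape_cells) = bis_cell r u.
Proof.
have uN := btail_lt u; rewrite /tape_cells !mem_cat !mem_iota /bis_cell.
have -> : (0 <= bcell r u < 0 + N)%N = (btag r u == 0%N) by rewrite bcellE; case: (btag r u) => [|t]; nia.
congr (_ || _); rewrite orbC; congr (_ || _).
  apply/idP/eqP => [|tE]; last by rewrite bcellE tE; lia.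
  by rewrite bcellE => /andP[h1 h2]; nia.
apply/idP/existsP => [/mapP[[c v] /cells_mem[k [R [t [kR cE vE]]]] /= uc]|[R /bpaddedP[t cE tE]]].
  exists R; rewrite add1n in cE; have kE := onth_syms kR.
  have tN : (lexi r t < N)%N.
    apply: leq_trans (expn_arity_le R); rewrite -[X in (_ < _ ^ X)%N](size_tuple t).
    exact: lexi_bound.
  have [E1 E2] := tag_tail uN tN (etrans (esym (bcellE u)) (etrans uc cE)).
  rewrite /bpadded E1 kE eqxx /=.
  have : (btail r u < n ^ arity R)%N.
    by rewrite E2 -[X in (_ < _ ^ X)%N](size_tuple t) lexi_bound.
  by rewrite (btail_split R); case: (lexi r (take (K - _) _)) => // m; nia.
have kR : onth syms (index R syms) = Some R by rewrite onth_index // mem_enum.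
have := mem_cells 1 t kR; rewrite add1n -cE => /(map_f fst); exact.
Qed.

Lemma nth_tape_cells_origin : nth 0%N tape_cells N = N.
Proof.
have [R R0] := htau; have Rs : R \in syms by rewrite mem_enum.
rewrite /tape_cells nth_cat size_iota ltnn subnn nth_cat.
case E: syms Rs => [|R' Rs] // _.
rewrite cells_fst size_cat size_iota ltn_addr ?expn_gt0 ?n_gt0 // nth_cat size_iota.
by rewrite expn_gt0 n_gt0 /= nth_iota ?expn_gt0 ?n_gt0 // addn0 mul1n.
Qed.

Lemma boriginE u : borigin r u = (bcell r u == nth 0%N tape_cells N).
Proof.
rewrite nth_tape_cells_origin /borigin bcellE; have := btail_lt u.
set x := btag r u; set y := btail r u => yN.
apply/andP/eqP => [[/eqP-> /eqP->]|E]; first by rewrite mul1n addn0.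
have N0 : (0 < N)%N by rewrite expn_gt0 n_gt0.
by have [-> ->] := @tag_tail x 1 y 0 yN N0 (ltac:(lia)).
Qed.

Lemma binitE u (a : work M) (p : int) : (`|p| < N)%N -> bcell r u = cellat N tape_cells p ->
  binit d r a u = (ctape (init M word) p == a).
Proof.
move=> pN; rewrite /cellat; have uN := btail_lt u.
have bits_size : size bits = size (cells 1 syms) by rewrite /bits -(cells_bits 1) size_map.
have blankE m : (m = 0 \/ m = (size syms).+1)%N -> btag r u = m -> binit d r a u = (blank M == a).
  move=> mE tagE; rewrite /binit tagE; have -> : (m == 0%N) || (m == (size syms).+1).
    by case: mE => ->; rewrite eqxx ?orbT.
  rewrite /= eq_sym; case: eqP => //= _; apply/negbTE/existsP => -[R /andP[/eqP mR _]].
  have iR : (index R syms < size syms)%N by rewrite index_mem mem_enum.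
  case: mE => mE; rewrite mE in mR; first by [].
  by case: mR => mR; rewrite -mR ltnn in iR.
case: p pN => [k|k] pN; last first.
  have -> : absz (N%:Z + Negz k)%R = (N - k.+1)%N by lia.
  rewrite /tape_cells nth_cat size_iota ifT; last by lia.
  rewrite nth_iota; last by lia.
  move=> cE; apply: (blankE 0%N); first by left.
  by rewrite bcellE in cE; case: (btag r u) cE => // t; nia.
have {}pN : (k < N)%N by lia.
have -> : absz (N%:Z + k)%R = (N + k)%N by lia.
rewrite /tape_cells nth_cat size_iota ltnNge leq_addr /= addKn nth_cat size_map /word -map_comp.
rewrite -bits_size; case: ltnP => ks cE; last first.
  rewrite [X in X == a]nth_default ?size_map //; apply: (blankE (size syms).+1); first by right.
  rewrite nth_iota in cE; last by lia.
  have xN : (k - size bits < N)%N by lia.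
  by have [] := tag_tail uN xN (etrans (esym (bcellE u)) cE).
have ks' : (k < size (cells 1 syms))%N by rewrite -bits_size.
rewrite (nth_map true) //; have -> : nth true bits k = (nth (0%N, true) (cells 1 syms) k).2.
  by rewrite /bits -(cells_bits 1) (nth_map (0%N, true)).
rewrite (nth_map (0%N, true)) // in cE.
have := mem_nth (0%N, true) ks'; case: (nth _ _ k) cE => c v /= cE /cells_mem[i [R [t [iR c'E ->]]]].
have iE := onth_syms iR; have RK := arity_le R.
have tN : (lexi r t < n ^ arity R)%N by rewrite -[X in (_ < _ ^ X)%N](size_tuple t) lexi_bound.
have [E1 E2] := tag_tail uN (leq_trans tN (expn_arity_le R)) (etrans (esym (bcellE u)) (etrans cE c'E)).
rewrite add1n iE in E1; rewrite (btail_split R) in E2.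
set t' := take (arity R) _ in E2.
have t'E : t' = t.
  have st : size t' = size t by rewrite size_tuple size_sub //; rewrite /bsize; lia.
  apply: (lexi_inj_seq r_all st).
  by case: (lexi r (take (K - _) _)) E2 => [|m]; nia.
have bitE : bbit R u = (t \in @interp _ A (Some R)).
  rewrite /bbit -/t' t'E; apply/existsP/idP => [[t1 /andP[t1R /eqP/val_inj <-]] //|tR].
  by exists t; rewrite tR eqxx.
rewrite /binit E1 /= eqSS ltn_eqF ?index_mem ?mem_enum //=.
have -> : [exists R0, ((index R syms).+1 == (index R0 syms).+1) &&
     (bbit R0 u && (a == emb M (d true)) || ~~ bbit R0 u && (a == emb M (d false)))] =
     (bbit R u && (a == emb M (d true)) || ~~ bbit R u && (a == emb M (d false))).
  apply/existsP/idP => [[R0 /andP[/eqP[iR0] H]]|H]; last by exists R; rewrite eqxx.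
  suff -> : R = R0 by [].
  by rewrite -(nth_index R (s := syms) (x := R)) ?mem_enum // iR0 nth_index // mem_enum.
by rewrite bitE eq_sym; case: (t \in _); rewrite /= ?orbF // eq_sym.
Qed.

Definition bev u : option tr := onth (enum {: tr}) (bevent_index r u).

Lemma bevE e u : bevent r e u = (bev u == Some e).
Proof.
rewrite /bevent /bev; apply/eqP/eqP => [->|]; first by rewrite onth_index // mem_enum.
by move=> /(onth_uniq (enum_uniq _))[_ ->].
Qed.

Lemma block_split u : val u = take K (drop 0 u) ++ take K.+1 (drop K u) ++ take 1 (drop (K + K.+1) u).
Proof.
have -> : (K + K.+1 = K.+1 + K)%N by rewrite addnC.
rewrite -drop_drop [take 1 _]take_oversize ?cat_take_drop ?drop0 ?cat_take_drop //.
by rewrite !size_drop size_tuple /bsize; lia.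
Qed.

Lemma block_inj u v e : btime r u = btime r v -> bcell r u = bcell r v ->
  bev u = Some e -> bev v = Some e -> u = v.
Proof.
move=> uv1 uv2 ue ve; apply: val_inj; rewrite [LHS]block_split [RHS]block_split.
have sz a l : (a + l <= b)%N -> size (take l (drop a u)) = size (take l (drop a v)).
  by move=> alb; rewrite !size_sub.
have [_ eu] := onth_uniq (enum_uniq _) ue; have [_ ev] := onth_uniq (enum_uniq _) ve.
congr (_ ++ (_ ++ _)); apply: (lexi_inj_seq r_all) => //.
- by apply: sz; rewrite /bsize; lia.
- by apply: sz; rewrite /bsize; lia.
- by apply: sz; rewrite /bsize; lia.
- by rewrite -[LHS]/(bevent_index r u) -eu ev.
Qed.

Lemma tape_cells_lt c : c \in tape_cells -> (c < n ^ K.+1)%N.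
Proof.
have nN : ((size syms).+2 * N <= n ^ K.+1)%N by rewrite expnS leq_mul2r; apply/orP; right; lia.
rewrite /tape_cells !mem_cat !mem_iota => cL; apply: leq_trans nN.
have [_ /allP cells_lt] := cells_sorted 1 syms.
case/or3P: cL => [|/cells_lt|]; move=> /andP[_]; [nia| |nia].
by move=> /leq_trans; apply; rewrite add1n leq_mul2r leqnSn orbT.
Qed.

Lemma block_surj i c e : (i < N)%N -> c \in tape_cells ->
  exists u, [/\ btime r u = i, bcell r u = c & bev u = Some e].
Proof.
move=> iN cL; have [s1 s1E] := lexi_surj r_uniq iN.
have [s2 s2E] := lexi_surj r_uniq (tape_cells_lt cL).
have en : (index e (enum {: tr}) < n ^ 1)%N.
  by rewrite expn1; apply: leq_trans n_tr; rewrite cardE index_mem mem_enum.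
have [s3 s3E] := lexi_surj r_uniq en.
have sz : size (s1 ++ s2 ++ s3) == b by rewrite !size_cat !size_tuple /bsize addn1.
have d1 : drop K (s1 ++ s2 ++ s3) = s2 ++ s3.
  by rewrite drop_cat size_tuple ltnn subnn drop0.
exists (Tuple sz); split.
- by rewrite /btime /= drop0 take_cat size_tuple ltnn subnn take0 cats0.
- by rewrite /bcell [tval _]/= d1 take_cat size_tuple ltnn subnn take0 cats0.
- rewrite /bev /bevent_index [tval _]/= addnC -drop_drop d1 drop_cat size_tuple ltnn subnn drop0.
  by rewrite take_oversize ?size_tuple // s3E onth_index ?mem_enum.
Qed.

Definition bgraph (es : seq tr) : {set b.-tuple A} :=
  graph (btime r) (bcell r) bev N tape_cells es.

Lemma bchiE (G : {set b.-tuple A}) : bchi M d r G =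
  chi (btime r) (bcell r) (fun e u => bev u == Some e) (bis_cell r) (borigin r)
    (binit d r) G.
Proof.
rewrite /bchi; congr (chi _ _ _ _ _ _ _); apply/funext => e; apply/funext => u.
exact: bevE.
Qed.

Lemma is_cellE u : bis_cell r u = (bcell r u \in tape_cells).
Proof. by rewrite mem_tape_cells. Qed.

Lemma bchiP (G : {set b.-tuple A}) :
  bchi M d r G -> exists2 es, (size es <= N)%N & accepting (M := M) word es /\ G = bgraph es.
Proof.
rewrite bchiE => H; have [es esN GE] := chi_shape btime_lt block_inj block_surj
  tape_cells_sorted (leqnn N) size_tape_cells is_cellE boriginE H.
exists es => //; split=> //; rewrite GE in H.
exact: (chi_accepting btime_lt block_surj tape_cells_sorted (leqnn N) size_tape_cells
  binitE esN H).
Qed.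

Lemma bgraph_chi es : (size es <= N)%N -> accepting (M := M) word es -> bchi M d r (bgraph es).
Proof.
move=> esN acc; rewrite bchiE.
exact: (accepting_chi btime_lt block_inj block_surj tape_cells_sorted (leqnn N) size_tape_cells
  is_cellE boriginE binitE esN acc).
Qed.

Lemma bgraph_inj es es' : (size es <= N)%N -> (size es' <= N)%N -> bgraph es = bgraph es' ->
  es = es'.
Proof.
exact: (graph_inj block_surj tape_cells_sorted (leqnn N) size_tape_cells).
Qed.

End Instance.

Section GraphWeights.
Variables (S : pzSemiRingType) (tau : vocabulary) (Sigma : finType) (M : wtm S Sigma).
Variables (d : bool -> Sigma) (K : nat).
Hypothesis arity_le : forall R : sym tau, (arity R <= K)%N.
Hypothesis htau : exists R : sym tau, (0 < arity R)%N.
Local Notation tr := (transition (state M) (work M)).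
Local Notation syms := (enum (sym tau)).
Local Notation b := (bsize K).
Variables (A : structure (with_lt tau)) (r : seq A).
Hypothesis Ar : enumerates r.
Local Notation n := (size r).
Hypothesis n_syms : (size syms + 2 <= n)%N.
Hypothesis n_tr : (#|{: tr}| <= n)%N.
Local Notation N := (n ^ K)%N.

Let r_uniq : uniq r. Proof. by case: Ar. Qed.
Let r_all a : a \in r. Proof. by case: Ar. Qed.

Definition bweight (G : {set b.-tuple A}) (u : b.-tuple A) : S :=
  if u \in G then oapp (@weight _ _ M) 0 (bev M r u) else 1.

Lemma lexi_btime (u v : b.-tuple A) : (lexi r u < lexi r v)%N -> (btime r u <= btime r v)%N.
Proof.
have E (x : b.-tuple A) : lexi r x = (btime r x * n ^ K.+2 + lexi r (drop K x))%N.
  rewrite /btime drop0 -{1}(cat_take_drop K x) lexi_cat; congr (_ * _ ^ _ + _)%N.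
  by rewrite size_drop size_tuple /bsize addKn.
have lt (x : b.-tuple A) : (lexi r (drop K x) < n ^ K.+2)%N.
  have -> : K.+2 = size (drop K x) by rewrite size_drop size_tuple /bsize addKn.
  exact: lexi_bound.
rewrite !E; have := lt u; have := lt v; nia.
Qed.

Lemma bgraph_events (es : seq tr) : (size es <= N)%N ->
  [seq bev M r u | u <- lex_tuples r b & u \in bgraph (M := M) K r es] = map Some es.
Proof.
move=> esN; set F := filter _ _.
have FG u : u \in F -> u \in bgraph (M := M) K r es by rewrite mem_filter => /andP[].
have evF u : u \in F -> bev M r u = onth es (btime r u).
  by move=> /FG /graphP[e [-> -> _]].
have pF : pairwise (fun u v : b.-tuple A => lexi r u < lexi r v)%N F.
  apply: (subseq_pairwise (filter_subseq _ _)).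
  have : pairwise ltn [seq lexi r (val t) | t <- lex_tuples r b].
    by rewrite lexi_lex_tuples // -sorted_pairwise ?iota_ltn_sorted //; exact: ltn_trans.
  by rewrite pairwise_map.
have timeF : map (btime r) F = iota 0 (size es).
  apply: (irr_sorted_eq ltn_trans ltnn); rewrite ?iota_ltn_sorted //.
    rewrite sorted_pairwise; last exact: ltn_trans.
    rewrite pairwise_map; elim: (F) FG pF => //= u s IH sG /andP[us ps].
    rewrite IH // ?andbT; last by move=> v vs; apply: sG; rewrite in_cons vs orbT.
    apply/allP => v vs; rewrite /= ltn_neqAle lexi_btime ?andbT; last exact: (allP us).
    have /graphP[e [ue ie uc]] := sG u (mem_head _ _).
    have /graphP[e' [ve ie' vc]] : v \in bgraph (M := M) K r es by apply: sG; rewrite in_cons vs orbT.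
    apply/eqP => uv; have := allP us _ vs; rewrite /= (_ : u = v) ?ltnn //.
    by apply: (block_inj Ar n_syms n_tr uv _ ue); [rewrite uc vc uv | rewrite ve -ie' -uv].
  move=> i; rewrite mem_iota add0n /=; apply/mapP/idP => [[u /FG/graphP[e [_ ie _]] ->]|/onth_lt[e ie]].
    by rewrite -onthTE ie.
  have [u [uG ui _]] := graph_event (block_surj arity_le Ar n_syms n_tr) (tape_cells_sorted arity_le Ar n_syms n_tr) (leqnn _) (size_tape_cells K htau Ar n_syms n_tr) esN ie.
  exists u => //; rewrite mem_filter uG mem_lex_tuples; apply/allP => a _; exact: r_all.
transitivity [seq onth es i | i <- map (btime r) F].
  by rewrite -map_comp; apply/eq_in_map => u /evF.
rewrite timeF; apply: eq_from_onth => i; rewrite !onth_map.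
case: (ltnP i (size es)) => ies; last by rewrite !onth_default ?size_iota.
by rewrite onthE (nth_map 0%N) ?size_iota // nth_iota //= add0n; have [e ->] := onth_lt ies.
Qed.

Lemma bweight_graph (es : seq tr) : (size es <= N)%N ->
  \prod_(u <- lex_tuples r b) bweight (bgraph (M := M) K r es) u = comp_weight es.
Proof.
move=> esN; rewrite /bweight -big_mkcond -big_filter.
rewrite -(big_map (bev M r) xpredT (oapp (@weight _ _ M) 0)) /= bgraph_events //.
by rewrite big_map.
Qed.

Lemma sum_graphs x : is_behavior M (word d r) x ->
  (forall es, accepting (M := M) (word d r) es -> (size es <= N)%N) ->
  \sum_(G : {set b.-tuple A})
    (if bchi M d r G then 1 else 0) * \prod_(u <- lex_tuples r b) bweight G u = x.
Proof.
move=> [s [us sP ->]] szP.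
pose F (G : {set b.-tuple A}) := \prod_(u <- lex_tuples r b) bweight G u.
transitivity (\sum_(G | bchi M d r G) F G).
  by rewrite [RHS]big_mkcond; apply: eq_bigr => G _; case: ifP => _; rewrite ?mul1r ?mul0r.
have sN es : es \in s -> (size es <= N)%N by rewrite sP => /szP.
rewrite -big_filter (perm_big (map (bgraph (M := M) K r) s)) /=.
  rewrite big_map big_seq [RHS]big_seq; apply: eq_bigr => es /sN; exact: bweight_graph.
apply: uniq_perm; first by rewrite filter_uniq // index_enum_uniq.
  rewrite map_inj_in_uniq // => es es' /sN esN /sN esN'; exact: bgraph_inj.
move=> G; rewrite mem_filter mem_index_enum andbT; apply/idP/mapP => [|[es ess ->]].
  move=> /(bchiP arity_le htau Ar n_syms n_tr)[es esN [acc GE]]; exists es => //.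
  by rewrite sP.
by apply: bgraph_chi => //; [exact: sN | move: ess; rewrite sP].
Qed.

End GraphWeights.

Lemma lex_tuples_map (T U : Type) (f : T -> U) (r : seq T) k :
  lex_tuples (map f r) k = [seq map_tuple f t | t <- lex_tuples r k].
Proof.
elim: k => [|k IH] /=; first by congr [:: _]; apply: val_inj.
rewrite IH allpairs_mapl allpairs_mapr map_allpairs.
by congr flatten; apply: eq_map => a; apply: eq_map => t; apply: val_inj.
Qed.

Lemma map_index_self (T : eqType) (r : seq T) : uniq r -> map (index^~ r) r = iota 0 (size r).
Proof.
move=> ur; apply: eq_from_onth => i; rewrite onth_map.
case: (ltnP i (size r)) => ir; last by rewrite !onth_default ?size_iota.
have [a ia] := onth_lt ir; have [_ aE] := onth_uniq ur ia.
by rewrite ia onthE (nth_map 0%N) ?size_iota // nth_iota //= aE.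
Qed.

Section SmallStructures.
Variables (S : pzSemiRingType) (tau : vocabulary).
Local Notation bf := (bformula (with_lt tau)).
Local Notation wf := (wformula S (with_lt tau)).
Local Notation syms := (enum (sym tau)).

Definition size_ge (m : nat) : bf :=
  if m is q.+1 then BEx 0 (rank_is tau q 0) else BNot (BFalse _).

Definition size_is (m : nat) : bf := BAnd (size_ge m) (BNot (size_ge m.+1)).

Lemma size_ge_fo m : bfirst_order (size_ge m).
Proof. by case: m => // q; exact: rank_is_fo. Qed.

Lemma size_ge_closed m V W : bclosed V W (size_ge m).
Proof. by case: m => // q /=; apply: rank_is_closed; rewrite mem_head. Qed.

Fixpoint ranks_are (ms xs : seq nat) : bf :=
  if (ms, xs) is (m :: ms', x :: xs') then BAnd (rank_is tau m x) (ranks_are ms' xs')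
  else BNot (BFalse _).

(* The atom [R t] for the tuple [t] of the elements of ranks [ms]. *)
Definition bit_formula (R : sym tau) (ms : (arity R).-tuple nat) : bf :=
  foldr (@BEx _) (BAnd (ranks_are ms (iota 0 (arity R)))
    (@BRel (with_lt tau) (Some R) (iota_tuple (arity R) 0))) (iota 0 (arity R)).

Definition bit_formulas (m : nat) : seq bf :=
  flatten [seq [seq bit_formula ms | ms <- lex_tuples (iota 0 m) (arity R)] | R <- syms].

Fixpoint decision (F : seq bool -> S) (fs : seq bf) (acc : seq bool) : wf :=
  if fs is f :: fs' then
    WAdd (WMul (WBool S f) (decision F fs' (rcons acc true)))
      (WMul (WBool S (BNot f)) (decision F fs' (rcons acc false)))
  else WConst _ (F acc).

Lemma ranks_are_fo ms xs : bfirst_order (ranks_are ms xs).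
Proof. by elim: ms xs => [|m ms IH] [|x xs] //=; rewrite rank_is_fo IH. Qed.

Lemma ranks_are_closed ms xs V W : all (mem V) xs -> bclosed V W (ranks_are ms xs).
Proof.
elim: ms xs => [|m ms IH] [|x xs] //= /andP[xV xsV].
by rewrite rank_is_closed //= IH.
Qed.

Lemma exs_closed xs (f : bf) V W : bclosed (V ++ xs) W f -> bclosed V W (foldr (@BEx _) f xs).
Proof.
elim: xs V => [|x xs IH] V /=; first by rewrite cats0.
move=> cl; apply: IH; apply: bclosed_sub cl => // y; rewrite !(mem_cat, inE).
by case/or3P => ->; rewrite ?orbT.
Qed.

Lemma exs_fo xs (f : bf) : bfirst_order f -> bfirst_order (foldr (@BEx _) f xs).
Proof. by elim: xs. Qed.

Lemma all_bit_formulas (p : pred bf) m :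
  (forall (R : sym tau) ms, p (@bit_formula R ms)) -> all p (bit_formulas m).
Proof.
move=> H; rewrite /bit_formulas; elim: syms => //= R Rs IH; rewrite all_cat IH andbT.
by elim: (lex_tuples _ _) => //= ms s ->; rewrite H.
Qed.

Lemma bit_formula_fo (R : sym tau) (ms : (arity R).-tuple nat) : bfirst_order (bit_formula ms).
Proof. by apply: exs_fo; rewrite /= ranks_are_fo. Qed.

Lemma bit_formula_closed (R : sym tau) (ms : (arity R).-tuple nat) V W : bclosed V W (bit_formula ms).
Proof.
have sub : all (mem (V ++ iota 0 (arity R))) (iota 0 (arity R)).
  by apply/allP => x; rewrite inE mem_cat orbC => ->.
by apply: exs_closed; rewrite /= ranks_are_closed.
Qed.

Lemma decision_fo F fs acc : all (@bfirst_order _) fs -> wfirst_order (decision F fs acc).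
Proof. by elim: fs acc => //= f fs IH acc /andP[ff fsf]; rewrite ff !IH. Qed.

Lemma decision_closed F fs acc V W : all (bclosed V W) fs -> wclosed V W (decision F fs acc).
Proof. by elim: fs acc => //= f fs IH acc /andP[ff fsf]; rewrite ff !IH. Qed.

Section Sem.
Variables (A : structure (with_lt tau)) (r : seq A).
Hypothesis Ar : enumerates r.
Implicit Types (rho : nat -> option A) (eta : so_assignment A).

Let r_uniq : uniq r. Proof. by case: Ar. Qed.
Let r_all a : a \in r. Proof. by case: Ar. Qed.

Lemma bsem_size_ge rho eta m : bsem rho eta (size_ge m) = (m <= size r)%N.
Proof.
case: m => // q; have E a : bsem [eta rho with 0%N |-> Some a] eta (rank_is tau q 0) = (index a r == q).
  exact: bsem_rank_is.
rewrite -[LHS]/[exists a, bsem [eta rho with 0%N |-> Some a] eta (rank_is tau q 0)].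
apply/existsP/idP => [[a]|qr].
  by rewrite E => /eqP<-; rewrite index_mem.
by have [a qa] := onth_lt qr; exists a; rewrite E; have [_ ->] := onth_uniq r_uniq qa.
Qed.

Lemma bsem_size_is rho eta m : bsem rho eta (size_is m) = (size r == m).
Proof.
have E : bsem rho eta (BNot (size_ge m.+1)) = ~~ (m < size r)%N.
  by rewrite -(bsem_size_ge rho eta).
by rewrite bsem_and E bsem_size_ge -leqNgt -eqn_leq eq_sym.
Qed.

Lemma bsem_ranks_are rho eta ms xs s : map rho xs = map Some s -> size ms = size s ->
  bsem rho eta (ranks_are ms xs) = (map (index^~ r) s == ms).
Proof.
elim: ms xs s => [|m ms IH] [|x xs] [|a s] // [xa xs_s] [ss].
rewrite -[ranks_are _ _]/(BAnd (rank_is tau m x) (ranks_are ms xs)) bsem_and.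
by rewrite (bsem_rank_is Ar _ _ xa) (IH _ _ xs_s ss) /= eqseq_cons.
Qed.

Lemma bsem_bit_formula rho eta (R : sym tau) (t : (arity R).-tuple A) :
  bsem rho eta (bit_formula (map_tuple (index^~ r) t)) = (t \in @interp _ A (Some R)).
Proof.
rewrite (@bsem_exs _ A _ _ _ (arity R)) ?size_iota //.
have xE (u : (arity R).-tuple A) : map (upd rho (iota 0 (arity R)) u) (iota 0 (arity R)) = map Some u.
  by rewrite map_upd ?iota_uniq // size_iota size_tuple.
have E (u : (arity R).-tuple A) : bsem (upd rho (iota 0 (arity R)) u) eta
   (BAnd (ranks_are (map_tuple (index^~ r) t) (iota 0 (arity R)))
    (@BRel (with_lt tau) (Some R) (iota_tuple (arity R) 0))) = (u == t) && (u \in @interp _ A (Some R)).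
  rewrite bsem_and (bsem_ranks_are _ (xE u)) ?size_map ?size_tuple //.
  rewrite [bsem _ _ (BRel _)](@exists_tupleE _ _ _ _ _ u) //.
  congr (_ && _); apply/eqP/eqP => [|->//] /(inj_map _) H; apply/val_inj/H.
  exact: index_enumerates_inj.
apply/existsP/idP => [[u]|tR]; first by rewrite E => /andP[/eqP->].
by exists t; rewrite E eqxx.
Qed.

Lemma bsem_bit_formulas rho eta : map (bsem rho eta) (bit_formulas (size r)) = bits r.
Proof.
rewrite /bit_formulas /bits map_flatten -map_comp; congr flatten; apply: eq_map => R /=.
rewrite -map_comp -(map_index_self r_uniq) lex_tuples_map -map_comp; apply: eq_map => t /=.
exact: bsem_bit_formula.
Qed.

Lemma wsem_decision rho eta F fs acc :
  wsem r rho eta (decision F fs acc) = F (acc ++ map (bsem rho eta) fs).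
Proof.
elim: fs acc => [|f fs IH] acc /=; first by rewrite cats0.
by rewrite !IH !cat_rcons; case: bsem; rewrite /= ?mul1r ?mul0r ?addr0 ?add0r.
Qed.

Lemma wsem_adds rho eta (T : Type) (F : T -> wf) x s :
  wsem r rho eta (foldr (@WAdd S _) x [seq F i | i <- s]) =
  \sum_(i <- s) wsem r rho eta (F i) + wsem r rho eta x.
Proof. by elim: s => [|i s IH] /=; rewrite ?big_nil ?add0r // big_cons IH addrA. Qed.

End Sem.

Lemma adds_fo (T : eqType) (F : T -> wf) x s : (forall i, i \in s -> wfirst_order (F i)) ->
  wfirst_order x -> wfirst_order (foldr (@WAdd S _) x [seq F i | i <- s]).
Proof.
move=> H xf; elim: s H => //= i s IH H; rewrite H ?mem_head ?IH // => j js.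
by apply: H; rewrite inE js orbT.
Qed.

Lemma adds_closed (T : eqType) (F : T -> wf) x s V W : (forall i, i \in s -> wclosed V W (F i)) ->
  wclosed V W x -> wclosed V W (foldr (@WAdd S _) x [seq F i | i <- s]).
Proof.
move=> H xf; elim: s H => //= i s IH H; rewrite H ?mem_head ?IH // => j js.
by apply: H; rewrite inE js orbT.
Qed.

End SmallStructures.

Section Growth.
Variable tau : vocabulary.

Lemma code_length_poly : exists J a, (forall R : sym tau, (arity R <= a)%N) /\
  forall m, (0 < m)%N -> (code_length tau m <= J * m ^ a)%N.
Proof.
exists #|sym tau|, (\max_(R : sym tau) arity R)%N; split=> [R|m m0]; first exact: leq_bigmax.
rewrite code_lengthE -sum_nat_const leq_sum // => R _.
by rewrite leq_pexp2l // (leq_bigmax R).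
Qed.

Lemma time_bound (T : nat -> nat) (c k N0 : nat)
    (htau : exists R : sym tau, (0 < arity R)%N) :
  (forall m, (N0 <= m)%N -> (T m <= c * m ^ k)%N) ->
  exists K n0, (forall R : sym tau, (arity R <= K)%N) /\
    forall n, (n0 <= n)%N -> (T (code_length tau n) <= n ^ K)%N.
Proof.
move=> HT; have [J [a [aR Ja]]] := code_length_poly.
exists (a + (a * k).+1)%N, (N0 + c * J ^ k + 1)%N; split=> [R|n nn0].
  exact: leq_trans (aR R) (leq_addr _ _).
have n_gt0 : (0 < n)%N by lia.
have mN0 : (N0 <= code_length tau n)%N by apply: leq_trans (leq_code_length htau n); lia.
apply: leq_trans (HT _ mN0) _.
apply: (@leq_trans (c * (J * n ^ a) ^ k)); first by rewrite leq_mul2l leq_wexp2r ?orbT ?Ja.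
rewrite expnMn -expnM mulnA; apply: (@leq_trans (n ^ (a * k).+1)).
  by rewrite expnS leq_mul2r; apply/orP; right; lia.
by rewrite leq_pexp2l // leq_addl.
Qed.

End Growth.

Lemma wclosed_sub (S : pzSemiRingType) (tau : vocabulary) (f : wformula S tau) V V' W W' :
  {subset V <= V'} -> {subset W <= W'} -> wclosed V W f -> wclosed V' W' f.
Proof.
elim: f V V' W W' => [f|x|f IHf g IHg|f IHf g IHg|x f IH|x f IH|X f IH|X f IH] V V' W W' VV WW //=.
- exact: bclosed_sub.
- by case/andP => /(IHf _ _ _ _ VV WW)-> /(IHg _ _ _ _ VV WW)->.
- by case/andP => /(IHf _ _ _ _ VV WW)-> /(IHg _ _ _ _ VV WW)->.
- by apply: IH => // y; rewrite !inE => /orP[->|/VV->]; rewrite ?orbT.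
- by apply: IH => // y; rewrite !inE => /orP[->|/VV->]; rewrite ?orbT.
- by apply: IH => // Y; rewrite !inE => /orP[->|/WW->]; rewrite ?orbT.
- by apply: IH => // Y; rewrite !inE => /orP[->|/WW->]; rewrite ?orbT.
Qed.

Section Assembly.
Variables (S : pzSemiRingType) (tau : vocabulary).
Local Notation wf := (wformula S (with_lt tau)).
Local Notation syms := (enum (sym tau)).

Section WeightFormula.
Variables (Sigma : finType) (M : wtm S Sigma) (K : nat).
Local Notation tr := (transition (state M) (work M)).
Local Notation b := (bsize K).

(* Multiplied over all blocks in lexicographic order, hence in the order of the
   times, this yields the weight of the computation coded by [Xb]. *)
Lemma weight_formula : exists f : wf,
  [/\ wfirst_order f, wclosed (vars b 0) [:: Xb b] f &
    forall (A : structure (with_lt tau)) (r : seq A) (u : b.-tuple A) (G : {set b.-tuple A}) rho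
        (eta : so_assignment A),
      enumerates r -> map rho (vars b 0) = map Some u -> eta (Xb b) = G ->
      wsem r rho eta f = bweight M r G u].
Proof.
have [f0 [f0_fo f0_cl f0_sem]] := def_not (def_mem tau b (isT : (0 < 1)%N)).
have /choice[f f_ok] : forall e : tr, exists f : bformula (with_lt tau),
    [/\ bfirst_order f, bclosed (iota 0 (1 * b)) [:: Xb b] f &
      forall (A : structure (with_lt tau)) (r : seq A) (bl : nat -> b.-tuple A) (G : {set b.-tuple A})
          (rho : nat -> option A) (eta : so_assignment A),
        enumerates r -> (forall i, (i < 1)%N -> map rho (vars b i) = map Some (bl i)) ->
        eta (Xb b) = G -> bsem rho eta f = (bl 0%N \in G) && bevent r e (bl 0%N)].
  move=> e; exact: (def_and (def_mem tau b (isT : (0 < 1)%N)) (def_bevent tau K (isT : (0 < 1)%N) e)).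
rewrite mul1n in f0_cl f_ok.
exists (foldr (@WAdd S _) (WBool S f0)
  [seq WMul (WBool S (f e)) (WConst _ (weight e)) | e <- enum {: tr}]); split.
- by apply: adds_fo => // e _; have [fo _ _] := f_ok e; rewrite /= fo.
- by apply: adds_closed => // e _; have [_ cl _] := f_ok e; rewrite /= cl.
- move=> A r u G rho eta Ar uE GE; rewrite wsem_adds /=.
  have blE i : (i < 1)%N -> map rho (vars b i) = map Some ((fun=> u) i) by case: i.
  rewrite (f0_sem A r (fun=> u) G rho eta Ar blE GE) /bweight.
  have E e : bsem rho eta (f e) = (u \in G) && (bev M r u == Some e).
    by have [_ _ sem] := f_ok e; rewrite (sem A r (fun=> u) G rho eta Ar blE GE) bevE.
  under eq_bigr do rewrite E.
  case uG: (u \in G) => /=; last by rewrite big1 ?add0r // => e _; rewrite mul0r.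
  rewrite addr0; case ue: (bev M r u) => [e|] /=; last by rewrite big1 // => e _; rewrite mul0r.
  rewrite (bigD1_seq e) ?mem_enum ?enum_uniq //= eqxx mul1r big1 ?addr0 // => e' ne.
  by rewrite (inj_eq Some_inj) eq_sym (negPf ne) mul0r.
Qed.

End WeightFormula.

Definition no_tuple (b : nat) : bformula (with_lt tau) :=
  BNot (foldr (@BEx _) (@BVar (with_lt tau) (Xb b) (iota_tuple b 0)) (iota 0 b)).

Lemma bsem_no_tuple (A : structure (with_lt tau)) rho (eta : so_assignment A) b :
  bsem rho eta (no_tuple b) = (eta (Xb b) == set0 :> {set b.-tuple A}).
Proof.
have E : bsem rho eta (foldr (@BEx _) (@BVar (with_lt tau) (Xb b) (iota_tuple b 0)) (iota 0 b)) =
    [exists t : b.-tuple A, t \in eta (Xb b)].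
  rewrite (@bsem_exs _ A _ _ _ b) ?size_iota //; apply: eq_existsb => t.
  apply: (@exists_tupleE _ b _ _ (iota_tuple b 0)).
  by rewrite map_upd ?iota_uniq // size_iota size_tuple.
rewrite -[LHS]/(~~ bsem rho eta (foldr (@BEx _) (@BVar (with_lt tau) (Xb b) (iota_tuple b 0)) (iota 0 b))) E.
rewrite negb_exists; apply/forallP/eqP => [H|-> t]; last by rewrite inE.
by apply/setP => t; rewrite inE; apply/negbTE.
Qed.

Lemma no_tuple_closed b V : bclosed V [:: Xb b] (no_tuple b).
Proof.
apply: exs_closed; rewrite /= mem_head /=.
by apply/allP => x; rewrite inE mem_cat orbC => ->.
Qed.

Theorem NP_wESO (htau : exists R : sym tau, (0 < arity R)%N) (Sigma : finType)
    (d : bool -> Sigma) (P : seq Sigma -> S) : NP P ->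
  exists b (psi : wf), [/\ wfirst_order psi, wclosed [::] [:: Xb b] psi &
    forall (A : structure (with_lt tau)) (r : seq A), enumerates r ->
      value_along r (WSumSO (Xb b) psi) = P (word d r)].
Proof.
move=> [M [_ [k [T [timeT [c [N0 HT]]]]] HP]].
have [K [n1 [arity_le TK]]] := time_bound htau HT.
pose n0 := (n1 + (size syms + 2) + #|{: transition (state M) (work M)}|)%N.
pose b := bsize K; exists b.
have [fw [fw_fo fw_cl fw_sem]] := weight_formula M K.
have [fchi [chi_fo chi_cl chi_sem]] := def_bchi M d arity_le.
pose small := foldr (@WAdd S _) (WConst (with_lt tau) 0)
  [seq WMul (WBool S (BAnd (size_is tau m) (no_tuple b)))
     (decision (fun u => P (map d u)) (bit_formulas tau m) [::]) | m <- iota 0 n0].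
pose big := WMul (WBool S (size_ge tau n0))
  (WMul (WBool S fchi) (foldr (@WProd S _) fw (vars b 0))).
exists (WAdd small big); split.
- rewrite /= size_ge_fo chi_fo /= andbC; apply/andP; split; first by elim: (vars b 0).
  apply: adds_fo => // m _; apply/andP; split; last first.
    exact/decision_fo/all_bit_formulas/bit_formula_fo.
  have fo1 : bfirst_order (size_is tau m) by apply/andP; split; [exact: (size_ge_fo tau m) | exact: (size_ge_fo tau m.+1)].
  have fo2 : bfirst_order (no_tuple b) by exact: (@exs_fo tau (iota 0 b)).
  by apply/andP.
- rewrite /= size_ge_closed chi_cl /= andbC; apply/andP; split.
    have H V W xs (f : wf) : wclosed (rev xs ++ V) W f -> wclosed V W (foldr (@WProd S _) f xs).
      elim: xs V => //= x xs IH V; rewrite rev_cons cat_rcons; exact: IH.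
    apply: H; rewrite cats0; apply: wclosed_sub fw_cl => // x; by rewrite mem_rev.
  apply: adds_closed => // m _; apply/andP; split; last first.
    by apply/decision_closed/all_bit_formulas => R ms; exact: bit_formula_closed.
  have cl1 : bclosed [::] [:: Xb b] (size_is tau m) by apply/andP; split; [exact: (size_ge_closed tau m) | exact: (size_ge_closed tau m.+1)].
  by apply/andP; split=> //; exact: no_tuple_closed.
- move=> A r Ar; rewrite /value_along [wsem _ _ _ _]/=.
  pose eta (G : {set b.-tuple A}) : so_assignment A :=
    dfwith (T := fun X : sovar => {set (ar X).-tuple A}) (fun=> set0) (i := Xb b) G.
  have etaE G : eta G (Xb b) = G by exact: dfwith_in.
  have smallE G : wsem r (fun=> None) (eta G) small =
      if (size r < n0)%N && (G == set0) then P (word d r) else 0.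
    rewrite wsem_adds [wsem _ _ _ (WConst _ _)]/= addr0.
    have E m : wsem r (fun=> None) (eta G) (WMul (WBool S (BAnd (size_is tau m) (no_tuple b)))
        (decision (fun u => P (map d u)) (bit_formulas tau m) [::])) =
        if (size r == m) && (G == set0) then P (word d r) else 0.
      rewrite -[LHS]/((if bsem (fun=> None) (eta G) (BAnd (size_is tau m) (no_tuple b)) then 1 else 0) *
        wsem r (fun=> None) (eta G) (decision (fun u => P (map d u)) (bit_formulas tau m) [::])).
      rewrite bsem_and (bsem_size_is Ar) bsem_no_tuple etaE; case: eqP => [<-|_] /=; last by rewrite mul0r.
      by case: eqP => _; rewrite ?mul0r // mul1r wsem_decision /= (bsem_bit_formulas Ar).
    under eq_bigr do rewrite E.
    case: ltnP => [rn|rn] /=; last first.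
      rewrite big_seq big1 // => m; rewrite mem_iota add0n => /andP[_ mn].
      by rewrite gtn_eqF //; apply: leq_trans rn.
    rewrite (bigD1_seq (size r)) ?mem_iota ?iota_uniq //= eqxx /= big1 ?addr0 // => m ne.
    by rewrite eq_sym (negPf ne).
  have bigE G : wsem r (fun=> None) (eta G) big =
      if (n0 <= size r)%N then (if bchi M d r G then 1 else 0) * \prod_(u <- lex_tuples r b) bweight M r G u else 0.
    rewrite -[LHS]/((if bsem (fun=> None) (eta G) (size_ge tau n0) then 1 else 0) *
      ((if bsem (fun=> None) (eta G) fchi then 1 else 0) *
       wsem r (fun=> None) (eta G) (foldr (@WProd S _) fw (vars b 0)))).
    rewrite (bsem_size_ge Ar); case: leqP => [rn|_]; rewrite ?mul0r // mul1r.
    have r0 : (0 < size r)%N by move: rn; rewrite /n0; lia.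
    have [a0 _] := onth_lt r0.
    have -> : bsem (fun=> None) (eta G) fchi = bchi M d r G.
      by apply: (chi_sem A r (fun=> [tuple of nseq b a0])).
    rewrite (wsem_prods _ _ _ _ (k := b)) ?size_iota //; congr (_ * _); apply: eq_bigr => u _.
    apply: fw_sem => //; rewrite map_upd ?iota_uniq // size_iota size_tuple //.
  rewrite -[LHS]/(\sum_(G : {set b.-tuple A}) (wsem r (fun=> None) (eta G) small + wsem r (fun=> None) (eta G) big)).
  under eq_bigr do rewrite smallE bigE.
  case: ltnP => rn /=.
    rewrite (bigD1 set0) //= eqxx addr0 big1 ?addr0 // => G ne.
    by rewrite (negPf ne) addr0.
  under eq_bigr do rewrite add0r.
  have n1r : (n1 <= size r)%N by move: rn; rewrite /n0; lia.
  apply: sum_graphs => //; try by move: rn; rewrite /n0; lia.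
  move=> es acc; apply: leq_trans (TK _ n1r).
  have [_ Tmax] := timeT (code_length tau (size r)); apply: (Tmax (word d r)).
    rewrite size_map /bits size_flatten /shape -map_comp /code_length -map_comp leq_eqVlt.
    apply/orP; left; apply/eqP; congr sumn; apply: eq_map => R /=.
    by rewrite size_map size_lex_tuples.
  by move: acc; rewrite /accepting /computation; case: run.
Qed.

End Assembly.

(** * Structures without order *)

Section Expansion.
Variables (S : pzSemiRingType) (tau : vocabulary).

Definition expand (A : structure tau) (I : {set 2.-tuple A}) : structure (with_lt tau) :=
  @Structure (with_lt tau) A
    (fun R => match R return {set (arity (R : sym (with_lt tau))).-tuple A} with
              | Some R => interp A R | None => I end).

Definition order_set (A : finType) (lt : rel A) : {set 2.-tuple A} :=
  [set t | lt (tnth t ord0) (tnth t ord_max)].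

Lemma ltA_order_set (A : structure tau) (lt : rel A) :
  ltA (expand (order_set lt)) = lt.
Proof. by apply/funext => x; apply/funext => y; rewrite /ltA /= inE. Qed.

Lemma linear_enumerates (A : structure (with_lt tau)) :
  linear_order (ltA A) -> enumerates (order_enum (ltA A)).
Proof.
move=> lin; split; first exact: order_enum_uniq.
  by move=> a; exact: mem_order_enum.
exact: order_enum_lt.
Qed.

Fixpoint blift (f : bformula tau) : bformula (with_lt tau) :=
  match f with
  | BFalse => BFalse _
  | BRel R xs => @BRel (with_lt tau) (Some R) xs
  | BVar X xs => @BVar (with_lt tau) X xs
  | BEq x y => BEq _ x y
  | BNot f => BNot (blift f)
  | BOr f g => BOr (blift f) (blift g)
  | BEx x f => BEx x (blift f)
  | BExSO X f => BExSO X (blift f)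
  end.

Fixpoint wlift (f : wformula S tau) : wformula S (with_lt tau) :=
  match f with
  | WBool f => WBool S (blift f)
  | WConst x => WConst _ x
  | WAdd f g => WAdd (wlift f) (wlift g)
  | WMul f g => WMul (wlift f) (wlift g)
  | WSum x f => WSum x (wlift f)
  | WProd x f => WProd x (wlift f)
  | WSumSO X f => WSumSO X (wlift f)
  | WProdSO X f => WProdSO X (wlift f)
  end.

Definition Xlt : sovar := (1%N, 2%N).

Fixpoint bdrop (f : bformula (with_lt tau)) : bformula tau :=
  match f with
  | BFalse => BFalse _
  | BRel R xs =>
      match R return (arity (R : sym (with_lt tau))).-tuple nat -> bformula tau with
      | Some R => fun xs => BRel (R := R) xs
      | None => fun xs => BVar tau (X := Xlt) xs
      end xs
  | BVar X xs => @BVar tau X xs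
  | BEq x y => BEq _ x y
  | BNot f => BNot (bdrop f)
  | BOr f g => BOr (bdrop f) (bdrop g)
  | BEx x f => BEx x (bdrop f)
  | BExSO X f => BExSO X (bdrop f)
  end.

Fixpoint wdrop (f : wformula S (with_lt tau)) : wformula S tau :=
  match f with
  | WBool f => WBool S (bdrop f)
  | WConst x => WConst _ x
  | WAdd f g => WAdd (wdrop f) (wdrop g)
  | WMul f g => WMul (wdrop f) (wdrop g)
  | WSum x f => WSum x (wdrop f)
  | WProd x f => WProd x (wdrop f)
  | WSumSO X f => WSumSO X (wdrop f)
  | WProdSO X f => WProdSO X (wdrop f)
  end.

Lemma blift_fo f : bfirst_order (blift f) = bfirst_order f.
Proof. by elim: f => //= f -> g ->. Qed.

Lemma wlift_fo f : wfirst_order (wlift f) = wfirst_order f.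
Proof. by elim: f => //= [f|f -> g ->|f -> g ->] //; rewrite blift_fo. Qed.

Lemma blift_closed f V W : bclosed V W (blift f) = bclosed V W f.
Proof. by elim: f V W => //= f IHf g IHg V W; rewrite IHf IHg. Qed.

Lemma wlift_closed f V W : wclosed V W (wlift f) = wclosed V W f.
Proof. by elim: f V W => //= [f V W|f IHf g IHg V W|f IHf g IHg V W]; rewrite ?blift_closed ?IHf ?IHg. Qed.

Lemma bdrop_fo f : bfirst_order (bdrop f) = bfirst_order f.
Proof. by elim: f => //= [[R|] xs|f -> g ->]. Qed.

Lemma wdrop_fo f : wfirst_order (wdrop f) = wfirst_order f.
Proof. by elim: f => //= [f|f -> g ->|f -> g ->] //; rewrite bdrop_fo. Qed.

Lemma bdrop_closed f V W : bclosed V W f -> bclosed V (Xlt :: W) (bdrop f).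
Proof.
elim: f V W => //= [[R|] xs|X xs|f IHf g IHg|x f IH|X f IH] V W //=.
- by rewrite in_cons => /andP[-> ->]; rewrite orbT.
- by case/andP => /IHf-> /IHg->.
- exact: IH.
- move=> /IH; apply: bclosed_sub => // Y; rewrite !in_cons.
  by case/or3P => ->; rewrite ?orbT.
Qed.

Lemma wdrop_closed f V W : wclosed V W f -> wclosed V (Xlt :: W) (wdrop f).
Proof.
elim: f V W => //= [f|f IHf g IHg|f IHf g IHg|x f IH|x f IH|X f IH|X f IH] V W.
- exact: bdrop_closed.
- by case/andP => /IHf-> /IHg->.
- by case/andP => /IHf-> /IHg->.
- exact: IH.
- exact: IH.
- move=> /IH; apply: wclosed_sub => // Y; rewrite !in_cons.
  by case/or3P => ->; rewrite ?orbT.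
- move=> /IH; apply: wclosed_sub => // Y; rewrite !in_cons.
  by case/or3P => ->; rewrite ?orbT.
Qed.

Lemma blift_sem (A : structure tau) (I : {set 2.-tuple A}) (f : bformula tau) rho
    (eta : so_assignment A) :
  @bsem (with_lt tau) (expand I) rho eta (blift f) = @bsem tau A rho eta f.
Proof.
elim: f rho eta => //= [f IH|f IHf g IHg|x f IH|X f IH] rho eta; rewrite ?IH ?IHf ?IHg //.
- by apply: eq_existsb => a; rewrite IH.
- by apply: eq_existsb => J; rewrite IH.
Qed.

Lemma wlift_sem (A : structure tau) (I : {set 2.-tuple A}) r (f : wformula S tau) rho
    (eta : so_assignment A) :
  @wsem S (with_lt tau) (expand I) r rho eta (wlift f) = @wsem S tau A r rho eta f.
Proof.
elim: f rho eta => //= [f|f IHf g IHg|f IHf g IHg|x f IH|x f IH|X f IH|X f IH] rho eta;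
  rewrite ?blift_sem ?IHf ?IHg //; by apply: eq_bigr => a _; rewrite IH.
Qed.

Lemma bdrop_sem (A : structure tau) (I : {set 2.-tuple A}) (f : bformula (with_lt tau)) rho
    (eta : so_assignment A) : bfirst_order f -> eta Xlt = I ->
  bsem rho eta (bdrop f) = @bsem (with_lt tau) (expand I) rho eta f.
Proof.
move=> + EI; elim: f rho => //= [[R|] xs|f IH|f IHf g IHg|x f IH] rho.
- by [].
- by move=> _; rewrite /= EI.
- by move=> fo; rewrite IH.
- by case/andP => ffo gfo; rewrite IHf ?IHg.
- by move=> fo; apply: eq_existsb => a; rewrite IH.
Qed.

Lemma wdrop_sem (A : structure tau) (I : {set 2.-tuple A}) r (f : wformula S (with_lt tau)) rho
    (eta : so_assignment A) : wfirst_order f -> eta Xlt = I ->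
  wsem r rho eta (wdrop f) = @wsem S (with_lt tau) (expand I) r rho eta f.
Proof.
move=> + EI; elim: f rho => //= [f|f IHf g IHg|f IHf g IHg|x f IH|x f IH] rho.
- by move=> fo; rewrite (bdrop_sem _ fo EI).
- by case/andP => ffo gfo; rewrite IHf ?IHg.
- by case/andP => ffo gfo; rewrite IHf ?IHg.
- by move=> fo; apply: eq_bigr => a _; rewrite IH.
- by move=> fo; apply: eq_bigr => a _; rewrite IH.
Qed.

End Expansion.

Section Invariance.
Variables (S : pzSemiRingType) (tau : vocabulary) (A : structure tau).

Lemma bsem_eq_eta (f : bformula tau) rho (eta eta' : so_assignment A) V W :
  bfirst_order f -> bclosed V W f -> (forall X, X \in W -> eta X = eta' X) ->
  bsem rho eta f = bsem rho eta' f.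
Proof.
move=> + + E; elim: f V rho => //= [X xs|f IH|f IHf g IHg|x f IH] V rho.
- by move=> _ /andP[/E-> _].
- by move=> fo cl; rewrite (IH V).
- by case/andP => ffo gfo /andP[fcl gcl]; rewrite (IHf V) ?(IHg V).
- by move=> fo cl; apply: eq_existsb => a; rewrite (IH (x :: V)).
Qed.

Lemma wsem_eq_eta r (f : wformula S tau) rho (eta eta' : so_assignment A) V W :
  wfirst_order f -> wclosed V W f -> (forall X, X \in W -> eta X = eta' X) ->
  wsem r rho eta f = wsem r rho eta' f.
Proof.
move=> + + E; elim: f V rho => //= [f|f IHf g IHg|f IHf g IHg|x f IH|x f IH] V rho.
- by move=> fo cl; rewrite (bsem_eq_eta _ fo cl E).
- by case/andP => ffo gfo /andP[fcl gcl]; rewrite (IHf V) ?(IHg V).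
- by case/andP => ffo gfo /andP[fcl gcl]; rewrite (IHf V) ?(IHg V).
- by move=> fo cl; apply: eq_bigr => a _; rewrite (IH (x :: V)).
- by move=> fo cl; apply: eq_bigr => a _; rewrite (IH (x :: V)).
Qed.

Hypothesis mulSC : forall s t : S, s * t = t * s.

Lemma prod_perm (T : eqType) (F : T -> S) r r' : perm_eq r r' ->
  \prod_(a <- r) F a = \prod_(a <- r') F a.
Proof.
elim: r r' => [|a r IH] r' rr'; first by move: rr'; rewrite perm_sym => /perm_nilP->.
have [s [s' E]] : exists s s', r' = s ++ a :: s'.
  have : a \in r' by rewrite -(perm_mem rr') mem_head.
  by case/splitPr => s s'; exists s, s'.
rewrite E big_cat !big_cons /= mulrA (mulSC _ (F a)) -mulrA -big_cat; congr (_ * _).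
apply: IH; rewrite -(perm_cons a); apply: (perm_trans rr').
by rewrite E perm_catC /= perm_cons perm_catC.
Qed.

Lemma wsem_perm r r' (f : wformula S tau) rho (eta : so_assignment A) : wfirst_order f ->
  perm_eq r r' -> wsem r rho eta f = wsem r' rho eta f.
Proof.
move=> + rr'; elim: f rho => //= [f IHf g IHg|f IHf g IHg|x f IH|x f IH] rho.
- by case/andP => ffo gfo; rewrite IHf ?IHg.
- by case/andP => ffo gfo; rewrite IHf ?IHg.
- by move=> fo; apply: eq_bigr => a _; rewrite IH.
- move=> fo; rewrite (prod_perm _ rr'); apply: eq_bigr => a _; exact: IH.
Qed.

Lemma wsem_perm_sums r r' Xs (f : wformula S tau) rho (eta : so_assignment A) : wfirst_order f ->
  perm_eq r r' ->
  wsem r rho eta (foldr (@WSumSO S tau) f Xs) = wsem r' rho eta (foldr (@WSumSO S tau) f Xs).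
Proof.
move=> fo rr'; elim: Xs eta => [|X Xs IH] eta /=; first exact: wsem_perm.
by apply: eq_bigr => I _; rewrite IH.
Qed.

End Invariance.

Section LinearFormula.
Variable tau : vocabulary.

Definition BXlt (x y : nat) : bformula tau := @BVar tau Xlt [tuple x; y].

Definition linear_formula : bformula tau :=
  BNot (BOr (BEx 0 (BXlt 0 0))
    (BOr (BEx 0 (BEx 1 (BEx 2 (BNot (BOr (BNot (BXlt 0 1)) (BOr (BNot (BXlt 1 2)) (BXlt 0 2)))))))
      (BEx 0 (BEx 1 (BNot (BOr (BEq _ 0 1) (BOr (BXlt 0 1) (BXlt 1 0)))))))).

Lemma linear_formulaP (A : structure tau) (I : {set 2.-tuple A}) (eta : so_assignment A) :
  eta Xlt = I ->
  bsem (fun=> None) eta linear_formula <-> linear_order (fun x y : A => [tuple x; y] \in I).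
Proof.
move=> EI; pose lt := fun x y : A => [tuple x; y] \in I.
have LTE rho x y a c : rho x = Some a -> rho y = Some c -> bsem rho eta (BXlt x y) = lt a c.
  move=> xa yc; rewrite /BXlt [LHS](@exists_tupleE _ 2 _ _ _ [tuple a; c]) ?EI //=.
  by rewrite xa yc.
have EQE rho x y (a c : A) : rho x = Some a -> rho y = Some c -> bsem rho eta (BEq _ x y) = (a == c).
  move=> xa yc /=; rewrite xa yc; apply/existsP/eqP => [[z /andP[/eqP[->] /eqP[->]]] //|->].
  by exists c; rewrite eqxx.
have -> : bsem (fun=> None) eta linear_formula =
  ~~ ([exists a, lt a a] || ([exists a, exists c, exists e, ~~ (~~ lt a c || (~~ lt c e || lt a e))] ||
      [exists a, exists c, ~~ ((a == c) || (lt a c || lt c a))])).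
  rewrite -[LHS]/(~~ ([exists a, bsem [eta (fun=> None) with 0%N |-> Some a] eta (BXlt 0 0)] ||
    ([exists a, exists c, exists e, ~~ (~~ bsem [eta [eta [eta (fun=> None) with 0%N |-> Some a] with 1%N |-> Some c] with 2%N |-> Some e] eta (BXlt 0 1) ||
       (~~ bsem [eta [eta [eta (fun=> None) with 0%N |-> Some a] with 1%N |-> Some c] with 2%N |-> Some e] eta (BXlt 1 2) ||
        bsem [eta [eta [eta (fun=> None) with 0%N |-> Some a] with 1%N |-> Some c] with 2%N |-> Some e] eta (BXlt 0 2)))] ||
     [exists a, exists c, ~~ (bsem [eta [eta (fun=> None) with 0%N |-> Some a] with 1%N |-> Some c] eta (BEq _ 0 1) ||
      (bsem [eta [eta (fun=> None) with 0%N |-> Some a] with 1%N |-> Some c] eta (BXlt 0 1) ||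
       bsem [eta [eta (fun=> None) with 0%N |-> Some a] with 1%N |-> Some c] eta (BXlt 1 0)))]))).
  congr (~~ (_ || (_ || _))); apply: eq_existsb => a; first by rewrite (LTE _ _ _ a a).
    apply: eq_existsb => c; apply: eq_existsb => e.
    by rewrite (LTE _ _ _ a c) // (LTE _ _ _ c e) // (LTE _ _ _ a e).
  apply: eq_existsb => c.
  by rewrite (EQE _ _ _ a c) // (LTE _ _ _ a c) // (LTE _ _ _ c a).
rewrite !negb_or; split.
  case/and3P => /existsPn irr /existsPn tr /existsPn tot; split.
  - by move=> a; apply/negbTE/irr.
  - move=> c a e ac ce; move: (tr a) => /existsPn/(_ c)/existsPn/(_ e).
    by rewrite negbK => /orP[|/orP[|//]]; rewrite /lt ?ac ?ce.
  - move=> a c ac; move: (tot a) => /existsPn/(_ c).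
    by rewrite negbK (negPf ac).
case=> irr tr tot; apply/and3P; split; apply/existsPn => a.
- by rewrite /lt irr.
- apply/existsPn => c; apply/existsPn => e; rewrite negbK.
  case ac: (lt a c) => //=; case ce: (lt c e) => //=; exact: tr ac ce.
- apply/existsPn => c; rewrite negbK; have [//|ac] := eqVneq a c.
  exact: tot.
Qed.

End LinearFormula.

Lemma idempotent_sum (S : pzSemiRingType) (T : finType) (Q : pred T) (x : S) :
  (forall s : S, s + s = s) -> (exists i, Q i) -> \sum_(i | Q i) x = x.
Proof.
move=> idem [i Qi]; rewrite sumr_const.
have : (0 < #|Q|)%N by apply/card_gt0P; exists i.
case: #|_| => // m _; elim: m => [|m IH]; first by rewrite mulr1n.
by rewrite mulrS IH idem.
Qed.

Theorem theorem12 (S : pzSemiRingType) (tau : vocabulary)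
    (htau : exists R : sym tau, (0 < arity R)%N) :
  ((forall phi : wformula S (with_lt tau), wESO phi -> sentence phi ->
      exists P : seq bool -> S, NP P /\
        forall A : ordered_structure tau,
          P (@enc tau (reduct A) (ltA A)) = ovalue A phi) /\
   (forall (Sigma : finType) (d : bool -> Sigma), injective d ->
      forall P : seq Sigma -> S, NP P ->
      exists phi : wformula S (with_lt tau),
        [/\ wESO phi, sentence phi &
          forall A : ordered_structure tau,
            P (map d (@enc tau (reduct A) (ltA A))) = ovalue A phi])) /\
  ((forall s : S, s + s = s) -> (forall s t : S, s * t = t * s) ->
   (forall phi : wformula S tau, wESO phi -> sentence phi ->
      exists P : seq bool -> S, NP P /\
        forall (A : structure tau) (lt : rel A), linear_order lt ->
          P (enc lt) = value A phi) /\
   (forall (Sigma : finType) (d : bool -> Sigma), injective d ->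
      forall P : seq Sigma -> S, NP P -> order_invariant tau d P ->
      exists phi : wformula S tau,
        [/\ wESO phi, sentence phi &
          forall (A : structure tau) (lt : rel A), linear_order lt ->
            P (map d (enc lt)) = value A phi])).
Proof.
split; [split|move=> idem mulSC; split].
- move=> phi phiW phiS; have [P [PN PE]] := wESO_NP htau phiW phiS.
  by exists P; split=> // A; apply: PE; exact: ltA_linear.
- move=> Sigma d _ P PN; have [b [psi [fo cl psiE]]] := NP_wESO htau d PN.
  exists (WSumSO (Xb b) psi); split=> //; first by exists [:: Xb b], psi.
  move=> A; rewrite /ovalue psiE //; exact/linear_enumerates/ltA_linear.
- move=> phi [Xs [psi [fo phiE]]] cl.
  have lE : wlift phi = foldr (@WSumSO S _) (wlift psi) Xs.
    by rewrite phiE; elim: (Xs) => //= X Ys ->.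
  have [||P [PN PE]] := @wESO_NP S tau htau (wlift phi).
  + by exists Xs, (wlift psi); rewrite wlift_fo.
  + by rewrite /sentence wlift_closed.
  exists P; split=> // A lt lin; have := PE (expand (order_set lt)).
  rewrite ltA_order_set => /(_ lin) H; rewrite [LHS]H /value_along wlift_sem /value /value_along phiE.
  apply: wsem_perm_sums => //; apply: uniq_perm; rewrite ?enum_uniq ?order_enum_uniq //.
  by move=> a; rewrite mem_order_enum mem_enum.
- move=> Sigma d _ P PN inv; have [b [psi [fo cl psiE]]] := NP_wESO htau d PN.
  pose theta := WMul (WBool S (linear_formula tau)) (wdrop psi).
  exists (WSumSO Xlt (WSumSO (Xb b) theta)); split.
  + by exists [:: Xlt; Xb b], theta; rewrite /= wdrop_fo.
  + rewrite /sentence /=; apply: wclosed_sub (wdrop_closed cl) => // Y.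
    by rewrite !in_cons => /or3P[] ->; rewrite ?orbT.
  move=> A lt lin; apply/esym.
  pose eta0 : so_assignment A := fun X => set0.
  pose eta1 (I : {set 2.-tuple A}) : so_assignment A :=
    dfwith (T := fun X : sovar => {set (ar X).-tuple A}) eta0 (i := Xlt) I.
  pose eta2 I (G : {set b.-tuple A}) : so_assignment A :=
    dfwith (T := fun X : sovar => {set (ar X).-tuple A}) (eta1 I) (i := Xb b) G.
  have eta2E I G : eta2 I G Xlt = I.
    by rewrite /eta2 dfwith_out ?/eta1 ?dfwith_in.
  rewrite -[LHS]/(\sum_(I : {set 2.-tuple A}) \sum_(G : {set b.-tuple A})
    ((if bsem (fun=> None) (eta2 I G) (linear_formula tau) then 1 else 0) *
     wsem (enum A) (fun=> None) (eta2 I G) (wdrop psi))).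
  pose linear (I : {set 2.-tuple A}) := `[< linear_order (ltA (expand I)) >].
  transitivity (\sum_(I : {set 2.-tuple A} | linear I) P (map d (enc lt))).
    rewrite [RHS]big_mkcond; apply: eq_bigr => I _.
    have linE G : bsem (fun=> None) (eta2 I G) (linear_formula tau) = linear I.
      by apply/idP/asboolP => [/(linear_formulaP (eta2E I G))|H]; last exact/(linear_formulaP (eta2E I G)).
    under eq_bigr do rewrite linE; case: ifP => /asboolP linI; last first.
      by rewrite big1 // => G _; rewrite mul0r.
    rewrite (inv A lt (ltA (expand I)) lin linI).
    rewrite -[map d _]/(word d (order_enum (ltA (expand I)))) -psiE; last exact: linear_enumerates.
    apply: eq_bigr => G _; rewrite mul1r (wdrop_sem _ _ fo (eta2E I G)).
    have pe : @perm_eq (expand I) (enum A) (order_enum (ltA (expand I))).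
      apply: uniq_perm; rewrite ?enum_uniq ?order_enum_uniq // => a.
      by rewrite mem_order_enum mem_enum.
    rewrite (wsem_perm mulSC _ _ fo pe).
    apply: (wsem_eq_eta _ _ fo cl) => X; rewrite inE => /eqP->.
    by rewrite /eta2 !dfwith_in.
  apply: idempotent_sum => //; exists (order_set lt).
  by apply/asboolP; rewrite ltA_order_set.
Qed.
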